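(* Let $(M,\xi,J)$ be a closed spherical $CR$ $3$-manifold. Suppose $\hat\theta$ is a contact form on $M$ which together with $J$ defines a positive pseudohermitian structure with vanishing torsion and positive Tanaka-Webster curvature. Let $\theta_{(t)}$, $t\in[0,t_{\max})$, be a smooth solution of the Yamabe flow $\partial_t\theta_{(t)}=-2W_{(t)}\theta_{(t)}$ with $\theta_{(0)}=\hat\theta$, where $W(\cdot,t)=W_{(t)}$ is the Tanaka-Webster curvature of $(J,\theta_{(t)})$. Then for all points $x_1,x_2\in M$ and times $0<t_1<t_2<t_{\max}$, $$\frac{W(x_2,t_2)}{W(x_1,t_1)}\ \ge\ \Big(\frac{t_2}{t_1}\Big)^{-2}\exp\Big(-\frac1{16}L\Big),\qquad L=\inf_\gamma\int_{t_1}^{t_2}|\dot\gamma(t)|^2_{J,\theta_{(t)}}\,dt,$$ where the infimum is taken over all Legendrian paths $\gamma:[t_1,t_2]\to M$ with $\gamma(t_1)=x_1$ and $\gamma(t_2)=x_2$.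
   Context: Closed means compact without boundary. $M$ is a smooth $3$-manifold with an oriented contact structure $\xi\subset TM$; $J:\xi\to\xi$ is a smooth endomorphism with $J^2=-\mathrm{id}$ (a $CR$ structure compatible with $\xi$). $J$ is spherical if $(M,\xi,J)$ is locally $CR$ equivalent to the standard sphere $S^3\subset\mathbb C^2$ (equivalently, its Cartan curvature tensor vanishes). A pseudohermitian structure $(J,\theta)$ is $J$ together with a global contact form $\theta$ for $\xi$. $T$ is the characteristic vector field: $\theta(T)=1$, $d\theta(T,\cdot)=0$. Choose (locally) a complex vector field $Z_1$ in $\xi\otimes\mathbb C$ with $JZ_1=iZ_1$, put $Z_{\bar1}=\overline{Z_1}$, and let $\{\theta,\theta^1,\theta^{\bar1}\}$ be the coframe dual to $\{T,Z_1,Z_{\bar1}\}$; then $d\theta=ih_{1\bar1}\theta^1\wedge\theta^{\bar1}$ with $h_{1\bar1}$ real and nonzero. $(J,\theta)$ is positive if $h_{1\bar1}>0$, and then $Z_1$ is chosen so that $h_{1\bar1}=1$, i.e. $d\theta=i\theta^1\wedge\theta^{\bar1}$. The connection form $\omega_1{}^1$ and the torsion $A^1{}_{\bar1}$ are determined by $d\theta^1=\theta^1\wedge\omega_1{}^1+A^1{}_{\bar1}\theta\wedge\theta^{\bar1}$ and $\omega_1{}^1+\omega_{\bar1}{}^{\bar1}=0$, where $\omega_{\bar1}{}^{\bar1}=\overline{\omega_1{}^1}$; $A_{\bar1\bar1}=A^1{}_{\bar1}$ and $A_{11}=\overline{A_{\bar1\bar1}}$. The Tanaka-Webster curvature $W$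 is the real function defined by $d\omega_1{}^1=W\theta^1\wedge\theta^{\bar1}+2i\,\mathrm{Im}(A_{11,\bar1}\theta^1\wedge\theta)$, where $A_{11,\bar1}$ is the covariant derivative of $A_{11}$ in the direction $Z_{\bar1}$. Levi form: for $V=v_1Z_{\bar1}+v_{\bar1}Z_1$, $U=u_1Z_{\bar1}+u_{\bar1}Z_1$ in $\xi$, $\langle V,U\rangle_{J,\theta}=v_1u_{\bar1}+v_{\bar1}u_1$, and $|V|^2_{J,\theta}=\langle V,V\rangle_{J,\theta}$. A Legendrian path is a smooth path whose velocity $\dot\gamma$ lies in $\xi$ at each time. *)

(* Defs.v *)
From HB Require Import structures.
From mathcomp Require Export all_boot all_order all_algebra.
From mathcomp Require Export all_classical all_reals all_analysis.
From mathcomp Require Export complex.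

Set Implicit Arguments.
Unset Strict Implicit.
Unset Printing Implicit Defensive.

Export Order.TTheory GRing.Theory Num.Theory numFieldNormedType.Exports.

Local Open Scope classical_set_scope.
Local Open Scope ring_scope.

Section Smooth.
Context {R : realType} {V W : normedModType R}.

(* All iterated directional derivatives of order <= k exist and are continuous
   on U.  Only used with V finite dimensional and U open, where this is the
   usual class C^k. *)
Fixpoint Ck (k : nat) (U : set V) (f : V -> W) : Prop :=
  (forall x, U x -> {for x, continuous f}) /\
  match k with
  | 0%N => True
  | k'.+1 => forall v : V,
      (forall x, U x -> derivable f x v) /\ Ck k' U (fun x => 'D_v f x)
  end.

Definition smooth_open (U : set V) (f : V -> W) : Prop := forall k, Ck k U f.

(* Smoothness on an arbitrary subset: f extends smoothly to a neighbourhood of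
   each point.  This covers half-open time intervals and paths on segments. *)
Definition smooth_on (A : set V) (f : V -> W) : Prop :=
  forall x, A x -> exists O (g : V -> W),
    [/\ open O, O x, smooth_open O g & forall y, A y -> O y -> f y = g y].

End Smooth.

(* Derivative at t of c : I -> V, one-sided at the end points of I. *)
Definition deriv_in {R : realType} {V : normedModType R}
    (I : set R) (c : R -> V) (t : R) : V :=
  lim ((fun h : R => h^-1 *: (c (t + h) - c t))
         @ within [set h | I (t + h)] 0^').

(* A chart c is the homeomorphism [coord c] of the open set [dom c] onto the
   open set [img c] of R^n; [param c] is its inverse.  The values of [coord c]
   off [dom c] and of [param c] off [img c] are irrelevant. *)
Record manifold (R : realType) (n : nat) := Manifold {
  carrier :> topologicalType;
  carrier_hausdorff : hausdorff_space carrier;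
  carrier_countable : @second_countable carrier;
  chart : Type;
  dom : chart -> set carrier;
  coord : chart -> carrier -> 'rV[R]_n;
  param : chart -> 'rV[R]_n -> carrier;
  dom_open : forall c, open (dom c);
  dom_cover : forall p, exists c, dom c p;
  img_open : forall c, open (coord c @` dom c);
  coordK : forall c p, dom c p -> param c (coord c p) = p;
  coord_continuous : forall c p, dom c p -> {for p, continuous (coord c)};
  param_continuous : forall c x, (coord c @` dom c) x ->
    {for x, continuous (param c)};
  transition_smooth : forall c d,
    smooth_open (coord c @` (dom c `&` dom d)) (coord d \o param c)
}.

Definition img {R : realType} {n : nat} {M : manifold R n} (c : chart M) :
  set 'rV[R]_n := coord c @` dom c.

(* Differential at x of the transition map from the chart c to the chart d. *)
Definition push {R : realType} {n : nat} {M : manifold R n} (c d : chart M)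
  (x v : 'rV[R]_n) : 'rV[R]_n := 'D_v (coord d \o param c) x.

Section Forms.
Context {R : realType} {n : nat}.
Local Notation C := R[i].

(* Tangent vectors and 1-forms at a point are row vectors, 2-forms are
   antisymmetric matrices B with B i j = B(e_i, e_j). *)
Definition pairing {K : comNzRingType} (a v : 'rV[K]_n) : K :=
  \sum_(i < n) a 0 i * v 0 i.

Definition ev2 {K : comNzRingType} (B : 'M[K]_n) (u v : 'rV[K]_n) : K :=
  \sum_(i < n) \sum_(j < n) u 0 i * B i j * v 0 j.

Definition wedge11 {K : comNzRingType} (a b : 'rV[K]_n) : 'M[K]_n :=
  \matrix_(i, j) (a 0 i * b 0 j - a 0 j * b 0 i).

(* (a /\ B)(u, v, w) for a 1-form a and a 2-form B. *)
Definition wedge12 {K : comNzRingType} (a : 'rV[K]_n) (B : 'M[K]_n)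
    (u v w : 'rV[K]_n) : K :=
  pairing a u * ev2 B v w + pairing a v * ev2 B w u + pairing a w * ev2 B u v.

Definition pderiv (i : 'I_n) (f : 'rV[R]_n -> R) (x : 'rV[R]_n) : R :=
  'D_(delta_mx 0 i) f x.

Definition grad (f : 'rV[R]_n -> R) (x : 'rV[R]_n) : 'rV[R]_n :=
  \row_i pderiv i f x.

Definition extd (a : 'rV[R]_n -> 'rV[R]_n) (x : 'rV[R]_n) : 'M[R]_n :=
  \matrix_(i, j) (pderiv i (fun y => a y 0 j) x
                  - pderiv j (fun y => a y 0 i) x).

Definition cmx {p q : nat} (A : 'M[R]_(p, q)) : 'M[C]_(p, q) :=
  map_mx (fun r : R => (r%:C)%C) A.
Definition mxRe {p q : nat} (A : 'M[C]_(p, q)) : 'M[R]_(p, q) :=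
  map_mx (@complex.Re R) A.
Definition mxIm {p q : nat} (A : 'M[C]_(p, q)) : 'M[R]_(p, q) :=
  map_mx (@complex.Im R) A.
Definition mxconj {p q : nat} (A : 'M[C]_(p, q)) : 'M[C]_(p, q) :=
  map_mx (fun z : C => conjc z) A.

Definition ii : C := Complex 0 1.

Definition gradC (f : 'rV[R]_n -> C) (x : 'rV[R]_n) : 'rV[C]_n :=
  cmx (grad (fun y => complex.Re (f y)) x)
  + ii *: cmx (grad (fun y => complex.Im (f y)) x).

Definition extdC (a : 'rV[R]_n -> 'rV[C]_n) (x : 'rV[R]_n) : 'M[C]_n :=
  cmx (extd (fun y => mxRe (a y)) x) + ii *: cmx (extd (fun y => mxIm (a y)) x).

Definition smoothC (V : set 'rV[R]_n) (a : 'rV[R]_n -> 'rV[C]_n) : Prop :=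
  smooth_open V (fun x => mxRe (a x)) /\ smooth_open V (fun x => mxIm (a x)).

End Forms.

Section Contact.
Context {R : realType} (M : manifold R 3).

(* A 1-form on M is given by its components in each chart; they matter only at
   points of [img c]. *)
Definition form1 := chart M -> 'rV[R]_3 -> 'rV[R]_3.

Definition is_form1 (a : form1) : Prop :=
  (forall c, smooth_open (img c) (a c)) /\
  (forall c d p, dom c p -> dom d p -> forall v,
     pairing (a c (coord c p)) v
     = pairing (a d (coord d p)) (push c d (coord c p) v)).

Definition plane_field := chart M -> 'rV[R]_3 -> set 'rV[R]_3.

Definition contact_at (P : set 'rV[R]_3) (a : 'rV[R]_3 -> 'rV[R]_3)
    (x : 'rV[R]_3) : Prop :=
  (forall v, P v <-> pairing (a x) v = 0) /\
  (exists u v w, wedge12 (a x) (extd a x) u v w != 0).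

Definition is_contact (xi : plane_field) : Prop :=
  (forall c d p, dom c p -> dom d p -> forall v,
     xi c (coord c p) v <-> xi d (coord d p) (push c d (coord c p) v)) /\
  (forall c x, img c x -> exists V (a : 'rV[R]_3 -> 'rV[R]_3),
     [/\ open V, V x, V `<=` img c, smooth_open V a &
         forall y, V y -> contact_at (xi c y) a y]).

(* J acts on row vectors on the right: J v = v *m J c x.  Only the restriction
   of this matrix to xi is meaningful. *)
Definition is_CR (xi : plane_field) (J : chart M -> 'rV[R]_3 -> 'M[R]_3) :
    Prop :=
  [/\ forall c, smooth_open (img c) (J c),
      forall c x v, img c x -> xi c x v -> xi c x (v *m J c x),
      forall c x v, img c x -> xi c x v -> v *m J c x *m J c x = - v &
      forall c d p v, dom c p -> dom d p -> xi c (coord c p) v ->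
        push c d (coord c p) (v *m J c (coord c p))
        = push c d (coord c p) v *m J d (coord d p)].

End Contact.

(* J orients xi, so that the compatible orientation is not separate data. *)
Record CR3 (R : realType) := MkCR3 {
  mfd :> manifold R 3;
  xi : plane_field mfd;
  xi_contact : is_contact xi;
  Jcr : chart mfd -> 'rV[R]_3 -> 'M[R]_3;
  Jcr_CR : is_CR xi Jcr
}.

Arguments xi {R X} : rename.
Arguments Jcr {R X} : rename.

Section Sphere.
Context {R : realType}.

(* C^2 is 'rV[R]_2 * 'rV[R]_2, with (a, b) standing for a + ib. *)
Local Notation C2 := ('rV[R]_2 * 'rV[R]_2)%type.

Definition mulI (q : C2) : C2 := (- q.2, q.1).
Definition dot (q w : C2) : R := pairing q.1 w.1 + pairing q.2 w.2.
Definition S3 : set C2 := [set q | dot q q = 1].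

(* The CR structure of S^3: its maximal complex tangent planes (with the
   multiplication by i). *)
Definition HS3 (q : C2) : set C2 := [set w | dot q w = 0 /\ dot q (mulI w) = 0].

Definition spherical (X : CR3 R) : Prop :=
  forall (c : chart X) x, img c x ->
  exists V (F : 'rV[R]_3 -> C2),
    [/\ [/\ open V, V x & V `<=` img c],
        (* F is a diffeomorphism of V onto an open subset of S^3 *)
        [/\ smooth_open V F,
            set_inj V F,
            (exists2 O : set C2, open O & F @` V = O `&` S3) &
            forall y v, V y -> 'D_v F y = 0 -> v = 0] &
        forall y v, V y ->
          (xi c y v <-> HS3 (F y) ('D_v F y)) /\
          (xi c y v -> 'D_(v *m Jcr c y) F y = mulI ('D_v F y))].

End Sphere.

Section Pseudohermitian.
Context {R : realType} (X : CR3 R).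
Local Notation C := R[i].
Implicit Types (theta : form1 X) (c : chart X) (x : 'rV[R]_3).

Definition is_contact_form theta : Prop :=
  is_form1 theta /\
  forall c x, img c x -> contact_at (xi c x) (theta c) x.

(* At the point x of the chart c: T is the characteristic vector, Z is Z_1, and
   {theta, th1, conj th1} is the coframe dual to {T, Z_1, Z_{\bar 1}}, with
   d theta = i h th1 /\ conj th1. *)
Definition frame_at theta c x (T : 'rV[R]_3) (Z th1 : 'rV[C]_3) (h : R) :
    Prop :=
  [/\ pairing (theta c x) T = 1 /\ (forall v, ev2 (extd (theta c) x) T v = 0),
      xi c x (mxRe Z) /\ xi c x (mxIm Z),
      Z *m cmx (Jcr c x) = ii *: Z,
      [/\ pairing th1 Z = 1, pairing th1 (mxconj Z) = 0
        & pairing th1 (cmx T) = 0] &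
      cmx (extd (theta c) x) = (ii * (h%:C)%C) *: wedge11 th1 (mxconj th1)].

Definition local_frame theta c (V : set 'rV[R]_3) (T : 'rV[R]_3 -> 'rV[R]_3)
    (Z th1 : 'rV[R]_3 -> 'rV[C]_3) (h : 'rV[R]_3 -> R) : Prop :=
  [/\ open V /\ V `<=` img c, smooth_open V T, smoothC V Z, smoothC V th1 &
      forall x, V x -> frame_at theta c x (T x) (Z x) (th1 x) (h x)].

Definition positive_psh theta : Prop :=
  forall c x, img c x -> exists V T Z th1 h,
    [/\ V x, local_frame theta c V T Z th1 h & forall y, V y -> 0 < h y].

(* The connection form om = omega_1^1 and the torsion A = A^1_{\bar 1} of a
   frame with h = 1. *)
Definition structure_eq theta c (V : set 'rV[R]_3)
    (th1 om : 'rV[R]_3 -> 'rV[C]_3) (A : 'rV[R]_3 -> C) : Prop :=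
  smoothC V om /\
  forall x, V x ->
    om x + mxconj (om x) = 0 /\
    extdC th1 x = wedge11 (th1 x) (om x)
                  + A x *: wedge11 (cmx (theta c x)) (mxconj (th1 x)).

Definition A11 (A : 'rV[R]_3 -> C) (x : 'rV[R]_3) : C := conjc (A x).

(* A_{11,\bar 1} = Z_{\bar 1} A_11 - 2 omega_1^1(Z_{\bar 1}) A_11 *)
Definition A11_1bar (Z om : 'rV[R]_3 -> 'rV[C]_3) (A : 'rV[R]_3 -> C)
    (x : 'rV[R]_3) : C :=
  pairing (gradC (A11 A) x) (mxconj (Z x))
  - 2 * pairing (om x) (mxconj (Z x)) * A11 A x.

Definition vanishing_torsion theta : Prop :=
  forall c x, img c x -> exists V T Z th1 om A,
    [/\ V x, local_frame theta c V T Z th1 (fun=> 1),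
        structure_eq theta c V th1 om A &
        forall y, V y -> A y = 0].

Definition is_TW_curvature theta (W : X -> R) : Prop :=
  forall c x, img c x -> exists V T Z th1 om A,
    [/\ V x, local_frame theta c V T Z th1 (fun=> 1),
        structure_eq theta c V th1 om A &
        forall y, V y ->
          extdC om y =
            ((W (param c y))%:C)%C *: wedge11 (th1 y) (mxconj (th1 y))
            + (2 * ii) *: cmx (mxIm (A11_1bar Z om A y *:
                                     wedge11 (th1 y) (cmx (theta c y))))].

(* r = <u, v>_{J, theta}, from V = v_1 Z_{\bar 1} + v_{\bar 1} Z_1 in a frame
   with h = 1. *)
Definition is_levi theta c x (v u : 'rV[R]_3) (r : R) : Prop :=
  exists T Z th1 (v1 v1b u1 u1b : C),
    [/\ frame_at theta c x T Z th1 1,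
        cmx v = v1 *: mxconj Z + v1b *: Z,
        cmx u = u1 *: mxconj Z + u1b *: Z &
        (r%:C)%C = v1 * u1b + v1b * u1].

Definition time_range (tmax : \bar R) : set R :=
  [set t | 0 <= t /\ (t%:E < tmax)%E].

Definition yamabe_flow (tmax : \bar R) (theta : R -> form1 X)
    (W : R -> X -> R) : Prop :=
  [/\ forall c, smooth_on (V := ('rV[R]_3 * R)%type)
        (img c `*` time_range tmax) (fun z => theta z.2 c z.1),
      forall t, time_range tmax t -> is_contact_form (theta t),
      forall t, time_range tmax t -> is_TW_curvature (theta t) (W t) &
      forall c x t, img c x -> time_range tmax t ->
        deriv_in (time_range tmax) (fun s => theta s c x) t
        = (- 2 * W t (param c x)) *: theta t c x].

Definition velocity (I : set R) (g : R -> X) c (t : R) : 'rV[R]_3 :=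
  deriv_in I (fun s => coord c (g s)) t.

Definition legendrian (t1 t2 : R) (g : R -> X) : Prop :=
  [/\ {within `[t1, t2], continuous g},
      forall c,
        smooth_on (`[t1, t2] `&` g @^-1` dom c) (fun s => coord c (g s)) &
      forall c t, `[t1, t2]%classic t -> dom c (g t) ->
        xi c (coord c (g t)) (velocity `[t1, t2] g c t)].

(* |g'(t)|^2_{J, theta}: the value does not depend on the chart and frame. *)
Definition speed2 theta (t1 t2 : R) (g : R -> X) (t : R) : R :=
  xget 0 [set r | exists c, dom c (g t) /\
    let v := velocity `[t1, t2] g c t in
    is_levi theta c (coord c (g t)) v v r].

(* +oo when no Legendrian path joins p1 to p2. *)
Definition inf_energy (theta : R -> form1 X) (t1 t2 : R) (p1 p2 : X) : \bar R :=
  ereal_inf [set (\int[@lebesgue_measure R]_(t in `[t1, t2])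
                    (speed2 (theta t) t1 t2 g t)%:E)%E
            | g in [set g | [/\ legendrian t1 t2 g, g t1 = p1 & g t2 = p2]]].

End Pseudohermitian.

(* Main.v *)
From HB Require Import structures.
Require Import Defs.
From mathcomp Require Import ring lra.

(** Write w for the curvature of the initial form.  That form is locally a multiple of the
    form of the sphere by a factor u, and u_11 = 0 because both are torsion-free; the formula for
    the curvature of a conformal form then yields w_11 = 0.
    Together with T w = 0 this makes 2 w_{1 1b} + w^2 and a cubic expression in w and |w_1|^2
    locally constant, and on the (clopen, compact) set K where they take given values
    [6 |w_1|^2 = -(w - w1) (w - w2) (w + w1 + w2)] with w1, w2 the extrema of w on K.

    Hence the flow stays in a two-dimensional family: with thetahat = f theta_t, the function
    f = alpha + beta w solves the flow on K as soon as (alpha, beta) solves an autonomous ODE,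
    whose solution is explicit up to one quadrature.  The maximum principle shows that f has
    this form for all times of existence, so W is an explicit Moebius function E(w, t) of w.
    In terms of e_i = E(w_i, t), with [e_i' = 4 (e1^2 + e1 e2 + e2^2) / 3 - 2 e_i^2], the
    Harnack quantity at a fixed time is smallest at the maximum of E, where it is bounded below
    because [1 / e1] is concave in t, the quotient [e2 / e1] being nondecreasing.

    Along a Legendrian path, (d/dt w)^2 is at most the product of |gamma'|^2 and |w_1|^2, so
    the arithmetic-geometric mean inequality bounds the derivative of ln W from below by
    [- 2 / t - |gamma'|^2 / 16], and the theorem follows by integration. *)

Set Implicit Arguments.
Unset Strict Implicit.
Unset Printing Implicit Defensive.

Local Open Scope classical_set_scope.
Local Open Scope ring_scope.

(** * Pseudohermitian frames and conformal change *)

(** Curvature and torsion are defined through local frames whose existence is asserted separately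
    for each notion, chart and point. A frame over a small open set is therefore encoded as three
    derivations of a commutative ring of smooth functions, where tensor identities become [ring]
    identities, and whatever is kept from it has to be independent of the frame: the Laplacian and
    the gradient norm of w, hence the two constants. The manifold may have several components with
    different constants, whence the sets K. Affine functions of w survive the flow because the terms
    in w^2 and w^3 cancel in the curvature formula for f = alpha + beta w; thus f' = 2 W f closes up
    as an ODE for alpha and beta. The life spans of this ODE and of the flow are unrelated a priori.
    They are compared through blow-up: the explicit alpha exceeds every bound before the ODE ends,
    while f is bounded on K over every compact time interval on which the flow exists. *)

(* The algebra of a pseudohermitian frame: Z, Zb, T act as derivations, with
   p = om(Z), pb = - om(Zb), q = om(T), a = A_11 and ab = conj A_11 in terms of
   the connection form om and the torsion; J stands for the constant i. *)
Record pshf (A : comPzRingType) (J : A) := Pshf {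
  pZ : A -> A; pZb : A -> A; pT : A -> A;
  pp : A; ppb : A; pq : A; pa : A; pab : A; pW : A;
  pZD : {morph pZ : u v / u + v}; pZbD : {morph pZb : u v / u + v};
  pTD : {morph pT : u v / u + v};
  pZM : forall u v, pZ (u * v) = pZ u * v + u * pZ v;
  pZbM : forall u v, pZb (u * v) = pZb u * v + u * pZb v;
  pTM : forall u v, pT (u * v) = pT u * v + u * pT v;
  pZJ : pZ J = 0; pZbJ : pZb J = 0; pTJ : pT J = 0;
  p_ZZb : forall u, pZ (pZb u) - pZb (pZ u) = - (J * pT u) + ppb * pZ u - pp * pZb u;
  p_ZT : forall u, pZ (pT u) - pT (pZ u) = - (pq * pZ u) + pab * pZb u;
  p_ZbT : forall u, pZb (pT u) - pT (pZb u) = pq * pZb u + pa * pZ u;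
  p_WE : pW = - pZ ppb - pZb pp + J * pq - 2 * pp * ppb;
  p_ind : forall x y z, (forall u, x * pZ u + y * pZb u + z * pT u = 0) ->
    [/\ x = 0, y = 0 & z = 0]
}.

Section Algebra.
Variables (A : comPzRingType) (J : A).
Hypothesis JJ : J * J = -1.

Lemma JJ0 : J * J + 1 = 0. Proof. by rewrite JJ addNr. Qed.

(** [ring] sees J as an indeterminate, so an identity that uses J^2 = -1 is proved by supplying the
    cofactor c of J^2 + 1; [eq_comb] does the same for an arbitrary equation u = v. *)
Lemma eq_combJ (x y c : A) : x - y = c * (J * J + 1) -> x = y.
Proof. by rewrite JJ0 mulr0 => /eqP; rewrite subr_eq0 => /eqP. Qed.

Lemma eq_comb (x y c u v : A) : u = v -> x - y = c * (u - v) -> x = y.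
Proof. by move=> ->; rewrite subrr mulr0 => /eqP; rewrite subr_eq0 => /eqP. Qed.

Lemma mulJI (x : A) : J * x = 0 -> x = 0.
Proof. by move=> h; apply: (@eq_combJ _ _ x); rewrite subr0 -[x in LHS]addr0 -[in LHS](mulr0 J) -h; ring. Qed.

Section Frame.
Variable S : pshf J.
Local Notation Z := (pZ S).
Local Notation Zb := (pZb S).
Local Notation T := (pT S).
Local Notation p := (pp S).
Local Notation pb := (ppb S).
Local Notation q := (pq S).
Local Notation a := (pa S).
Local Notation ab := (pab S).
Local Notation W := (pW S).

Lemma pZ0 : Z 0 = 0. Proof. by apply: (addrI (Z 0)); rewrite -pZD !addr0. Qed.
Lemma pZb0 : Zb 0 = 0. Proof. by apply: (addrI (Zb 0)); rewrite -pZbD !addr0. Qed.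
Lemma pT0 : T 0 = 0. Proof. by apply: (addrI (T 0)); rewrite -pTD !addr0. Qed.
Lemma pZN u : Z (- u) = - Z u.
Proof. by apply: (addrI (Z u)); rewrite -pZD !subrr pZ0. Qed.
Lemma pZbN u : Zb (- u) = - Zb u.
Proof. by apply: (addrI (Zb u)); rewrite -pZbD !subrr pZb0. Qed.
Lemma pTN u : T (- u) = - T u.
Proof. by apply: (addrI (T u)); rewrite -pTD !subrr pT0. Qed.
Lemma pZ1 : Z 1 = 0.
Proof. by apply: (addrI (Z 1)); rewrite addr0 -{3}[1]mulr1 pZM mulr1 mul1r. Qed.
Lemma pZb1 : Zb 1 = 0.
Proof. by apply: (addrI (Zb 1)); rewrite addr0 -{3}[1]mulr1 pZbM mulr1 mul1r. Qed.
Lemma pT1 : T 1 = 0.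
Proof. by apply: (addrI (T 1)); rewrite addr0 -{3}[1]mulr1 pTM mulr1 mul1r. Qed.
Lemma pZn n : Z n%:R = 0.
Proof. by elim: n => [|n IH]; rewrite ?pZ0// -natr1 pZD IH pZ1 addr0. Qed.
Lemma pZbn n : Zb n%:R = 0.
Proof. by elim: n => [|n IH]; rewrite ?pZb0// -natr1 pZbD IH pZb1 addr0. Qed.
Lemma pTn n : T n%:R = 0.
Proof. by elim: n => [|n IH]; rewrite ?pT0// -natr1 pTD IH pT1 addr0. Qed.

Definition pder := (pZD S, pZbD S, pTD S, pZM S, pZbM S, pTM S, pZJ S, pZbJ S, pTJ S,
  pZ0, pZb0, pT0, pZN, pZbN, pTN, pZ1, pZb1, pT1, pZn, pZbn, pTn).

(** The commutators oriented as rewriting rules: with [TZE] and [TZbE] they bring every iterated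
    derivative to a normal form in which T acts first, then Z, then Zb, so that [ring] can
    compare. *)
Lemma ZZbE u : Z (Zb u) = Zb (Z u) - J * T u + pb * Z u - p * Zb u.
Proof. by have := p_ZZb S u => /eqP; rewrite subr_eq => /eqP->; ring. Qed.

Lemma TZE u : T (Z u) = Z (T u) + q * Z u - ab * Zb u.
Proof.
have := p_ZT S u => /eqP; rewrite subr_eq addrC -subr_eq => /eqP<-; ring.
Qed.

Lemma TZbE u : T (Zb u) = Zb (T u) - q * Zb u - a * Z u.
Proof.
have := p_ZbT S u => /eqP; rewrite subr_eq addrC -subr_eq => /eqP<-; ring.
Qed.

End Frame.

Section ConjFrame.
Variable S : pshf J.
Lemma conj_ind x y z : (forall u, x * pZb S u + y * pZ S u + z * pT S u = 0) ->
  [/\ x = 0, y = 0 & z = 0].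
Proof.
move=> h; have [|-> -> ->//] := @p_ind _ _ S y x z.
by move=> u; rewrite [_ * pZ S u + _]addrC.
Qed.

(** The abstract ring carries no conjugation. Exchanging Z and Zb and replacing J by -J stands in
    for it, so that an identity for Z also yields the one for Zb. *)
Definition conj_frame : pshf (- J).
Proof.
refine (@Pshf A (- J) (pZb S) (pZ S) (pT S) (ppb S) (pp S) (- pq S) (pab S) (pa S) (pW S)
  (pZbD S) (pZD S) (pTD S) (pZbM S) (pZM S) (pTM S) _ _ _ _ _ _ _ conj_ind).
- by rewrite pZbN pZbJ oppr0.
- by rewrite pZN pZJ oppr0.
- by rewrite pTN pTJ oppr0.
- by move=> u; rewrite -opprB p_ZZb; ring.
- by move=> u; rewrite p_ZbT; ring.
- by move=> u; rewrite p_ZT; ring.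
- by rewrite p_WE; ring.
Defined.
End ConjFrame.

(** * Derivatives of the curvature in a torsion-free frame *)

Section TorsionFree.
Variable S : pshf J.
Local Notation Z := (pZ S).
Local Notation Zb := (pZb S).
Local Notation T := (pT S).
Local Notation p := (pp S).
Local Notation pb := (ppb S).
Local Notation q := (pq S).
Local Notation W := (pW S).
Hypothesis (a0 : pa S = 0) (ab0 : pab S = 0).
Hypothesis (Tp : T p = Z q + q * p) (Tpb : T pb = - Zb q - q * pb).

(** [Tp] and [Tpb] express that the derivative of the connection form vanishes on (Z, T) and (Zb,
    T); inserted in T of the formula [p_WE], they make all terms cancel after commutation. *)
Lemma T_W : T W = 0.
Proof.
rewrite p_WE !pder TZE TZbE Tp Tpb !pder ZZbE a0 ab0.
apply: (@eq_combJ _ _ 0); ring.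
Qed.

Hypothesis W11 : Z (Z W) = p * Z W.

(** The covariant second derivative W_{1 1b}; by [lapW_sym], a consequence of T W = 0, it equals
    W_{1b 1}. *)
Definition lapW := Zb (Z W) + pb * Z W.

Lemma lapW_sym : lapW = Z (Zb W) + p * Zb W.
Proof. by rewrite ZZbE T_W /lapW; ring. Qed.

(** Once Z is moved past Zb, the equation W_11 = 0 removes the third derivative; the coefficient of
    Z W that the commutators leave is -W by [p_WE]. *)
Lemma Z_lapW : Z lapW = - W * Z W.
Proof.
have E : T (Z W) = q * Z W by rewrite TZE T_W ab0 pZ0; ring.
rewrite /lapW !pder ZZbE. rewrite W11 !pder E [X in _ = - X * _]p_WE; ring.
Qed.

(* When W_11 = 0 the functions kapW and c6W are locally constant, and by definition
   6 |W_1|^2 = c6W + 3 kapW W - W^3. *)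
Definition kapW := 2 * lapW + W * W.

Lemma Z_kapW : Z kapW = 0.
Proof. by have := Z_lapW; rewrite /kapW; move: lapW => h E; rewrite !pder E; ring. Qed.

Definition c6W := 6 * (Z W * Zb W) - 3 * (kapW * W) + W * W * W.

Lemma Z_c6W : Z c6W = 0.
Proof.
have E : Z (Zb W) = lapW - p * Zb W by rewrite lapW_sym; ring.
have := Z_kapW; have : kapW = 2 * lapW + W * W by [].
rewrite /c6W; move: kapW lapW E => k h E kE Zk.
by rewrite !pder Zk W11 E kE; ring.
Qed.

End TorsionFree.

(** The bracket of Z and Zb contains T with an invertible coefficient: the contact condition. *)
Lemma T_of_ZZb (S : pshf J) u : pZ S u = 0 -> pZb S u = 0 -> pT S u = 0.
Proof.
move=> z zb; apply: mulJI; have := p_ZZb S u.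
by rewrite z zb pZ0 pZb0 => /eqP; rewrite !mulr0 !subr0 addr0 eq_sym oppr_eq0 => /eqP.
Qed.

(** * Conformal change: S' belongs to the contact form theta / (l lb) when S belongs to theta *)

Section Conformal.
Variables (S S' : pshf J) (l lb li lbi c a b : A).
Local Notation Z := (pZ S).
Local Notation Zb := (pZb S).
Local Notation T := (pT S).
Local Notation p := (pp S).
Local Notation pb := (ppb S).
Local Notation q := (pq S).
Local Notation f := (l * lb).
Hypothesis (lli : l * li = 1) (llbi : lb * lbi = 1).
Hypothesis (Z'E : forall u, pZ S' u = l * Z u) (Zb'E : forall u, pZb S' u = lb * Zb u).
Hypothesis (T'E : forall u, pT S' u = c * T u + a * Z u + b * Zb u).

Lemma li_cancel x : l * x = 0 -> x = 0.
Proof. by move=> h; rewrite -[x]mul1r -lli mulrAC h mul0r. Qed.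
Lemma lbi_cancel x : lb * x = 0 -> x = 0.
Proof. by move=> h; rewrite -[x]mul1r -llbi mulrAC h mul0r. Qed.

Lemma conf_ZZb : [/\ c = f, f * pb - lb * Zb l = - (J * a) + ppb S' * l &
  f * p - l * Z lb = J * b + pp S' * lb].
Proof.
have [|x0 y0 z0] := @p_ind _ _ S (f * pb - lb * Zb l + J * a - ppb S' * l)
   (- f * p + l * Z lb + J * b + pp S' * lb) (- (J * f) + J * c).
  move=> u; have := p_ZZb S' u.
  rewrite !Z'E !Zb'E T'E !pder.
  move=> E; rewrite -[RHS](subrr (l * (Z lb * Zb u + lb * Z (Zb u)) - lb * (Zb l * Z u + l * Zb (Z u)))).
  by rewrite {2}E ZZbE; ring.
split.
- apply/eqP; rewrite -subr_eq0; apply/eqP; apply: mulJI.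
  by rewrite -z0; ring.
- by apply: (eq_comb (c := 1) x0); ring.
- by apply: (eq_comb (c := -1) y0); ring.
Qed.

Lemma conf_ZT : [/\ Z f = J * b,
   - (f * q) * l + l * b * pb + l * Z a - f * T l - a * Z l - b * Zb l = - pq S' * l &
   l * (f * pab S - b * p + Z b) = pab S' * lb].
Proof.
have [cf _ _] := conf_ZZb.
have [|x0 y0 z0] := @p_ind _ _ S
   (- (f * q) * l + l * b * pb + l * Z a - f * T l - a * Z l - b * Zb l + pq S' * l)
   (l * (f * pab S - b * p + Z b) - pab S' * lb) (l * (Z f - J * b)).
  move=> u; have := p_ZT S' u; rewrite !Z'E !Zb'E !T'E cf !pder.
  set E1 := (X in X = _ -> _); set E2 := (X in _ = X -> _) => E.
  transitivity (E1 - E2); last by rewrite E subrr.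
  by rewrite /E1 /E2 ZZbE TZE; ring.
split.
- by apply/eqP; rewrite -subr_eq0; apply/eqP; apply: li_cancel.
- by apply: (eq_comb (c := 1) x0); ring.
- by apply: (eq_comb (c := 1) y0); ring.
Qed.

Lemma conf_ZbT : Zb f = - (J * a).
Proof.
have [cf _ _] := conf_ZZb.
have [|x0 y0 z0] := @p_ind _ _ S
   (lb * (f * pa S - a * pb + Zb a) - pa S' * l)
   (f * q * lb + lb * a * p + lb * Zb b - f * T lb - a * Z lb - b * Zb lb - pq S' * lb)
   (lb * (Zb f + J * a)).
  move=> u; have := p_ZbT S' u; rewrite !Z'E !Zb'E !T'E cf !pder.
  set E1 := (X in X = _ -> _); set E2 := (X in _ = X -> _) => E.
  transitivity (E1 - E2); last by rewrite E subrr.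
  by rewrite /E1 /E2 ZZbE TZbE; ring.
by apply/eqP; rewrite -subr_eq0 opprK; apply/eqP; apply: lbi_cancel.
Qed.

Lemma conf_bE : b = - (J * Z f).
Proof. by have [-> _ _] := conf_ZT; apply: (@eq_combJ _ _ b); ring. Qed.

Lemma conf_aE : a = J * Zb f.
Proof. by rewrite conf_ZbT; apply: (@eq_combJ _ _ a); ring. Qed.

(** Since b = - J Z f, the third equation of [conf_ZT] says that the torsion changes by a multiple
    of f_11 = Z Z f - p Z f. *)
Lemma conf_torsion : pab S = 0 -> pab S' = 0 -> Z (Z f) = p * Z f.
Proof.
move=> ab0 ab'0; have [_ _] := conf_ZT.
rewrite ab0 ab'0 mulr0 mul0r add0r conf_bE; move: (l * lb) => F /li_cancel h.
apply/eqP; rewrite -subr_eq0; apply/eqP; apply: mulJI.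
by rewrite pZN pZM pZJ in h; rewrite -[RHS]oppr0 -[in RHS]h; ring.
Qed.

Lemma conf_torsion0 : pab S = 0 -> Z (Z f) = p * Z f -> pab S' = 0.
Proof.
move=> ab0 h; have [_ _] := conf_ZT.
rewrite ab0 mulr0 add0r conf_bE; move: (l * lb) h => F h; rewrite pZN pZM pZJ h => h'.
by apply: lbi_cancel; rewrite mulrC -h'; ring.
Qed.

(* Logarithmic derivatives of l and lb, which keep inverses out of the formulas. *)
Local Notation s := (li * Z l).
Local Notation x := (li * Zb l).
Local Notation r := (lbi * Z lb).
Local Notation y := (lbi * Zb lb).

Lemma logl (g u gi : A) : g * gi = 1 -> u = g * (gi * u).
Proof. by move=> h; rewrite mulrA h mul1r. Qed.

Lemma conf_pE : pp S' = l * (p - 2 * r - s).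
Proof.
have [_ _ E] := conf_ZZb; have [F _ _] := conf_ZT.
apply: subr0_eq; apply: lbi_cancel.
move: (logl (Z l) lli) (logl (Z lb) llbi); move: (li * Z l) (lbi * Z lb) => s r e1 e2.
by rewrite -F pZM e1 e2 in E; apply: (eq_comb (c := -1) E); ring.
Qed.

Lemma conf_pbE : ppb S' = lb * (pb - 2 * x - y).
Proof.
have [_ E _] := conf_ZZb; have F := conf_ZbT.
apply: subr0_eq; apply: li_cancel.
move: (logl (Zb l) lli) (logl (Zb lb) llbi); move: (li * Zb l) (lbi * Zb lb) => x y e1 e2.
by rewrite -F pZbM e1 e2 in E; apply: (eq_comb (c := -1) E); ring.
Qed.

Lemma conf_Zf : Z f = f * (s + r).
Proof.
move: (logl (Z l) lli) (logl (Z lb) llbi); move: (li * Z l) (lbi * Z lb) => s r e1 e2.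
by rewrite pZM e1 e2; ring.
Qed.

Lemma conf_Zbf : Zb f = f * (x + y).
Proof.
move: (logl (Zb l) lli) (logl (Zb lb) llbi); move: (li * Zb l) (lbi * Zb lb) => x y e1 e2.
by rewrite pZbM e1 e2; ring.
Qed.

(** The commutator of Z and Zb applied to l trades T l, which enters [pq S'] through [conf_ZT], for
    derivatives along Z and Zb. *)
Lemma conf_Tl : J * T l = l * (Zb s - Z x + pb * s - p * x).
Proof.
move: (logl (Z l) lli) (logl (Zb l) lli); move: (li * Z l) (li * Zb l) => s x e1 e2.
have := ZZbE S l; rewrite e1 e2 pZM pZbM e1 e2 => E.
by apply: (eq_comb (c := 1) E); ring.
Qed.

Lemma conf_Jq : J * pq S' = f * (J * q) - Z f * pb + Z (Zb f)
    + f * (Zb s - Z x + pb * s - p * x) - Zb f * s + Z f * x.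
Proof.
apply: subr0_eq; apply: li_cancel; rewrite mulrBr; apply/eqP; rewrite subr_eq0; apply/eqP.
have e1 := logl (Z l) lli; have e2 := logl (Zb l) lli.
transitivity (l * (f * (J * q) - Z f * pb + Z (Zb f)) + f * (J * T l)
    - Zb f * (l * s) + Z f * (l * x)); last by rewrite conf_Tl; ring.
rewrite -e1 -e2; have [_ Q _] := conf_ZT.
rewrite conf_aE conf_bE [Z (J * _)]pZM pZJ in Q.
move: (Zb (l * lb)) (Z (l * lb)) (Z (Zb (l * lb))) Q; move: (l * lb) => F ZbF ZF ZZbF Q.
transitivity (- J * (- (F * q) * l + l * - (J * ZF) * pb + l * (0 * ZbF + J * ZZbF) -
   F * T l - J * ZbF * Z l - - (J * ZF) * Zb l)).
  by apply: (eq_comb (c := J) Q); ring.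
by apply: (@eq_combJ _ _ (l * ZF * pb - l * ZZbF + ZbF * Z l - ZF * Zb l)); ring.
Qed.

(** The transformation law of the Tanaka-Webster curvature (the CR Yamabe equation), written for the
    factor f itself instead of a power of it, so that the right side is quadratic in f. The
    transformed p, pb and q are inserted in [p_WE]. *)
Lemma conf_W : f * pW S' = 2 * f * ((Zb (Z f) + pb * Z f) + (Z (Zb f) + p * Zb f))
  + pW S * (f * f) - 6 * (Z f * Zb f).
Proof.
have pE := conf_pE; have pbE := conf_pbE; have Jq := conf_Jq.
have ZF := conf_Zf; have ZbF := conf_Zbf.
rewrite p_WE Jq pE pbE Z'E Zb'E.
move: (logl (Z l) lli) (logl (Z lb) llbi) (logl (Zb l) lli) (logl (Zb lb) llbi) ZF ZbF.
move: (li * Z l) (lbi * Z lb) (li * Zb l) (lbi * Zb lb) => s r x y e1 e2 e3 e4 ZF ZbF.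
rewrite ZF ZbF [Z (l * lb * _)]pZM [Zb (l * lb * _)]pZbM ZF ZbF.
rewrite !pder ?e1 ?e2 ?e3 ?e4 p_WE; ring.
Qed.

End Conformal.

Section HessianW.
Variables (S S' : pshf J) (l lb li lbi c a b : A).
Local Notation Z := (pZ S).
Local Notation Zb := (pZb S).
Local Notation T := (pT S).
Local Notation f := (l * lb).
Hypothesis (lli : l * li = 1) (llbi : lb * lbi = 1).
Hypothesis (Z'E : forall u, pZ S' u = l * Z u) (Zb'E : forall u, pZb S' u = lb * Zb u).
Hypothesis (T'E : forall u, pT S' u = c * T u + a * Z u + b * Zb u).
Hypothesis (p0 : pp S = 0) (pb0 : ppb S = 0) (q0 : pq S = - (2 * J)).
Hypothesis (ab0 : pab S = 0) (ab'0 : pab S' = 0).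

(* On the sphere f is a CR Hamiltonian (f_11 = 0), and so is f W'. *)
Lemma conf_sphere_W11 : pZ S' (pZ S' (pW S')) = pp S' * pZ S' (pW S').
Proof.
have F11 : Z (Z f) = 0 by rewrite (conf_torsion lli Z'E Zb'E T'E ab0 ab'0) p0 mul0r.
have W0 : pW S = 2 by rewrite p_WE p0 pb0 q0 !pder; apply: (@eq_combJ _ _ (-2)); ring.
(* By [conf_W] this quadratic expression is W' f, because p = pb = 0 and W = 2 on the sphere. *)
pose k := 2 * f * (Zb (Z f) + Z (Zb f)) + 2 * (f * f) - 6 * (Z f * Zb f).
have kE : pW S' * f = k.
  have := conf_W lli llbi Z'E Zb'E T'E; rewrite p0 pb0 W0 => E.
  by apply: (eq_comb (c := 1) E); rewrite /k; ring.
have k11 : Z (Z k) = 0.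
  rewrite /k; move: (l * lb) F11 => F F11.
  have hE : Z (Zb (Z F)) = - (J * Z (T F)) - 2 * Z F.
    rewrite ZZbE F11 !pder p0 pb0 TZE q0 ab0.
    by apply: (@eq_combJ _ _ (2 * Z F)); ring.
  have gE : Z (Z (T F)) = 0.
    have := TZE S (Z F); rewrite F11 pT0 TZE q0 ab0 !pder F11 => E.
    by apply: (eq_comb (c := -1) E); ring.
  have e : Z (Zb F) = Zb (Z F) - J * T F by rewrite ZZbE p0 pb0; ring.
  move: (Zb (Z F)) hE e => h hE e; rewrite !(e, hE, gE, F11, pder S).
  by apply: (@eq_combJ _ _ 0); ring.
have ZF := conf_Zf S lli llbi.
rewrite (conf_pE lli llbi Z'E Zb'E T'E) p0 !Z'E pZM.
have e1 := logl (Z l) lli.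
move: (li * Z l) (lbi * Z lb) e1 ZF => s r e1 ZF; move: (pW S') kE => w kE.
(* Both f and W' f are annihilated by Z Z, so f Z Z W' + 2 Z f Z W' = 0; with Z f = f (s + r) this
   is W'_11 = 0 up to invertible factors. *)
have X0 : l * lb * (Z (Z w) + 2 * (s + r) * Z w) = 0.
  clearbody k; move: (l * lb) F11 kE ZF => F F11 kE ZF.
  have Zk := congr1 (pZ S) kE; rewrite pZM in Zk.
  have := congr1 (pZ S) Zk; rewrite k11 pZD !pZM F11 ZF => E.
  by apply: (eq_comb (c := 1) E); ring.
rewrite -mulrA in X0; have {}X0 := li_cancel llbi (li_cancel lli X0).
by rewrite e1; apply: (eq_comb (c := l * l) X0); ring.
Qed.
End HessianW.

(** * The standard frame of the unit sphere *)

Section Sphere.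
Variables (S : pshf J) (F1 F2 G1 G2 m n mi ni : A).
Local Notation Z := (pZ S).
Local Notation Zb := (pZb S).
Local Notation T := (pT S).
Hypotheses (mmi : m * mi = 1) (nni : n * ni = 1) (FG : F1 * G1 + F2 * G2 = 1).
Hypotheses (ZbF1 : Zb F1 = 0) (ZbF2 : Zb F2 = 0) (ZG1 : Z G1 = 0) (ZG2 : Z G2 = 0).
Hypotheses (ZF1 : Z F1 = m * G2) (ZF2 : Z F2 = - (m * G1)).
Hypotheses (ZbG1 : Zb G1 = n * F2) (ZbG2 : Zb G2 = - (n * F1)).

(** F1, F2 stand for the coordinates z1, z2 of the sphere and G1, G2 for their conjugates. Z0 is the
    classical field conj(z2) d/dz1 - conj(z1) d/dz2, of which Z is the multiple by m, and T0 is
    dictated by the bracket relation of Z0 and Zb0. *)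
Let Z0 u := mi * Z u.
Let Zb0 u := ni * Zb u.
Let T0 u := J * (Z0 (Zb0 u) - Zb0 (Z0 u)).

Let T0_span : exists g al be, m * n * g = 1 /\
  forall u, T0 u = g * T u + al * Z u + be * Zb u.
Proof.
exists (mi * ni), (J * (mi * ni * ppb S - ni * Zb mi)), (J * (mi * Z ni - mi * ni * pp S)).
split; first by rewrite mulrACA mmi nni mulr1.
move=> u; rewrite /T0 /Z0 /Zb0 !pder ZZbE.
by apply: (@eq_combJ _ _ (- (mi * ni * T u))); ring.
Qed.

Let T_span : exists C a0 b0, forall u, T u = C * T0 u + a0 * Z0 u + b0 * Zb0 u.
Proof.
have [g [al [be [mng T0E]]]] := T0_span.
exists (m * n), (- (m * n * al * m)), (- (m * n * be * n)) => u.
rewrite T0E /Z0 /Zb0.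
transitivity ((m * n * g) * T u + m * n * al * (1 - m * mi) * Z u +
  m * n * be * (1 - n * ni) * Zb u); last by ring.
by rewrite mng mmi nni; ring.
Qed.

Lemma m_mul u : u = m * (mi * u). Proof. by rewrite mulrA mmi mul1r. Qed.
Lemma n_mul u : u = n * (ni * u). Proof. by rewrite mulrA nni mul1r. Qed.

Let span_basis x y z : exists x' y' z', forall u,
  x * Z u + y * Zb u + z * T u = x' * Z0 u + y' * Zb0 u + z' * T0 u.
Proof.
have [C [a0 [b0 TE]]] := T_span.
exists (x * m + z * a0), (y * n + z * b0), (z * C) => u; rewrite TE /Z0 /Zb0.
by rewrite {1}[Z u]m_mul {1}[Zb u]n_mul; ring.
Qed.

Let Z0T0_span : exists x y z, forall u,
  Z0 (T0 u) - T0 (Z0 u) = x * Z0 u + y * Zb0 u + z * T0 u.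
Proof.
have [g [al [be [_ T0E]]]] := T0_span.
have [x [y [z E]]] := span_basis
  (mi * Z al - g * T mi - al * Z mi - be * Zb mi - g * mi * pq S + be * mi * ppb S)
  (mi * Z be + g * mi * pab S - be * mi * pp S) (mi * Z g - be * mi * J).
exists x, y, z => u; rewrite -E !T0E /Z0 !pder ZZbE TZE; ring.
Qed.

Let Zb0T0_span : exists x y z, forall u,
  Zb0 (T0 u) - T0 (Zb0 u) = x * Z0 u + y * Zb0 u + z * T0 u.
Proof.
have [g [al [be [_ T0E]]]] := T0_span.
have [x [y [z E]]] := span_basis
  (ni * Zb al + g * ni * pa S - al * ni * ppb S)
  (ni * Zb be - g * T ni - al * Z ni - be * Zb ni + g * ni * pq S + al * ni * pp S)
  (ni * Zb g + al * ni * J).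
exists x, y, z => u; rewrite -E !T0E /Zb0 !pder ZZbE TZbE; ring.
Qed.

Let Z0F1 : Z0 F1 = G2. Proof. by rewrite /Z0 ZF1 mulrA [mi * m]mulrC mmi mul1r. Qed.
Let Z0F2 : Z0 F2 = - G1. Proof. by rewrite /Z0 ZF2 mulrN mulrA [mi * m]mulrC mmi mul1r. Qed.
Let Z0G1 : Z0 G1 = 0. Proof. by rewrite /Z0 ZG1 mulr0. Qed.
Let Z0G2 : Z0 G2 = 0. Proof. by rewrite /Z0 ZG2 mulr0. Qed.
Let Zb0F1 : Zb0 F1 = 0. Proof. by rewrite /Zb0 ZbF1 mulr0. Qed.
Let Zb0F2 : Zb0 F2 = 0. Proof. by rewrite /Zb0 ZbF2 mulr0. Qed.
Let Zb0G1 : Zb0 G1 = F2. Proof. by rewrite /Zb0 ZbG1 mulrA [ni * n]mulrC nni mul1r. Qed.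
Let Zb0G2 : Zb0 G2 = - F1. Proof. by rewrite /Zb0 ZbG2 mulrN mulrA [ni * n]mulrC nni mul1r. Qed.
Let Z0D u v : Z0 (u + v) = Z0 u + Z0 v. Proof. by rewrite /Z0 pZD mulrDr. Qed.
Let Zb0D u v : Zb0 (u + v) = Zb0 u + Zb0 v. Proof. by rewrite /Zb0 pZbD mulrDr. Qed.
Let Z0N u : Z0 (- u) = - Z0 u. Proof. by rewrite /Z0 pZN mulrN. Qed.
Let Zb0N u : Zb0 (- u) = - Zb0 u. Proof. by rewrite /Zb0 pZbN mulrN. Qed.
Let Z00 : Z0 0 = 0. Proof. by rewrite /Z0 pZ0 mulr0. Qed.
Let Zb00 : Zb0 0 = 0. Proof. by rewrite /Zb0 pZb0 mulr0. Qed.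
Let Z0M u v : Z0 (u * v) = Z0 u * v + u * Z0 v. Proof. by rewrite /Z0 pZM; ring. Qed.
Let Zb0M u v : Zb0 (u * v) = Zb0 u * v + u * Zb0 v. Proof. by rewrite /Zb0 pZbM; ring. Qed.
Let Z0J : Z0 J = 0. Proof. by rewrite /Z0 pZJ mulr0. Qed.
Let Zb0J : Zb0 J = 0. Proof. by rewrite /Zb0 pZbJ mulr0. Qed.
Let T0F1 : T0 F1 = J * F1.
Proof. by rewrite /T0 Zb0F1 Z0F1 Z00 Zb0G2; ring. Qed.
Let T0F2 : T0 F2 = J * F2.
Proof. by rewrite /T0 Zb0F2 Z0F2 Z00 Zb0N Zb0G1; ring. Qed.
Let T0G1 : T0 G1 = - (J * G1).
Proof. by rewrite /T0 Zb0G1 Z0G1 Zb00 Z0F2; ring. Qed.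
Let T0G2 : T0 G2 = - (J * G2).
Proof. by rewrite /T0 Zb0G2 Z0G2 Zb00 Z0N Z0F1; ring. Qed.
Let T0N u : T0 (- u) = - T0 u.
Proof. by rewrite /T0 !(Z0N, Zb0N); ring. Qed.
Let T0D u v : T0 (u + v) = T0 u + T0 v.
Proof. by rewrite /T0 !(Z0D, Zb0D); ring. Qed.
Let T0M u v : T0 (u * v) = T0 u * v + u * T0 v.
Proof. by rewrite /T0 !(Z0M, Zb0M, Z0D, Zb0D); ring. Qed.
Let T00 : T0 0 = 0. Proof. by rewrite /T0 !(Z00, Zb00); ring. Qed.
Let T0J : T0 J = 0. Proof. by rewrite /T0 Z0J Zb0J Z00 Zb00; ring. Qed.

Let by_FG x : x * F1 = 0 -> x * F2 = 0 -> x = 0.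
Proof. by move=> h1 h2; rewrite -[x]mulr1 -FG mulrDr !mulrA h1 h2 !mul0r addr0. Qed.
Let by_GF x : x * G1 = 0 -> x * G2 = 0 -> x = 0.
Proof.
move=> h1 h2; rewrite -[x]mulr1 -FG mulrDr ![F1 * _]mulrC ![F2 * _]mulrC !mulrA h1 h2.
by rewrite !mul0r addr0.
Qed.

Let Z0T0E u : Z0 (T0 u) - T0 (Z0 u) = - (- (2 * J) * Z0 u) + 0 * Zb0 u.
Proof.
have [x [y [z E]]] := Z0T0_span.
have e1 := E F1; have e2 := E F2; have e3 := E G1; have e4 := E G2.
rewrite T0F1 Z0M Z0J Z0F1 T0G2 Zb0F1 in e1.
rewrite T0F2 Z0M Z0J Z0F2 T0N T0G1 Zb0F2 in e2.
rewrite T0G1 Z0N Z0M Z0J Z0G1 T00 Zb0G1 in e3.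
rewrite T0G2 Z0N Z0M Z0J Z0G2 T00 Zb0G2 in e4.
have zJ : J * z = 0.
  transitivity (J * z * (F1 * G1 + F2 * G2)); first by rewrite FG mulr1.
  transitivity (- G1 * ((0 * F1 + J * G2) - - (J * G2) - (x * G2 + y * 0 + z * (J * F1)))
    - G2 * ((0 * F2 + J * - G1) - - - (J * G1) - (x * - G1 + y * 0 + z * (J * F2)))).
    by ring.
  by rewrite e1 e2; ring.
have z0 := mulJI zJ; subst z.
have y0 : y = 0.
  apply: by_FG.
    by apply: (eq_comb (c := 1) e4); ring.
  by apply: (eq_comb (c := -1) e3); ring.
have x0 : x - 2 * J = 0.
  apply: by_GF.
    by apply: (eq_comb (c := 1) e2); ring.
  by apply: (eq_comb (c := -1) e1); ring.
by rewrite E y0 (subr0_eq x0); ring.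
Qed.

Let Zb0T0E u : Zb0 (T0 u) - T0 (Zb0 u) = - (2 * J) * Zb0 u + 0 * Z0 u.
Proof.
have [x [y [z E]]] := Zb0T0_span.
have e1 := E F1; have e2 := E F2; have e3 := E G1; have e4 := E G2.
rewrite T0F1 Zb0M Zb0J Zb0F1 T00 Z0F1 in e1.
rewrite T0F2 Zb0M Zb0J Zb0F2 T00 Z0F2 in e2.
rewrite T0G1 Zb0N Zb0M Zb0J Zb0G1 T0F2 Z0G1 in e3.
rewrite T0G2 Zb0N Zb0M Zb0J Zb0G2 T0N T0F1 Z0G2 in e4.
have zJ : J * z = 0.
  transitivity (J * z * (F1 * G1 + F2 * G2)); first by rewrite FG mulr1.
  transitivity (F1 * ((- (0 * G1 + J * F2)) - J * F2 - (x * 0 + y * F2 + z * - (J * G1)))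
    + F2 * ((- (0 * G2 + J * - F1)) - - (J * F1) - (x * 0 + y * - F1 + z * - (J * G2)))).
    by ring.
  by rewrite e3 e4; ring.
have z0 := mulJI zJ; subst z.
have x0 : x = 0.
  apply: by_GF.
    by apply: (eq_comb (c := 1) e2); ring.
  by apply: (eq_comb (c := -1) e1); ring.
have y0 : y + 2 * J = 0.
  apply: by_FG.
    by apply: (eq_comb (c := 1) e4); ring.
  by apply: (eq_comb (c := -1) e3); ring.
by rewrite E x0 (_ : y = - (2 * J)); [ring|apply: (eq_comb (c := 1) y0); ring].
Qed.

Let ind0 x y z : (forall u, x * Z0 u + y * Zb0 u + z * T0 u = 0) ->
  [/\ x = 0, y = 0 & z = 0].
Proof.
have [g [al [be [mng T0E]]]] := T0_span => h.
have [|x0 y0 z0] := @p_ind _ _ S (x * mi + z * al) (y * ni + z * be) (z * g).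
  by move=> u; rewrite -[RHS](h u) T0E /Z0 /Zb0; ring.
have z1 : z = 0 by rewrite -[z]mulr1 -mng mulrCA z0 mulr0.
subst z; split=> //; [rewrite mul0r addr0 in x0|rewrite mul0r addr0 in y0].
  by rewrite [x]m_mul [mi * x]mulrC x0 mulr0.
by rewrite [y]n_mul [ni * y]mulrC y0 mulr0.
Qed.

(** The connection form of the sphere is -2 i theta in this frame, which explains p = pb = 0, q = -2
    J and the curvature 2. *)
Definition sphere_frame : pshf J.
Proof.
refine (@Pshf A J Z0 Zb0 T0 0 0 (- (2 * J)) 0 0 2
  Z0D Zb0D T0D Z0M Zb0M T0M Z0J Zb0J T0J _ Z0T0E Zb0T0E _ ind0).
- by move=> u; rewrite /T0; apply: (@eq_combJ _ _ (Z0 (Zb0 u) - Zb0 (Z0 u))); ring.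
- by rewrite Z00 Zb00; apply: (@eq_combJ _ _ 2); ring.
Defined.

(** S arises from [sphere_frame] by the conformal change with l = m and lb = n. *)
Lemma sphere_W11 : pab S = 0 -> Z (Z (pW S)) = pp S * Z (pW S).
Proof.
move=> ab0; have [C [a0 [b0 TE]]] := T_span.
apply: (@conf_sphere_W11 sphere_frame S m n mi ni C a0 b0) => //.
- by move=> u; exact: m_mul.
- by move=> u; exact: n_mul.
Qed.

End Sphere.

End Algebra.

(** * Frames of one contact form in two charts; rho is the pullback *)

Section ChartChange.
Variables (A B : comPzRingType) (J : A) (JB : B) (S : pshf J) (S' : pshf JB) (rho : A -> B).
Hypotheses (rhoD : {morph rho : u v / u + v}) (rhoM : {morph rho : u v / u * v})
  (rhoJ : rho J = JB).
Variables (l lb a b : B).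
Hypotheses (Z'E : forall u, pZ S' (rho u) = l * rho (pZ S u))
  (Zb'E : forall u, pZb S' (rho u) = lb * rho (pZb S u))
  (T'E : forall u, pT S' (rho u) = rho (pT S u) + a * rho (pZ S u) + b * rho (pZb S u)).
Hypothesis ind : forall x y z, (forall u, x * rho (pZ S u) + y * rho (pZb S u)
  + z * rho (pT S u) = 0) -> [/\ x = 0, y = 0 & z = 0].
Hypothesis JJB : JB * JB + 1 = 0.

Let mulJB (x : B) : JB * x = 0 -> x = 0.
Proof.
move=> h; have : (JB * JB + 1) * x = 0 by rewrite JJB mul0r.
by rewrite mulrDl -mulrA h mulr0 add0r mul1r.
Qed.

Let rho0 : rho 0 = 0. Proof. by apply: (addrI (rho 0)); rewrite -rhoD !addr0. Qed.
Let rhoN u : rho (- u) = - rho u.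
Proof. by apply: (addrI (rho u)); rewrite -rhoD !subrr rho0. Qed.

(** The bracket method of the conformal case. As T' has coefficient 1 on T, the frames differ by a
    phase l, and the last equation is the transformation of the connection form. *)
Lemma chart_change : [/\ l * lb = 1, a = 0, b = 0 &
  rho (ppb S) - pZb S' l = ppb S' * l].
Proof.
have [|x0 y0 z0] := @ind (rho (ppb S) * (l * lb) - pZb S' l + JB * a - ppb S' * l)
  (- (rho (pp S) * (l * lb)) + pZ S' lb + JB * b + pp S' * lb) (JB * (1 - l * lb)).
  move=> u; have := p_ZZb S' (rho u); rewrite Z'E Zb'E T'E pZM pZbM Z'E Zb'E.
  set E1 := (X in X = _ -> _); set E2 := (X in _ = X -> _) => E.
  transitivity (E1 - E2); last by rewrite E subrr.
  have := congr1 rho (p_ZZb S u); rewrite !(rhoD, rhoN, rhoM) rhoJ => F.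
  by rewrite /E1 /E2; apply: (eq_comb (c := - (l * lb)) F); ring.
have ll1 : l * lb = 1 by apply/eqP; rewrite eq_sym -subr_eq0; apply/eqP; apply: mulJB.
have b0 : b = 0.
  have [|_ _ z1] := @ind
   (- rho (pq S) * l + l * b * rho (ppb S) + pZ S' a - pT S' l + pq S' * l)
   (l * rho (pab S) - l * b * rho (pp S) + pZ S' b - pab S' * lb)
   (- (l * (JB * b))).
    move=> u; have := p_ZT S' (rho u).
    rewrite Z'E Zb'E T'E !pZD !pZM pTM T'E !Z'E.
    set E1 := (X in X = _ -> _); set E2 := (X in _ = X -> _) => E.
    transitivity (E1 - E2); last by rewrite E subrr.
    have := congr1 rho (p_ZZb S u); have := congr1 rho (p_ZT S u).
    rewrite !(rhoD, rhoN, rhoM) rhoJ => F1 F2.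
    transitivity (E1 - E2 - l * (rho (pZ S (pT S u)) - rho (pT S (pZ S u)) -
      (- (rho (pq S) * rho (pZ S u)) + rho (pab S) * rho (pZb S u)))
      - l * b * (rho (pZ S (pZb S u)) - rho (pZb S (pZ S u)) -
        (- (JB * rho (pT S u)) + rho (ppb S) * rho (pZ S u) - rho (pp S) * rho (pZb S u)))).
      by rewrite /E1 /E2; ring.
    by rewrite F1 F2; ring.
  apply: mulJB; apply: (li_cancel ll1); rewrite -[RHS]oppr0 -z1; ring.
have a0 : a = 0.
  have [|_ _ z1] := @ind
   (rho (pa S) * lb - lb * a * rho (ppb S) + pZb S' a - pa S' * l)
   (rho (pq S) * lb + lb * a * rho (pp S) + pZb S' b - pT S' lb - pq S' * lb)
   (lb * (JB * a)).
    move=> u; have := p_ZbT S' (rho u).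
    rewrite Z'E Zb'E T'E !pZbD !pZbM pTM T'E !Zb'E.
    set E1 := (X in X = _ -> _); set E2 := (X in _ = X -> _) => E.
    transitivity (E1 - E2); last by rewrite E subrr.
    have := congr1 rho (p_ZZb S u); have := congr1 rho (p_ZbT S u).
    rewrite !(rhoD, rhoN, rhoM) rhoJ => F1 F2.
    transitivity (E1 - E2 - lb * (rho (pZb S (pT S u)) - rho (pT S (pZb S u)) -
      (rho (pq S) * rho (pZb S u) + rho (pa S) * rho (pZ S u)))
      + lb * a * (rho (pZ S (pZb S u)) - rho (pZb S (pZ S u)) -
        (- (JB * rho (pT S u)) + rho (ppb S) * rho (pZ S u) - rho (pp S) * rho (pZb S u)))).
      by rewrite /E1 /E2; ring.
    by rewrite F1 F2; ring.
  by apply: mulJB; apply: (li_cancel (li := l)) z1; rewrite mulrC.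
split=> //; rewrite a0 ll1 in x0.
by apply: (eq_comb (c := 1) x0); ring.
Qed.

(** The change of [ppb] absorbs the derivative of the phase l, so the covariant second derivative
    does not depend on the frame. *)
Lemma chart_lap u : pZb S' (pZ S' (rho u)) + ppb S' * pZ S' (rho u) =
  rho (pZb S (pZ S u) + ppb S * pZ S u).
Proof.
have [ll1 _ _ E] := chart_change; rewrite Z'E pZbM Zb'E rhoD rhoM.
have h : rho (pZb S (pZ S u)) = l * lb * rho (pZb S (pZ S u)) by rewrite ll1 mul1r.
by rewrite [in RHS]h; apply: (eq_comb (c := - rho (pZ S u)) E); ring.
Qed.

Lemma chart_grad u v : pZ S' (rho u) * pZb S' (rho v) = rho (pZ S u * pZb S v).
Proof. by have [ll1 _ _ _] := chart_change; rewrite Z'E Zb'E rhoM mulrACA ll1 mul1r. Qed.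

End ChartChange.

(** * Calculus of functions of class C^k *)

Lemma cvg_sumr (R : realType) T (F : set_system T) (FF : Filter F) I (r : seq I)
    (f : I -> T -> R) (l : I -> R) : (forall i, f i @ F --> l i) ->
  (fun x => \sum_(i <- r) f i x) @ F --> \sum_(i <- r) l i.
Proof.
move=> fl; elim: r => [|i r IH].
  by rewrite big_nil; under eq_fun do rewrite big_nil; exact: cvg_cst.
by rewrite big_cons; under eq_fun do rewrite big_cons; apply: cvgD.
Qed.

Section CkCalculus.
Context {R : realType}.

Section Basic.
Context {V W : normedModType R}.
Implicit Types (U : set V) (f g : V -> W).

Lemma CkS k U f : Ck k.+1 U f -> Ck k U f.
Proof.
elim: k f => [|k IH] f [fc fD]; first by split.
by split=> // v; have [dv /IH] := fD v.
Qed.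

Lemma Ck_cont k U f : Ck k U f -> forall x, U x -> {for x, continuous f}.
Proof. by case: k => [|k] []. Qed.

Lemma open_eq_near U f g x : open U -> U x -> {in U, f =1 g} ->
  \forall y \near x, f y = g y.
Proof.
by move=> oU Ux fg; near=> y; apply: fg; rewrite inE; near: y; apply: open_nbhs_nbhs.
Unshelve. all: by end_near. Qed.

Lemma Ck_ext k U f g : open U -> {in U, f =1 g} -> Ck k U f -> Ck k U g.
Proof.
move=> oU; elim: k f g => [|k IH] f g fg [fc fD]; split.
- move=> x Ux; rewrite /prop_for /continuous_at -(fg x) ?inE//.
  apply: cvg_trans (fc x Ux); apply: near_eq_cvg.
  exact: open_eq_near oU Ux fg.
- by [].
- move=> x Ux; rewrite /prop_for /continuous_at -(fg x) ?inE//.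
  apply: cvg_trans (fc x Ux); apply: near_eq_cvg.
  exact: open_eq_near oU Ux fg.
- move=> v; have [dv Dv] := fD v; split.
    move=> x Ux; apply: near_eq_derivable (dv x Ux).
    exact: open_eq_near oU Ux fg.
  apply: IH Dv => x; rewrite inE => Ux; apply: near_eq_derive.
  exact: open_eq_near oU Ux fg.
Qed.

Lemma Ck_sub k U U' f : U' `<=` U -> Ck k U f -> Ck k U' f.
Proof.
move=> UU; elim: k f => [|k IH] f [fc fD]; split.
- by move=> x /UU; apply: fc.
- by [].
- by move=> x /UU; apply: fc.
- by move=> v; have [dv Dv] := fD v; split; [move=> x /UU; apply: dv|apply: IH].
Qed.

Lemma Ck_cst k U (a : W) : Ck k U (cst a).
Proof.
elim: k a => [|k IH] a; split=> //.
- by move=> x _; apply: cst_continuous.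
- by move=> x _; apply: cst_continuous.
move=> v; split; first by move=> x _; apply: derivable_cst.
rewrite (_ : (fun x => _) = cst 0) //.
by apply/funext => x; rewrite derive_cst.
Qed.

Lemma Ck_add k U f g : open U -> Ck k U f -> Ck k U g -> Ck k U (f \+ g).
Proof.
move=> oU; elim: k f g => [|k IH] f g [fc fD] [gc gD]; split.
- by move=> x Ux; apply: cvgD; [apply: fc|apply: gc].
- by [].
- by move=> x Ux; apply: cvgD; [apply: fc|apply: gc].
move=> v; have [df Df] := fD v; have [dg Dg] := gD v; split.
  by move=> x Ux; apply: derivableD; [apply: df|apply: dg].
apply: Ck_ext (IH _ _ Df Dg) => // x; rewrite inE => Ux /=.
by rewrite -deriveD//; [apply: df|apply: dg].
Qed.

End Basic.

Section LinCont.
Context {V W W' : normedModType R}.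
Variable (L : {linear W -> W'}) .
Hypothesis Lc : continuous L.

Lemma derivable_lin (f : V -> W) x v : derivable f x v -> derivable (L \o f) x v.
Proof.
move=> /cvg_ex[l fl]; apply/cvg_ex; exists (L l).
rewrite (_ : (fun h => _) = L \o (fun h => h^-1 *: ((f \o shift x) (h *: v) - f x))).
  by apply: (cvg_comp _ _ fl); apply: Lc.
by apply/funext => h; rewrite /= -(raddfB L) [RHS]linearZ.
Qed.

Lemma derive_lin (f : V -> W) x v :
  derivable f x v -> 'D_v (L \o f) x = L ('D_v f x).
Proof.
move=> fl; apply: cvg_lim => //.
rewrite (_ : (fun h => _) = L \o (fun h => h^-1 *: ((f \o shift x) (h *: v) - f x))).
  by apply: (cvg_comp _ _ fl); apply: Lc.
by apply/funext => h; rewrite /= -(raddfB L) [RHS]linearZ.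
Qed.

Lemma Ck_lin k U (f : V -> W) : open U -> Ck k U f -> Ck k U (L \o f).
Proof.
move=> oU; elim: k f => [|k IH] f [fc fD]; split.
- by move=> x Ux; apply: continuous_comp; [apply: fc|apply: Lc].
- by [].
- by move=> x Ux; apply: continuous_comp; [apply: fc|apply: Lc].
move=> v; have [df Df] := fD v; split.
  by move=> x Ux; apply: derivable_lin; apply: df.
by apply: Ck_ext (IH _ Df) => // x; rewrite inE => Ux /=; rewrite derive_lin//; apply: df.
Qed.

End LinCont.

Section Scalar.
Context {V : normedModType R}.
Implicit Types (U : set V) (f g : V -> R).

Lemma Ck_mul k U f g : open U -> Ck k U f -> Ck k U g -> Ck k U (fun x => f x * g x).
Proof.
move=> oU; elim: k f g => [|k IH] f g [fc fD] [gc gD]; split.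
- by move=> x Ux; apply: cvgM; [apply: fc|apply: gc].
- by [].
- by move=> x Ux; apply: cvgM; [apply: fc|apply: gc].
move=> v; have [df Df] := fD v; have [dg Dg] := gD v; split.
  by move=> x Ux; apply: derivableM; [apply: df|apply: dg].
have fk : Ck k U f by apply: CkS; split.
have gk : Ck k U g by apply: CkS; split.
apply: Ck_ext (Ck_add oU (IH _ _ fk Dg) (IH _ _ gk Df)) => // x; rewrite inE => Ux /=.
by rewrite -[RHS]/('D_v (f * g) x) deriveM//; [apply: df|apply: dg].
Qed.

Lemma Ck_opp k U f : open U -> Ck k U f -> Ck k U (fun x => - f x).
Proof.
move=> oU fk; have H := Ck_mul oU (Ck_cst k U (-1 : R^o)) fk.
by apply: Ck_ext H => // x _ /=; rewrite mulN1r.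
Qed.

Lemma Ck_inv k U f : open U -> (forall x, U x -> f x != 0) -> Ck k U f ->
  Ck k U (fun x => (f x)^-1).
Proof.
move=> oU f0; elim: k => [|k IH] [fc fD]; split.
- by move=> x Ux; apply: cvgV; [apply: f0|apply: fc].
- by [].
- by move=> x Ux; apply: cvgV; [apply: f0|apply: fc].
move=> v; have [df Df] := fD v; split.
  by move=> x Ux; apply: derivableV; [apply: f0|apply: df].
have fk : Ck k U f by apply: CkS; split.
apply: Ck_ext (Ck_opp oU (Ck_mul oU (Ck_mul oU (IH fk) (IH fk)) Df)) => // x.
rewrite inE => Ux /=; rewrite deriveV ?f0//; last exact: df.
by rewrite /GRing.scale/= expr2 invfM !mulNr.
Qed.

Lemma is_derive_line f x v s : derivable f (s *: v + x) v ->
  is_derive s 1 (fun h => f (h *: v + x)) ('D_v f (s *: v + x)).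
Proof.
move=> fd.
have E : (fun h : R => h^-1 *: (((fun h => f (h *: v + x)) \o shift s) (h *: 1) - f (s *: v + x)))
  = (fun h => h^-1 *: ((f \o shift (s *: v + x)) (h *: v) - f (s *: v + x))).
  by apply/funext => h /=; rewrite [_%:A]mulr1 scalerDl addrA.
by apply: DeriveDef; rewrite /derivable /derive E.
Qed.

Lemma line_continuous (x v : V) : continuous (fun s : R => s *: v + x).
Proof.
move=> s; apply: cvgD; last exact: cvg_cst.
exact: scalel_continuous.
Qed.

Lemma MVT_line f x v : (forall s, 0 <= s <= 1 -> derivable f (s *: v + x) v) ->
  exists2 s, 0 <= s <= 1 & f (v + x) - f x = 'D_v f (s *: v + x).
Proof.
move=> fd.
have D (s : R) : 0 <= s <= 1 -> is_derive s 1 (fun h => f (h *: v + x)) ('D_v f (s *: v + x)).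
  by move=> s01; apply: is_derive_line; apply: fd.
have [||s] := @MVT_segment R (fun h => f (h *: v + x)) (fun s => 'D_v f (s *: v + x)) 0 1 ler01.
- by move=> s; rewrite in_itv/= => /andP[s0 s1]; apply: D; rewrite !ltW.
- apply: derivable_within_continuous => s; rewrite in_itv/= => s01.
  by have [] := D s s01.
rewrite in_itv/= => s01; rewrite scale1r scale0r add0r subr0 mulr1 => E.
by exists s.
Qed.

Lemma is_derive_scalev f x v (h : R) : derivable f x v ->
  is_derive x (h *: v) f (h * 'D_v f x).
Proof.
move=> fd; pose phi := fun s : R => f (s *: v + x).
have pd : is_derive (0 : R) 1 phi ('D_v f x).
  by have := @is_derive_line f x v 0; rewrite scale0r add0r => /(_ fd).
have pD : differentiable phi 0 by apply/derivable1_diffP; case: pd.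
have E : (fun k : R => k^-1 *: ((f \o shift x) (k *: (h *: v)) - f x))
  = (fun k => k^-1 *: ((phi \o shift 0) (k *: h) - phi 0)).
  by apply/funext => k; rewrite /phi /= addr0 scale0r add0r scalerA.
have D : 'D_h phi 0 = h * 'D_v f x.
  rewrite deriveE//; have /esym := @deriveE _ _ _ phi 0 1 pD.
  rewrite (_ : 'D_1 phi 0 = 'D_v f x); last by case: pd.
  by move=> <-; rewrite -[h in LHS]mulr1 [LHS]linearZ.
by apply: DeriveDef; rewrite -?D /derivable /derive E//; apply: (@diff_derivable _ _ _ phi 0 h).
Qed.

Lemma deriv_zero_near f U x : open U -> U x -> 
  (forall y v, U y -> is_derive y v f 0) -> \forall y \near x, f y = f x.
Proof.
move=> oU Ux fd; have /nbhs_ballP[e /= e0 eU] : nbhs x U by apply: open_nbhs_nbhs.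
apply/nbhs_ballP; exists e => //= y; rewrite -ball_normE/= distrC => xy.
have eU' (s : R) : 0 <= s <= 1 -> U (s *: (y - x) + x).
  case/andP=> s0 s1; apply: eU; rewrite -ball_normE/= opprD addrCA subrr addr0 normrN.
  by rewrite normrZ ger0_norm// (le_lt_trans _ xy)// ler_piMl.
have [s s01|s s01] := @MVT_line f x (y - x); first by case: (fd _ (y - x) (eU' s s01)).
rewrite subrK; have [_ ->] := fd _ (y - x) (eU' s s01).
by move/eqP; rewrite subr_eq0 => /eqP.
Qed.

Lemma Ck1_ball f U x v : open U -> U x -> Ck 1 U f -> forall e, 0 < e ->
  exists2 d, 0 < d & forall y, `|y - x| < d ->
    U y /\ `|'D_v f y - 'D_v f x| < e.
Proof.
move=> oU Ux [_ /(_ v)[fd [Dc _]]] e e0; have {}Dc := Dc x Ux.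
have : nbhs x (fun y => U y /\ `|'D_v f y - 'D_v f x| < e).
  apply: filterI; first exact: open_nbhs_nbhs.
  by move/cvgr_distC_lt : Dc; apply.
move=> /nbhs_ballP[d /= d0 H]; exists d => // y yx; apply: H.
by rewrite -ball_normE/= distrC.
Qed.

(* D_{u+v} f splits as an increment along u, based at x+hv, plus one along v;
   the first is a value of D_u f near x by the mean value theorem. *)
Lemma derive_addv f U x u v : open U -> U x -> Ck 1 U f ->
  'D_(u + v) f x = 'D_u f x + 'D_v f x.
Proof.
move=> oU Ux f1; have [_ fD] := f1.
have [duv _] := fD (u + v); have [du _] := fD u; have [dv _] := fD v.
apply/cvg_lim => //.
apply/cvgrPdist_lt => e e0.
have e20 : 0 < e / 2 by rewrite divr_gt0.
have [d d0 Hd] := Ck1_ball u oU Ux f1 e20.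
have /cvgrPdist_lt/(_ _ e20) Hv := (dv x Ux : derivable f x v).
have M0 : 0 < `|u| + `|v| + 1 by rewrite ltr_wpDl ?addr_ge0.
near=> h.
have h0 : h != 0 by near: h; apply: nbhs_dnbhs_neq.
have hd : `|h| * (`|u| + `|v| + 1) < d.
  rewrite -ltr_pdivlMr//; near: h.
  by apply: dnbhs0_lt; rewrite divr_gt0.
have Uy (s : R) : 0 <= s <= 1 -> `|s *: (h *: u) + (h *: v + x) - x| < d.
  case/andP=> s0 s1; rewrite addrA addrK (le_lt_trans _ hd)//.
  rewrite (le_trans (ler_normD _ _))// scalerA !normrZ ?normrM (ger0_norm s0).
  rewrite !mulrDr mulr1 -[leLHS]addr0 lerD// lerD2r -mulrA.
  by rewrite ler_piMl// mulr_ge0.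
have [s s01|s s01] := @MVT_line f (h *: v + x) (h *: u).
  by have [/du/is_derive_scalev+ _] := Hd _ (Uy s s01) => /(_ h)[].
have [Uys Hds] := Hd _ (Uy s s01).
have [_ ->] := is_derive_scalev h (du _ Uys) => E.
have {}E : f (h *: (u + v) + x) - f x =
    h *: 'D_u f (s *: (h *: u) + (h *: v + x)) + (f (h *: v + x) - f x).
  by rewrite scalerDr -addrA -[RHS]/(h * _ + _) -E subrKA.
rewrite /= E scalerDr [h^-1 *: (h *: _)]scalerA mulVf// scale1r opprD addrACA (splitr e).
rewrite (le_lt_trans (ler_normD _ _))// ltrD//; first by rewrite distrC.
by near: h; exact: Hv.
Unshelve. all: by end_near. Qed.

End Scalar.

Lemma Ck_derive {V W : normedModType R} k U (f : V -> W) v :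
  Ck k.+1 U f -> Ck k U (fun x => 'D_v f x).
Proof. by move=> [_ /(_ v)[]]. Qed.

Lemma Ck_derivable {V W : normedModType R} k U (f : V -> W) x v :
  Ck k.+1 U f -> U x -> derivable f x v.
Proof. by move=> [_ /(_ v)[+ _]] => /[apply]. Qed.

Lemma derive_sum_delta n (f : 'rV[R]_n -> R) U x v : open U -> U x -> Ck 1 U f ->
  'D_v f x = \sum_i v 0 i * 'D_(delta_mx 0 i) f x.
Proof.
move=> oU Ux f1; rewrite {1}(row_sum_delta v).
elim/big_ind2 : _ => [|a b c d aE bE|i _].
- by rewrite derive0.
- by rewrite (derive_addv _ _ oU Ux f1) aE bE.
- have fi : derivable f x (delta_mx 0 i) by apply: Ck_derivable f1 Ux.
  by have [_ ->] := is_derive_scalev (v 0 i) fi.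
Qed.

(** [Ck] speaks of directional derivatives, whereas the chain rule needs a differential. Its
    candidate is L; the mean value theorem on the segment from x to x + h reduces the remainder to
    the oscillation of the partial derivatives near x. *)
Lemma C1_differentiable n (f : 'rV[R]_n -> R) U x : open U -> U x -> Ck 1 U f ->
  differentiable f x.
Proof.
move=> oU Ux f1.
pose L : 'rV[R]_n -> R := fun v => \sum_i v 0 i * 'D_(delta_mx 0 i) f x.
have Ll : linear L.
  move=> a u v; rewrite /L scaler_sumr -big_split/=; apply: eq_bigr => i _.
  by rewrite !mxE mulrDl -mulrA.
pose Lpack := GRing.isLinear.Build R 'rV[R]_n R *:%R L Ll.
pose LL : {linear 'rV[R]_n -> R} := HB.pack L Lpack.
have Lc : continuous L.
  move=> v; apply: (@cvg_sumr R 'rV[R]_n (nbhs v) (nbhs_filter v) 'I_n) => i.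
  by apply: cvgM; [exact: (differentiable_continuous (differentiable_coord v 0 i))|apply: cvg_cst].
have H : f \o shift x = cst (f x) + LL +o_ 0 id.
  apply/eqaddoP => e e0.
  (* Dividing by [n.+1] instead of n covers n = 0 as well. *)
  have en0 : 0 < e / n.+1%:R by rewrite divr_gt0.
  have near_d : \forall y \near x, U y /\
     forall i, `|'D_(delta_mx 0 i) f y - 'D_(delta_mx 0 i) f x| < e / n.+1%:R.
    apply: (@filterI _ (nbhs x) (nbhs_filter x)); first exact: open_nbhs_nbhs.
    apply: (@filter_forall _ _ _ _ (nbhs_filter x)) => i.
    by have /cvgr_distC_lt := Ck_cont (Ck_derive (delta_mx 0 i) f1) Ux; apply.
  have /nbhs_ballP[d /= d0 Hd] := near_d.
  near=> h.
  have hd : `|h| < d.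
    near: h; apply/nbhs_ballP; exists d => //= h.
    by rewrite -ball_normE/= sub0r normrN.
  have Hs (s : R) : 0 <= s <= 1 -> ball x d (s *: h + x).
    case/andP=> s0 s1; rewrite -ball_normE/= opprD addrCA subrr addr0 normrN.
    by rewrite normrZ ger0_norm// (le_lt_trans _ hd)// ler_piMl.
  have [s s01|s s01] := @MVT_line _ f x h.
    by apply: Ck_derivable f1 _; have [] := Hd _ (Hs s s01).
  have [Us Ds] := Hd _ (Hs s s01).
  rewrite (derive_sum_delta _ oU Us f1) => E.
  rewrite -[_ h]/(f (h + x) - (f x + L h)) opprD addrA E /L -sumrB.
  apply: le_trans (ler_norm_sum _ _ _) _.
  apply: (@le_trans _ _ (\sum_(i < n) (e / n.+1%:R) * `|h|)).
    apply: ler_sum => i _; rewrite -mulrBr normrM mulrC ler_pM//; first exact/ltW/Ds.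
    by rewrite [leRHS]/Num.Def.normr/= mx_normrE; apply: (le_bigmax _ _ (0, i)).
  rewrite sumr_const card_ord -[leLHS]mulr_natr mulrAC ler_wpM2r// -mulrA ler_piMr ?ltW//.
  by rewrite mulrC ltr_pdivrMr// mul1r ltr_nat.
have E : 'd f x = LL :> ('rV[R]_n -> R) by apply: diff_unique.
by apply/diff_locallyP; split; rewrite E.
Unshelve. all: by end_near. Qed.

End CkCalculus.

Lemma subr_swap (R : zmodType) (a b c d : R) : a - b - (c - d) = a - c - (b - d).
Proof. by rewrite !opprB addrACA [RHS]addrACA (addrC (- c)). Qed.

Lemma dist_half (R : realFieldType) (e z a b : R) :
  `|z - a| < e / 2 -> `|z - b| < e / 2 -> `|a - b| <= e.
Proof.
move=> za zb; rewrite -(subrKA z) (splitr e) (le_trans (ler_normD _ _))//.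
by rewrite lerD ?ltW// distrC.
Qed.

(** * Symmetry of second derivatives *)

Section Schwarz.
Context {R : realType} {V : normedModType R}.
Implicit Types (f : V -> R) (U : set V).

Lemma is_derive_shiftv f a x v d :
  is_derive (x + a) v f d -> is_derive x v (fun y => f (y + a)) d.
Proof.
have E : (fun h : R => h^-1 *: (((fun y => f (y + a)) \o shift x) (h *: v) - f (x + a)))
  = (fun h => h^-1 *: ((f \o shift (x + a)) (h *: v) - f (x + a))).
  by apply/funext => h /=; rewrite addrA.
by move=> [fd <-]; apply: DeriveDef; rewrite /derivable /derive E.
Qed.

(** The mean value theorem is used twice: along u for the increment of f in direction v, and along v
    for D_u f. *)
Lemma second_difference f U x u v d h : Ck 2 U f ->
  (forall y, `|y - x| < d -> U y) -> `|h| * (`|u| + `|v|) < d ->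
  exists2 y, `|y - x| < d &
    (f (h *: u + x + h *: v) - f (h *: u + x)) - (f (x + h *: v) - f x)
    = h * h * 'D_v (fun z => 'D_u f z) y.
Proof.
move=> f2 dU hd; have f1 := CkS f2.
have ball s s' : 0 <= s <= 1 -> 0 <= s' <= 1 ->
    `|s' *: (h *: v) + (s *: (h *: u) + x) - x| < d.
  move=> /andP[s0 s1] /andP[s'0 s'1]; rewrite addrA addrK (le_lt_trans _ hd)//.
  rewrite (le_trans (ler_normD _ _))// !scalerA !normrZ ?normrM (ger0_norm s0) (ger0_norm s'0).
  rewrite addrC mulrDr -!mulrA lerD//.
    by rewrite ler_piMl ?mulr_ge0.
  by rewrite ler_piMl ?mulr_ge0.
have z01 : 0 <= (0 : R) <= 1 by rewrite lexx ler01.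
have o01 : 0 <= (1 : R) <= 1 by rewrite lexx ler01.
pose F y := f (y + h *: v) - f y.
have Fd s : 0 <= s <= 1 -> is_derive (s *: (h *: u) + x) (h *: u) F
    (h * ('D_u f (s *: (h *: u) + x + h *: v) - 'D_u f (s *: (h *: u) + x))).
  move=> s01; rewrite mulrBr.
  have H1 := dU _ (ball _ _ s01 o01); have H0 := dU _ (ball _ _ s01 z01).
  rewrite scale0r add0r in H0; rewrite scale1r addrC in H1.
  apply: is_deriveB.
    by apply: is_derive_shiftv; apply: is_derive_scalev; apply: Ck_derivable f1 H1.
  by apply: is_derive_scalev; apply: Ck_derivable f1 H0.
have [s s01|s s01] := @MVT_line _ _ F x (h *: u); first by case: (Fd s s01).
have [_ ->] := Fd s s01; rewrite /F => ->.
pose y := s *: (h *: u) + x.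
have gd s' : 0 <= s' <= 1 -> is_derive (s' *: (h *: v) + y) (h *: v) (fun z => 'D_u f z)
    (h * 'D_v (fun z => 'D_u f z) (s' *: (h *: v) + y)).
  move=> s'01; apply: is_derive_scalev.
  by apply: Ck_derivable (Ck_derive _ f2) (dU _ (ball _ _ s01 s'01)).
have [s' s'01|s' s'01] := @MVT_line _ _ (fun z => 'D_u f z) y (h *: v).
  by case: (gd s' s'01).
have [_ ->] := gd s' s'01; rewrite [_ + y]addrC => ->.
by exists (s' *: (h *: v) + y); [apply: ball|rewrite mulrA].
Qed.

(** The second difference is symmetric in u and v, so the two mixed derivatives take a common value
    at points y1 and y2 close to x, and both are continuous at x. *)
Lemma derive_swap f U x u v : open U -> U x -> Ck 2 U f ->
  'D_v (fun y => 'D_u f y) x = 'D_u (fun y => 'D_v f y) x.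
Proof.
move=> oU Ux f2; apply/eqP; rewrite -subr_eq0 -normr_le0; apply/ler_addgt0Pr => e e0.
have e20 : 0 < e / 2 by rewrite divr_gt0.
have [d1 d10 H1] := Ck1_ball v oU Ux (Ck_derive u f2) e20.
have [d2 d20 H2] := Ck1_ball u oU Ux (Ck_derive v f2) e20.
pose d := Num.min d1 d2; have d0 : 0 < d by rewrite lt_min d10.
pose M := `|u| + `|v| + 1.
have M0 : 0 < M by rewrite ltr_wpDl ?addr_ge0.
(* Small enough for the parallelogram spanned by h u and h v at x to stay within distance d of x. *)
pose h := d / 2 / M.
have h0 : 0 < h by rewrite !divr_gt0.
have hM : `|h| * (`|u| + `|v|) < d.
  rewrite gtr0_norm// (@le_lt_trans _ _ (h * M))//.
    by rewrite ler_wpM2l ?ltW// ltrDl.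
  by rewrite divfK ?gt_eqF// ltr_pdivrMr// ltr_pMr// ltr1n.
have dU y : `|y - x| < d -> U y by rewrite lt_min => /andP[/H1[]].
have [y1 yd1 E1] := second_difference f2 dU hM.
have [y2 yd2 E2] : exists2 y, `|y - x| < d &
    (f (h *: v + x + h *: u) - f (h *: v + x)) - (f (x + h *: u) - f x)
    = h * h * 'D_u (fun z => 'D_v f z) y.
  by apply: second_difference f2 dU _; rewrite [X in _ * X]addrC.
have E : h * h * 'D_v (fun z => 'D_u f z) y1 = h * h * 'D_u (fun z => 'D_v f z) y2.
  apply: etrans (esym E1) (etrans _ E2).
  have -> : h *: v + x + h *: u = h *: u + x + h *: v.
    by rewrite addrAC (addrC (h *: v)) addrAC.
  by rewrite (addrC (h *: v)) (addrC (h *: u)); apply: subr_swap.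
have {}E := mulfI (mulf_neq0 (lt0r_neq0 h0) (lt0r_neq0 h0)) E.
move: yd1; rewrite lt_min => /andP[/H1[_ B1] _].
move: yd2; rewrite lt_min => /andP[_ /H2[_ B2]].
by rewrite add0r; apply: (dist_half B1); rewrite E.
Qed.

End Schwarz.

Section Components.
Context {R : realType} {V : normedModType R}.

Definition coordf m n (i : 'I_m) (j : 'I_n) (A : 'M[R]_(m, n)) : R := A i j.

Lemma coordf_linear m n i j : linear (@coordf m n i j).
Proof. by move=> a u v; rewrite /coordf !mxE. Qed.

HB.instance Definition _ m n i j :=
  GRing.isLinear.Build R 'M[R]_(m, n) R *:%R (coordf i j) (@coordf_linear m n i j).

Lemma coordf_continuous m n i j : continuous (@coordf m n i j).
Proof. by move=> A; exact: (differentiable_continuous (differentiable_coord A i j)). Qed.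

Lemma Ck_coord m n k U (f : V -> 'M[R]_(m, n)) i j : open U -> Ck k U f ->
  Ck k U (fun x => f x i j).
Proof. by move=> oU; apply: (Ck_lin (L := coordf i j)) => //; apply: coordf_continuous. Qed.

Lemma derive_coordE m n (f : V -> 'M[R]_(m, n)) x v i j : derivable f x v ->
  'D_v (fun y => f y i j) x = ('D_v f x) i j.
Proof. by move=> /derive_mx->; rewrite mxE. Qed.

Lemma Ck_sum k U n (f : 'I_n -> V -> R) : open U -> (forall i, Ck k U (f i)) ->
  Ck k U (fun x => \sum_i f i x).
Proof.
move=> oU fk.
suff H (r : seq 'I_n) : Ck k U (fun x => \sum_(i <- r) f i x) by apply: H.
elim: r => [|i r IH].
  by apply: Ck_ext (Ck_cst k U (0 : R)) => // x _; rewrite big_nil.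
by apply: Ck_ext (Ck_add oU (fk i) IH) => // x _; rewrite big_cons.
Qed.

(** Only the derivative of phi along v is available, so phi is restricted to the line through x in
    direction v: the curve c is differentiable as a function of one variable, and f is so by
    [C1_differentiable]. *)
Lemma is_derive_chain n (f : 'rV[R]_n -> R) (phi : V -> 'rV[R]_n) U x v :
  open U -> U (phi x) -> Ck 1 U f -> derivable phi x v ->
  is_derive x v (f \o phi) (\sum_i ('D_v phi x) 0 i * 'D_(delta_mx 0 i) f (phi x)).
Proof.
move=> oU Up f1 dphi.
pose c := fun h : R => phi (h *: v + x).
have Ec : (fun h : R => h^-1 *: ((phi \o shift x) (h *: v) - phi x))
    = (fun h => h^-1 *: ((c \o shift 0) (h *: 1) - c 0)).
  by apply/funext => h; rewrite /c /= addr0 scale0r add0r [_%:A]mulr1.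
have cd : derivable c 0 1 by rewrite /derivable -Ec.
have cD : 'D_1 c 0 = 'D_v phi x by rewrite /derive -Ec.
have c0 : c 0 = phi x by rewrite /c scale0r add0r.
have cdiff : differentiable c 0 by apply/derivable1_diffP.
have fdiff : differentiable f (c 0) by rewrite c0; apply: C1_differentiable f1.
have fcd : differentiable (f \o c) 0 by apply: differentiable_comp.
have E : (fun h : R => h^-1 *: (((f \o phi) \o shift x) (h *: v) - (f \o phi) x))
    = (fun h => h^-1 *: (((f \o c) \o shift 0) (h *: 1) - (f \o c) 0)).
  by apply/funext => h; rewrite /c /= addr0 scale0r add0r [_%:A]mulr1.
have D : 'D_v (f \o phi) x = 'D_1 (f \o c) 0 by rewrite /derive E.
have Dd : derivable (f \o phi) x v.
  by rewrite /derivable E; exact: (@diff_derivable _ _ _ (f \o c) 0 1).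
apply: (DeriveDef Dd); rewrite D -(derive_sum_delta _ oU Up f1) -cD -c0.
by rewrite (deriveE _ fdiff) (deriveE _ cdiff) (deriveE _ fcd) diff_comp.
Qed.

Lemma Ck_comp n (f : 'rV[R]_n -> R) (phi : V -> 'rV[R]_n) U U' k :
  open U -> open U' -> (forall x, U x -> U' (phi x)) ->
  smooth_open U phi -> Ck k U' f -> Ck k U (f \o phi).
Proof.
move=> oU oU' UU' phis; elim: k f => [|k IH] f fk.
  split=> // x Ux; apply: continuous_comp; first exact: (Ck_cont (phis 0)).
  exact: (Ck_cont fk (UU' _ Ux)).
have f1 : Ck 1 U' f by elim: {IH} k fk => // k IHk /CkS.
split.
  move=> x Ux; apply: continuous_comp; first exact: (Ck_cont (phis 0)).
  exact: (Ck_cont fk (UU' _ Ux)).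
move=> v; have D x : U x -> is_derive x v (f \o phi)
    (\sum_i ('D_v phi x) 0 i * 'D_(delta_mx 0 i) f (phi x)).
  by move=> Ux; apply: is_derive_chain (UU' _ Ux) f1 _ => //; apply: Ck_derivable (phis 1) Ux.
split; first by move=> x /D[].
have H : Ck k U (fun x => \sum_i ('D_v phi x) 0 i * 'D_(delta_mx 0 i) f (phi x)).
  apply: Ck_sum => // i; apply: Ck_mul => //.
    by apply: Ck_coord => //; exact: (Ck_derive v (phis k.+1)).
  exact: (IH (fun z => 'D_(delta_mx 0 i) f z) (Ck_derive (delta_mx 0 i) fk)).
by apply: Ck_ext H => // x; rewrite inE => Ux; have [_ ->] := D x Ux.
Qed.

End Components.

(** * The ring of smooth complex functions *)

(** Openness is bundled with the set so that the ring structure of [smf O] is found from O alone. *)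
Record openset (R : realType) n :=
  OpenSet { oset :> set 'rV[R]_n; osetP : open oset }.

Section SmoothC.
Context {R : realType} {n : nat}.
Implicit Types (U : set 'rV[R]_n) (f g : 'rV[R]_n -> R[i]).

Definition smC U f :=
  smooth_open U (fun x => complex.Re (f x)) /\ smooth_open U (fun x => complex.Im (f x)).

Definition dC (v : 'rV[R]_n) f (x : 'rV[R]_n) : R[i] :=
  Complex ('D_v (fun y => complex.Re (f y)) x) ('D_v (fun y => complex.Im (f y)) x).

Lemma smC_ext U f g : open U -> {in U, f =1 g} -> smC U f -> smC U g.
Proof.
move=> oU fg [f1 f2]; split=> k.
  by apply: Ck_ext (f1 k) => // x xU; rewrite fg.
by apply: Ck_ext (f2 k) => // x xU; rewrite fg.
Qed.

Lemma smC_cst U c : smC U (cst c).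
Proof. by split=> k; apply: Ck_cst. Qed.

Lemma smC_add U f g : open U -> smC U f -> smC U g -> smC U (fun x => f x + g x).
Proof.
move=> oU [f1 f2] [g1 g2]; split=> k.
  by apply: Ck_ext (Ck_add oU (f1 k) (g1 k)) => // x _; rewrite /= raddfD.
by apply: Ck_ext (Ck_add oU (f2 k) (g2 k)) => // x _; rewrite /= raddfD.
Qed.

Lemma ReM (z w : R[i]) : complex.Re (z * w) =
  complex.Re z * complex.Re w - complex.Im z * complex.Im w.
Proof. by case: z => a b; case: w. Qed.
Lemma ImM (z w : R[i]) : complex.Im (z * w) =
  complex.Re z * complex.Im w + complex.Im z * complex.Re w.
Proof. by case: z => a b; case: w. Qed.

Lemma smC_mul U f g : open U -> smC U f -> smC U g -> smC U (fun x => f x * g x).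
Proof.
move=> oU [f1 f2] [g1 g2]; split=> k.
  apply: Ck_ext (Ck_add oU (Ck_mul oU (f1 k) (g1 k))
    (Ck_opp oU (Ck_mul oU (f2 k) (g2 k)))) => // x _.
  by rewrite /= ReM.
apply: Ck_ext (Ck_add oU (Ck_mul oU (f1 k) (g2 k)) (Ck_mul oU (f2 k) (g1 k))) => // x _.
by rewrite /= ImM.
Qed.

Lemma smC_opp U f : open U -> smC U f -> smC U (fun x => - f x).
Proof.
move=> oU [f1 f2]; split=> k.
  by apply: Ck_ext (Ck_opp oU (f1 k)) => // x _; rewrite raddfN.
by apply: Ck_ext (Ck_opp oU (f2 k)) => // x _; rewrite raddfN.
Qed.

Lemma smC_conj U f : open U -> smC U f -> smC U (fun x => conjc (f x)).
Proof.
move=> oU [f1 f2]; split=> k.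
  by apply: Ck_ext (f1 k) => // x _; case: (f x).
by apply: Ck_ext (Ck_opp oU (f2 k)) => // x _; case: (f x).
Qed.

Lemma smC_d U f v : smC U f -> smC U (dC v f).
Proof. by move=> [f1 f2]; split=> k; [exact: Ck_derive (f1 k.+1)|exact: Ck_derive (f2 k.+1)]. Qed.

Lemma smC_real U (f : 'rV[R]_n -> R) : smooth_open U f -> smC U (fun x => (f x)%:C%C).
Proof. by move=> fs; split=> k; [exact: fs|exact: Ck_cst]. Qed.

Lemma smC_inv U f : open U -> (forall x, U x -> f x != 0) -> smC U f ->
  smC U (fun x => (f x)^-1).
Proof.
move=> oU f0 [f1 f2].
pose m x := complex.Re (f x) * complex.Re (f x) + complex.Im (f x) * complex.Im (f x).
have mk k : Ck k U m.
  by apply: (Ck_add oU (Ck_mul oU (f1 k) (f1 k)) (Ck_mul oU (f2 k) (f2 k))).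
have m0 x : U x -> m x != 0.
  move/f0; rewrite /m; case: (f x) => a b /= h; apply: contra_neq h.
  move=> /eqP; rewrite -!expr2 paddr_eq0 ?sqr_ge0// !sqrf_eq0 => /andP[/eqP-> /eqP->].
  by [].
have iE x : U x -> (f x)^-1 = Complex (complex.Re (f x) / m x) (- (complex.Im (f x) / m x)).
  by move=> _; rewrite /m; case: (f x) => a b; rewrite -!expr2 /=.
split=> k.
  apply: Ck_ext (Ck_mul oU (f1 k) (Ck_inv oU m0 (mk k))) => // x.
  by rewrite inE => /iE->.
apply: Ck_ext (Ck_opp oU (Ck_mul oU (f2 k) (Ck_inv oU m0 (mk k)))) => // x.
by rewrite inE => /iE->.
Qed.

End SmoothC.

Section DCalculus.
Context {R : realType} {n : nat}.
Implicit Types (U : set 'rV[R]_n) (f g : 'rV[R]_n -> R[i]).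

Lemma complex_eq (z w : R[i]) : complex.Re z = complex.Re w ->
  complex.Im z = complex.Im w -> z = w.
Proof. by case: z => a b; case: w => c d /= -> ->. Qed.

Lemma dC_eq U f g v x : open U -> U x -> {in U, f =1 g} -> dC v f x = dC v g x.
Proof.
move=> oU Ux fg; congr Complex; apply: near_eq_derive.
  by apply: open_eq_near oU Ux _ => y yU; rewrite fg.
by apply: open_eq_near oU Ux _ => y yU; rewrite fg.
Qed.

Lemma dC_cst (v : 'rV[R]_n) c (x : 'rV[R]_n) : dC v (cst c) x = 0 :> R[i].
Proof. by rewrite /dC /=; congr Complex; exact: derive_cst. Qed.

Lemma dCD U f g v x : U x -> smC U f -> smC U g ->
  dC v (fun y => f y + g y) x = dC v f x + dC v g x.
Proof.
move=> Ux [f1 f2] [g1 g2]; apply: complex_eq; rewrite raddfD /=.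
  rewrite -deriveD; first by congr ('D_v _ x); apply/funext => y; rewrite raddfD.
    exact: Ck_derivable (f1 1) Ux.
  exact: Ck_derivable (g1 1) Ux.
rewrite -deriveD; first by congr ('D_v _ x); apply/funext => y; rewrite raddfD.
  exact: Ck_derivable (f2 1) Ux.
exact: Ck_derivable (g2 1) Ux.
Qed.

Lemma dCM U f g v x : U x -> smC U f -> smC U g ->
  dC v (fun y => f y * g y) x = dC v f x * g x + f x * dC v g x.
Proof.
move=> Ux [f1 f2] [g1 g2].
have d1 : derivable (fun y => complex.Re (f y)) x v by exact: Ck_derivable (f1 1) Ux.
have d2 : derivable (fun y => complex.Im (f y)) x v by exact: Ck_derivable (f2 1) Ux.
have e1 : derivable (fun y => complex.Re (g y)) x v by exact: Ck_derivable (g1 1) Ux.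
have e2 : derivable (fun y => complex.Im (g y)) x v by exact: Ck_derivable (g2 1) Ux.
have M (a b : 'rV[R]_n -> R) : derivable a x v -> derivable b x v ->
   is_derive x v (fun y => a y * b y) (a x * 'D_v b x + b x * 'D_v a x).
  by move=> da db; apply: DeriveDef; [apply: (derivableM da db)|apply: (deriveM da db)].
apply: complex_eq; rewrite raddfD /= !(ReM, ImM) /=.
  rewrite (_ : (fun y => _) = (fun y => complex.Re (f y) * complex.Re (g y)) -
      (fun y => complex.Im (f y) * complex.Im (g y))); last first.
    by apply/funext => y; rewrite ReM.
  rewrite deriveB; [|by case: (M _ _ d1 e1)|by case: (M _ _ d2 e2)].
  have [_ ->] := M _ _ d1 e1; have [_ ->] := M _ _ d2 e2.
  by move: ('D_v _ x) ('D_v _ x) ('D_v _ x) ('D_v _ x) => *; ring.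
rewrite (_ : (fun y => _) = (fun y => complex.Re (f y) * complex.Im (g y)) +
    (fun y => complex.Im (f y) * complex.Re (g y))); last first.
  by apply/funext => y; rewrite ImM.
rewrite deriveD; [|by case: (M _ _ d1 e2)|by case: (M _ _ d2 e1)].
have [_ ->] := M _ _ d1 e2; have [_ ->] := M _ _ d2 e1.
by move: ('D_v _ x) ('D_v _ x) ('D_v _ x) ('D_v _ x) => *; ring.
Qed.

Lemma dC_conj U f v x : U x -> smC U f ->
  dC v (fun y => conjc (f y)) x = conjc (dC v f x).
Proof.
move=> Ux [f1 f2]; apply: complex_eq => /=.
  by congr ('D_v _ x); apply/funext => y; case: (f y).
rewrite -deriveN; first by congr ('D_v _ x); apply/funext => y; rewrite -[RHS]/(- complex.Im (f y)); case: (f y).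
exact: Ck_derivable (f2 1) Ux.
Qed.

Lemma dC_swap U f u v x : open U -> U x -> smC U f ->
  dC v (dC u f) x = dC u (dC v f) x.
Proof.
move=> oU Ux [f1 f2]; apply: complex_eq => /=.
  exact: derive_swap (f1 2).
exact: derive_swap (f2 2).
Qed.

Lemma dC_sum_delta U f v x : open U -> U x -> smC U f ->
  dC v f x = \sum_i (v 0 i)%:C%C * dC (delta_mx 0 i) f x.
Proof.
move=> oU Ux [f1 f2]; apply: complex_eq; rewrite raddf_sum /=.
  rewrite (derive_sum_delta _ oU Ux (f1 1)); apply: eq_bigr => i _.
  by rewrite ?ReM /= mul0r subr0.
rewrite (derive_sum_delta _ oU Ux (f2 1)); apply: eq_bigr => i _.
by rewrite ?ImM /= mul0r addr0.
Qed.

Lemma dC_coord (v : 'rV[R]_n) j x : dC v (fun x => (x 0 j)%:C%C) x = (v 0 j)%:C%C.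
Proof.
apply: complex_eq => /=; last exact: derive_cst.
by rewrite derive_coordE ?derive_id//; exact: derivable_id.
Qed.

Lemma dC_Re v f x : complex.Re (dC v f x) = 'D_v (fun y => complex.Re (f y)) x.
Proof. by []. Qed.

Lemma dC_Im v f x : complex.Im (dC v f x) = 'D_v (fun y => complex.Im (f y)) x.
Proof. by []. Qed.

End DCalculus.

Opaque dC.

Section Ring.
Context {R : realType} {n : nat} (O : openset R n).
Local Notation V := (oset O).
Let oV : open V := @osetP R n O.

(* Extension by 0 makes pointwise equality on O the same as equality. *)
Record smf := Smf { fval :> 'rV[R]_n -> R[i];
                    smfP : smC V fval; smf_out : forall x, ~ V x -> fval x = 0 }.

HB.instance Definition _ := gen_eqMixin smf.
HB.instance Definition _ := gen_choiceMixin smf.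

Lemma smf_eq (f g : smf) : (forall x, V x -> f x = g x) -> f = g.
Proof.
case: f g => [f fs fo] [g gs go] /= fg.
have E : f = g.
  by apply/funext => x; have [Vx|nVx] := pselect (V x); [exact: fg|rewrite fo// go].
by case: _ / E in gs go fg *; congr Smf; exact: Prop_irrelevance.
Qed.

(* Opaque, so that unification never unfolds the ring operations below. *)
Lemma mkf_ex f : smC V f -> {g : smf | forall x, V x -> g x = f x}.
Proof.
move=> fs; pose g x := if `[< V x >] then f x else 0.
have gE x : V x -> g x = f x by rewrite /g; case: asboolP.
have gs : smC V g by apply: smC_ext fs => // x; rewrite inE => /gE->.
have go x : ~ V x -> g x = 0 by rewrite /g; case: asboolP.
by exists (Smf gs go).
Qed.

Definition mkf f (fs : smC V f) := sval (mkf_ex fs).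

Lemma mkfE f (fs : smC V f) x : V x -> mkf fs x = f x.
Proof. exact: (svalP (mkf_ex fs)). Qed.

Definition fcst c := mkf (@smC_cst R n V c).
Definition fadd (f g : smf) := mkf (smC_add oV (smfP f) (smfP g)).
Definition fmul (f g : smf) := mkf (smC_mul oV (smfP f) (smfP g)).
Definition fopp (f : smf) := mkf (smC_opp oV (smfP f)).
Definition fconj (f : smf) := mkf (smC_conj oV (smfP f)).
Definition fd v (f : smf) := mkf (smC_d v (smfP f)).

Lemma faddA : associative fadd.
Proof. by move=> f g h; apply: smf_eq => x Vx; rewrite !mkfE// addrA. Qed.
Lemma faddC : commutative fadd.
Proof. by move=> f g; apply: smf_eq => x Vx; rewrite !mkfE// addrC. Qed.
Lemma fadd0 : left_id (fcst 0) fadd.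
Proof. by move=> f; apply: smf_eq => x Vx; rewrite !mkfE// add0r. Qed.
Lemma faddN : left_inverse (fcst 0) fopp fadd.
Proof. by move=> f; apply: smf_eq => x Vx; rewrite !mkfE// addNr. Qed.
Lemma fmulA : associative fmul.
Proof. by move=> f g h; apply: smf_eq => x Vx; rewrite !mkfE// mulrA. Qed.
Lemma fmulC : commutative fmul.
Proof. by move=> f g; apply: smf_eq => x Vx; rewrite !mkfE// mulrC. Qed.
Lemma fmul1 : left_id (fcst 1) fmul.
Proof. by move=> f; apply: smf_eq => x Vx; rewrite !mkfE// mul1r. Qed.
Lemma fmulD : left_distributive fmul fadd.
Proof. by move=> f g h; apply: smf_eq => x Vx; rewrite !mkfE// mulrDl. Qed.

HB.instance Definition _ := GRing.isZmodule.Build smf faddA faddC fadd0 faddN.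
HB.instance Definition _ :=
  GRing.Zmodule_isComPzRing.Build smf fmulA fmulC fmul1 fmulD.

Section Values.
Variables (x : 'rV[R]_n) (Vx : V x).
Lemma fvalD (f g : smf) : (f + g) x = f x + g x. Proof. exact: mkfE. Qed.
Lemma fvalM (f g : smf) : (f * g) x = f x * g x. Proof. exact: mkfE. Qed.
Lemma fvalN (f : smf) : (- f) x = - f x. Proof. exact: mkfE. Qed.
Lemma fvalB (f g : smf) : (f - g) x = f x - g x. Proof. by rewrite fvalD fvalN. Qed.
Lemma fval0 : (0 : smf) x = 0. Proof. exact: mkfE. Qed.
Lemma fval1 : (1 : smf) x = 1. Proof. exact: mkfE. Qed.
Lemma fval_cst c : fcst c x = c. Proof. exact: mkfE. Qed.
Lemma fval_conj f : fconj f x = conjc (f x). Proof. exact: mkfE. Qed.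
Lemma fval_d v f : fd v f x = dC v f x. Proof. exact: mkfE. Qed.
Lemma fval_sum m (f : 'I_m -> smf) : (\sum_i f i) x = \sum_i f i x.
Proof.
by elim/big_ind2 : _ => [|a b c d <- <-|//]; [exact: fval0|rewrite fvalD].
Qed.
End Values.

Lemma fdD v f g : fd v (f + g) = fd v f + fd v g.
Proof.
apply: smf_eq => x Vx; rewrite fvalD// !fval_d// -(dCD _ Vx (smfP f) (smfP g)).
by apply: dC_eq oV Vx _ => y; rewrite inE => Vy; rewrite fvalD.
Qed.

Lemma fdM v f g : fd v (f * g) = fd v f * g + f * fd v g.
Proof.
apply: smf_eq => x Vx; rewrite fvalD// !fvalM// !fval_d// -(dCM _ Vx (smfP f) (smfP g)).
by apply: dC_eq oV Vx _ => y; rewrite inE => Vy; rewrite fvalM.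
Qed.

Lemma fd_cst v c : fd v (fcst c) = 0.
Proof.
apply: smf_eq => x Vx; rewrite fval0// fval_d// -(dC_cst v c x).
by apply: dC_eq oV Vx _ => y; rewrite inE => Vy; rewrite fval_cst.
Qed.

Lemma fd_conj v f : fd v (fconj f) = fconj (fd v f).
Proof.
apply: smf_eq => x Vx; rewrite fval_conj// !fval_d// -(dC_conj _ Vx (smfP f)).
by apply: dC_eq oV Vx _ => y; rewrite inE => Vy; rewrite fval_conj.
Qed.

Lemma fd_swap u v f : fd v (fd u f) = fd u (fd v f).
Proof.
apply: smf_eq => x Vx.
apply: etrans (fval_d Vx v (fd u f)) _.
apply: etrans _ (esym (fval_d Vx u (fd v f))).
transitivity (dC v (dC u f) x).
  by apply: dC_eq oV Vx _ => y; rewrite inE => Vy; rewrite fval_d.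
rewrite (dC_swap _ _ oV Vx (smfP f)).
by apply: dC_eq oV Vx _ => y; rewrite inE => Vy; rewrite fval_d.
Qed.

Lemma fconjD f g : fconj (f + g) = fconj f + fconj g.
Proof. by apply: smf_eq => x Vx; rewrite !(fval_conj, fvalD)// rmorphD. Qed.
Lemma fconjM f g : fconj (f * g) = fconj f * fconj g.
Proof. by apply: smf_eq => x Vx; rewrite !(fval_conj, fvalM)// rmorphM. Qed.
Lemma fconjN f : fconj (- f) = - fconj f.
Proof. by apply: smf_eq => x Vx; rewrite !(fval_conj, fvalN)// rmorphN. Qed.
Lemma fconjK : involutive fconj.
Proof. by move=> f; apply: smf_eq => x Vx; rewrite !fval_conj// conjcK. Qed.
Lemma fconj_cst c : fconj (fcst c) = fcst (conjc c).
Proof. by apply: smf_eq => x Vx; rewrite !(fval_conj, fval_cst). Qed.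
Lemma fconj_sum m (f : 'I_m -> smf) : fconj (\sum_i f i) = \sum_i fconj (f i).
Proof.
apply: smf_eq => x Vx; rewrite fval_conj// !fval_sum// rmorph_sum.
by apply: eq_bigr => i _; rewrite fval_conj.
Qed.

Lemma fcstM c d : fcst (c * d) = fcst c * fcst d.
Proof. by apply: smf_eq => x Vx; rewrite !(fval_cst, fvalM). Qed.
Lemma fcstN c : fcst (- c) = - fcst c.
Proof. by apply: smf_eq => x Vx; rewrite !(fval_cst, fvalN). Qed.

Lemma smf_inv (f : smf) : (forall x, V x -> f x != 0) -> {g : smf | f * g = 1}.
Proof.
move=> f0; exists (mkf (smC_inv oV f0 (smfP f))); apply: smf_eq => x Vx.
by rewrite fvalM// mkfE// fval1// mulfV// f0.
Qed.

Lemma smC_coord i : smC V (fun x => (x 0 i)%:C%C).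
Proof.
apply: smC_real => k; apply: Ck_coord => //.
have idc x : V x -> {for x, continuous (@id 'rV[R]_n)} by move=> _; exact: cvg_id.
case: k => [|k]; split; [exact: idc|exact: I|exact: idc|].
move=> v; split; first by move=> x _; exact: derivable_id.
by apply: Ck_ext (Ck_cst k V v) => // x _; rewrite derive_id.
Qed.

(** A derivation [vD X] is tested on these elements to recover the components of X. *)
Definition fcoord i := mkf (smC_coord i).

Lemma fd_coord i j : fd (delta_mx 0 i) (fcoord j) = (i == j)%:R.
Proof.
apply: smf_eq => x Vx; rewrite fval_d//.
rewrite (@dC_eq _ _ _ _ (fun x => (x 0 j)%:C%C) _ x oV Vx); last first.
  by move=> y; rewrite inE => Vy; rewrite mkfE.
by rewrite dC_coord mxE eqxx [i == j]eq_sym; case: (j == i); rewrite /= ?fval1 ?fval0.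
Qed.

Definition vD (X : 'I_n -> smf) (f : smf) : smf :=
  \sum_i X i * fd (delta_mx 0 i) f.

Lemma vDD X f g : vD X (f + g) = vD X f + vD X g.
Proof.
by rewrite /vD -big_split; apply: eq_bigr => i _; rewrite fdD mulrDr.
Qed.

Lemma vDM X f g : vD X (f * g) = vD X f * g + f * vD X g.
Proof.
rewrite /vD mulr_suml mulr_sumr -big_split; apply: eq_bigr => i _.
by rewrite fdM mulrDr mulrA mulrCA.
Qed.

Lemma vD_cst X c : vD X (fcst c) = 0.
Proof. by rewrite /vD big1// => i _; rewrite fd_cst mulr0. Qed.

Lemma vD_sum X m (f : 'I_m -> smf) : vD X (\sum_i f i) = \sum_i vD X (f i).
Proof.
elim/big_ind2 : _ => [|a b c d aE bE|//]; first exact: (vD_cst X 0).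
by rewrite vDD aE bE.
Qed.

Lemma vD_conj X f : fconj (vD X f) = vD (fun i => fconj (X i)) (fconj f).
Proof.
rewrite /vD fconj_sum; apply: eq_bigr => i _.
by rewrite fconjM fd_conj.
Qed.

(** The second derivatives of f cancel by [fd_swap]. *)
Lemma vD_bracket X Y f : vD X (vD Y f) - vD Y (vD X f) =
  vD (fun j => vD X (Y j) - vD Y (X j)) f.
Proof.
have E X' Y' : vD X' (vD Y' f) = \sum_j vD X' (Y' j) * fd (delta_mx 0 j) f +
   \sum_i \sum_j X' i * (Y' j * fd (delta_mx 0 i) (fd (delta_mx 0 j) f)).
  rewrite [vD Y' f]/vD vD_sum.
  under eq_bigr do rewrite vDM.
  rewrite big_split /=; congr (_ + _); rewrite exchange_big/=; apply: eq_bigr => j _.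
  by rewrite /vD mulr_sumr; apply: eq_bigr => i _; rewrite mulrCA.
rewrite !E opprD addrACA -sumrB /vD.
rewrite [X in _ + X](_ : _ = 0) ?addr0.
  by apply: eq_bigr => j _; rewrite mulrBl.
apply/eqP; rewrite subr_eq0; apply/eqP; rewrite exchange_big/=.
by apply: eq_bigr => j _; apply: eq_bigr => i _; rewrite fd_swap mulrCA.
Qed.

End Ring.

(** * Frames on open subsets of a chart *)

Section Contractions.
Variables (A : comPzRingType) (n : nat).
Implicit Types (a b X Y : 'I_n -> A) (M : 'I_n -> 'I_n -> A).

Definition con a X := \sum_i a i * X i.
Definition ev M X Y := \sum_i \sum_j X i * M i j * Y j.
Definition wed a b (i j : 'I_n) : A := a i * b j - a j * b i.

Lemma conDr a X Y : con a (fun i => X i + Y i) = con a X + con a Y.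
Proof. by rewrite /con -big_split; apply: eq_bigr => i _; rewrite mulrDr. Qed.

Lemma conZr a c X : con a (fun i => c * X i) = c * con a X.
Proof. by rewrite /con mulr_sumr; apply: eq_bigr => i _; rewrite mulrCA. Qed.

Lemma ev_wed a b X Y : ev (wed a b) X Y = con a X * con b Y - con a Y * con b X.
Proof.
transitivity (\sum_i \sum_j ((a i * X i) * (b j * Y j)) - \sum_i \sum_j ((a j * Y j) * (b i * X i))).
  rewrite -sumrB; apply: eq_bigr => i _; rewrite -sumrB; apply: eq_bigr => j _.
  by rewrite /wed; ring.
congr (_ - _).
  by rewrite /con mulr_suml; apply: eq_bigr => i _; rewrite mulr_sumr.
by rewrite exchange_big /con mulr_suml; apply: eq_bigr => i _; rewrite mulr_sumr.
Qed.

Lemma evD M N X Y : ev (fun i j => M i j + N i j) X Y = ev M X Y + ev N X Y.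
Proof.
rewrite /ev -big_split; apply: eq_bigr => i _; rewrite -big_split; apply: eq_bigr => j _.
by rewrite /= mulrDr mulrDl.
Qed.

Lemma evZ c M X Y : ev (fun i j => c * M i j) X Y = c * ev M X Y.
Proof.
rewrite /ev mulr_sumr; apply: eq_bigr => i _; rewrite mulr_sumr; apply: eq_bigr => j _.
by rewrite mulrCA -!mulrA.
Qed.

Lemma eq_ev M N X Y : (forall i j, M i j = N i j) -> ev M X Y = ev N X Y.
Proof. by move=> h; apply: eq_bigr => i _; apply: eq_bigr => j _; rewrite h. Qed.

End Contractions.

(** * Exterior derivatives, brackets and conjugation over the ring *)

Section Cartan.
Context {R : realType} {n : nat} {O : openset R n}.
Implicit Types (X Y : 'I_n -> smf O).

Definition dd (a : 'I_n -> smf O) (i j : 'I_n) : smf O :=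
  fd (delta_mx 0 i) (a j) - fd (delta_mx 0 j) (a i).

Definition brk X Y (j : 'I_n) : smf O := vD X (Y j) - vD Y (X j).

Lemma vD_con X (a : 'I_n -> smf O) Y : vD X (con a Y) =
  \sum_i \sum_j X i * fd (delta_mx 0 i) (a j) * Y j + con a (fun j => vD X (Y j)).
Proof.
rewrite /con vD_sum; under eq_bigr do rewrite vDM.
rewrite big_split /=; congr (_ + _); rewrite exchange_big; apply: eq_bigr => j _ /=.
by rewrite /vD mulr_suml.
Qed.

Lemma cartan (a : 'I_n -> smf O) X Y : con a (brk X Y) = vD X (con a Y) - vD Y (con a X) - ev (dd a) X Y.
Proof.
have -> : ev (dd a) X Y = \sum_i \sum_j X i * fd (delta_mx 0 i) (a j) * Y j -
    \sum_i \sum_j Y i * fd (delta_mx 0 i) (a j) * X j.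
  rewrite [X in _ - X]exchange_big -sumrB; apply: eq_bigr => i _.
  by rewrite -sumrB; apply: eq_bigr => j _; rewrite /dd; ring.
rewrite !vD_con /brk.
have -> : con a (fun j => vD X (Y j) - vD Y (X j)) =
    con a (fun j => vD X (Y j)) - con a (fun j => vD Y (X j)).
  by rewrite /con -sumrB; apply: eq_bigr => j _; rewrite mulrBr.
ring.
Qed.

Definition cj X (i : 'I_n) : smf O := fconj (X i).

Lemma fconj_con (a : 'I_n -> smf O) X : fconj (con a X) = con (cj a) (cj X).
Proof. by rewrite /con fconj_sum; apply: eq_bigr => i _; rewrite fconjM. Qed.

Lemma cjK X : cj (cj X) = X.
Proof. by apply/funext => i; rewrite /cj fconjK. Qed.

Lemma fconj_vD X f : fconj (vD X f) = vD (cj X) (fconj f).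
Proof. exact: vD_conj. Qed.

Lemma fconj_brk X Y j : fconj (brk X Y j) = brk (cj X) (cj Y) j.
Proof. by rewrite /brk fconjD fconjN !fconj_vD. Qed.

Lemma cj_brk X Y : cj (brk X Y) = brk (cj X) (cj Y).
Proof. by apply/funext => i; exact: fconj_brk. Qed.

Lemma vDN X (f : smf O) : vD X (- f) = - vD X f.
Proof. by apply: (addrI (vD X f)); rewrite -vDD !subrr; exact: (vD_cst X 0). Qed.

Lemma vD_lin3 (a b c : smf O) X Y Z u : vD (fun i => a * X i + b * Y i + c * Z i) u =
  a * vD X u + b * vD Y u + c * vD Z u.
Proof.
by rewrite /vD !mulr_sumr -!big_split; apply: eq_bigr => i _ /=; rewrite !mulrDl !mulrA.
Qed.

Lemma con_brkN (a : 'I_n -> smf O) X Y : con a (brk Y X) = - con a (brk X Y).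
Proof. by rewrite /con -sumrN; apply: eq_bigr => i _; rewrite /brk; ring. Qed.

End Cartan.

(* Dual frame and coframe, and the structure equations, as elements of the ring
   of smooth functions on O. *)
Record cframe (R : realType) (O : openset R 3) := CFrame {
  cT : 'I_3 -> smf O; cZ : 'I_3 -> smf O;
  cth : 'I_3 -> smf O; cth1 : 'I_3 -> smf O; com : 'I_3 -> smf O; cA : smf O;
  cT_real : cj cT = cT; cth_real : cj cth = cth;
  cth_T : con cth cT = 1; cth_Z : con cth cZ = 0;
  cth1_T : con cth1 cT = 0; cth1_Z : con cth1 cZ = 1; cth1_Zb : con cth1 (cj cZ) = 0;
  com_im : forall i, com i + fconj (com i) = 0;
  cdth : forall i j, dd cth i j = fcst O ii * wed cth1 (cj cth1) i j;
  cdth1 : forall i j, dd cth1 i j = wed cth1 com i j + cA * wed cth (cj cth1) i j;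
  c_full : forall X : 'I_3 -> smf O, X = fun i =>
    con cth X * cT i + con cth1 X * cZ i + con (cj cth1) X * cj cZ i
}.

Section FrameOf.
Context {R : realType} {O : openset R 3} (F : cframe O).
Local Notation J := (fcst O ii).
Local Notation T := (cT F).
Local Notation Z := (cZ F).
Local Notation Zb := (cj (cZ F)).
Local Notation th := (cth F).
Local Notation th1 := (cth1 F).
Local Notation thb := (cj (cth1 F)).
Local Notation om := (com F).

Lemma ii2 : ii * ii = -1 :> R[i].
Proof. by apply: complex_eq => /=; ring. Qed.

Lemma fJJ : J * J = -1.
Proof. by rewrite -fcstM ii2 fcstN; congr (- _). Qed.

Lemma fconj0 : fconj (0 : smf O) = 0.
Proof. by rewrite -[0]/(fcst O 0) fconj_cst; congr fcst; rewrite rmorph0. Qed.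
Lemma fconj1 : fconj (1 : smf O) = 1.
Proof. by rewrite -[1]/(fcst O 1) fconj_cst; congr fcst; rewrite rmorph1. Qed.

Lemma vD0 X : vD X (0 : smf O) = 0. Proof. exact: vD_cst. Qed.
Lemma vD1 X : vD X (1 : smf O) = 0. Proof. exact: vD_cst. Qed.

Lemma cth_Zb : con th Zb = 0.
Proof. by rewrite -(cth_real F) -fconj_con cth_Z fconj0. Qed.
Lemma thb_T : con thb T = 0.
Proof. by rewrite -[T]cT_real -fconj_con cth1_T fconj0. Qed.
Lemma thb_Z : con thb Z = 0.
Proof. by rewrite -[Z]cjK -fconj_con cth1_Zb fconj0. Qed.
Lemma thb_Zb : con thb Zb = 1.
Proof. by rewrite -fconj_con cth1_Z fconj1. Qed.

Definition fp := con om Z.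
Definition fpb := - con om Zb.
Definition fq := con om T.
(** The torsion enters as the bracket coefficient that [brk_ZbT] needs; [fa_cA] and [fab_cA]
    identify [fa] and [fab] with the torsion of the structure equation and its conjugate. *)
Definition fa := con th1 (brk Zb T).
Definition fab := con thb (brk Z T).

Lemma cj_om X : con om (cj X) = - fconj (con om X).
Proof.
rewrite fconj_con /con -sumrN; apply: eq_bigr => i _; rewrite -mulNr; congr (_ * _).
by apply/eqP; rewrite -addr_eq0 com_im.
Qed.

Lemma conj_fp : fconj fp = fpb. Proof. by rewrite /fpb cj_om opprK. Qed.
Lemma conj_fpb : fconj fpb = fp. Proof. by rewrite -conj_fp fconjK. Qed.
Lemma conj_fq : fconj fq = - fq.
Proof. by have h := cj_om T; rewrite cT_real in h; rewrite /fq [in RHS]h opprK. Qed.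

Lemma ev_dth X Y : ev (dd th) X Y = J * (con th1 X * con thb Y - con th1 Y * con thb X).
Proof. by rewrite (eq_ev _ _ (cdth F)) evZ ev_wed. Qed.

Lemma ev_dth1 X Y : ev (dd th1) X Y = con th1 X * con om Y - con th1 Y * con om X
  + cA F * (con th X * con thb Y - con th Y * con thb X).
Proof. by rewrite (eq_ev _ _ (cdth1 F)) evD evZ !ev_wed. Qed.

Definition frameE := (cth_T F, cth_Z F, cth_Zb, cth1_T F, cth1_Z F, cth1_Zb F,
  thb_T, thb_Z, thb_Zb).

Lemma brk_ZZb u : vD Z (vD Zb u) - vD Zb (vD Z u) =
  - (J * vD T u) + fpb * vD Z u - fp * vD Zb u.
Proof.
rewrite vD_bracket -/(brk Z Zb).
have e0 : con th (brk Z Zb) = - J.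
  by rewrite cartan ev_dth !frameE !vD0; ring.
have e1 : con th1 (brk Z Zb) = fpb.
  by rewrite cartan ev_dth1 !frameE vD0 vD1 /fpb; ring.
have e2 : con thb (brk Z Zb) = - fp.
  rewrite -[brk Z Zb]cjK -fconj_con (_ : cj (brk Z Zb) = brk Zb Z).
    by rewrite con_brkN e1 fconjN conj_fpb.
  by rewrite cj_brk cjK.
rewrite [brk Z Zb](c_full F) e0 e1 e2 vD_lin3; ring.
Qed.

Lemma brk_ZT u : vD Z (vD T u) - vD T (vD Z u) = - (fq * vD Z u) + fab * vD Zb u.
Proof.
rewrite vD_bracket -/(brk Z T).
have e0 : con th (brk Z T) = 0.
  by rewrite cartan ev_dth !frameE vD0 vD1; ring.
have e1 : con th1 (brk Z T) = - fq.
  by rewrite cartan ev_dth1 !frameE vD0 vD1 /fq; ring.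
rewrite [brk Z T](c_full F) e0 e1 -/fab vD_lin3; ring.
Qed.

Lemma brk_ZbT u : vD Zb (vD T u) - vD T (vD Zb u) = fq * vD Zb u + fa * vD Z u.
Proof.
rewrite vD_bracket -/(brk Zb T).
have e0 : con th (brk Zb T) = 0.
  by rewrite cartan ev_dth !frameE vD0 vD1; ring.
have e1 : con thb (brk Zb T) = fq.
  rewrite -[brk Zb T]cjK -fconj_con (_ : cj (brk Zb T) = brk Z T).
    rewrite cartan ev_dth1 !frameE vD0 vD1.
    by rewrite -[RHS]opprK -conj_fq -fconjN; congr fconj; rewrite /fq; ring.
  by rewrite cj_brk cjK cT_real.
rewrite [brk Zb T](c_full F) e0 e1 -/fa vD_lin3; ring.
Qed.

Lemma fa_cA : fa = cA F.
Proof. by rewrite /fa cartan ev_dth1 !frameE !vD0; ring. Qed.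

Lemma fab_cA : fab = fconj (cA F).
Proof.
by rewrite -fa_cA /fa fconj_con cj_brk cjK cT_real.
Qed.

Definition fW := - vD Z fpb - vD Zb fp + J * fq - 2 * fp * fpb.

Lemma frame_ind x y z : (forall u, x * vD Z u + y * vD Zb u + z * vD T u = 0) ->
  [/\ x = 0, y = 0 & z = 0].
Proof.
move=> h.
have vDc X j : vD X (fcoord O j) = X j.
  rewrite /vD (bigD1 j)//= big1 ?addr0 => [|i ij]; first by rewrite fd_coord eqxx mulr1.
  by rewrite fd_coord (negPf ij) mulr0.
have hj j : x * Z j + y * Zb j + z * T j = 0 by have := h (fcoord O j); rewrite !vDc.
have hc a : x * con a Z + y * con a Zb + z * con a T = 0.
  rewrite /con !mulr_sumr -!big_split /= big1// => j _.
  by rewrite -[RHS](mulr0 (a j)) -(hj j); ring.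
have := hc th1; have := hc thb; have := hc th; rewrite !frameE !mulr0 !mulr1 !add0r !addr0.
by move=> -> -> ->.
Qed.

Definition pshf_of : pshf J.
Proof.
refine (@Pshf _ J (vD Z) (vD Zb) (vD T) fp fpb fq fa fab fW
  (vDD Z) (vDD Zb) (vDD T) (vDM Z) (vDM Zb) (vDM T) (vD_cst Z ii) (vD_cst Zb ii) (vD_cst T ii)
  brk_ZZb brk_ZT brk_ZbT erefl frame_ind).
Defined.

(** Cartan's formula for the connection form. It shows that [fW], defined by the expression in
    [p_WE], is the component of d omega on (Z, Zb), that is, the Tanaka-Webster curvature. *)
Lemma dom_ZZb : ev (dd om) Z Zb = fW.
Proof.
have := cartan om Z Zb; have := brk_ZZb.
have -> : con om (brk Z Zb) = - (J * fq) + 2 * fp * fpb.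
  have e0 : con th (brk Z Zb) = - J.
    by rewrite cartan ev_dth !frameE !vD0; ring.
  have e1 : con th1 (brk Z Zb) = fpb.
    by rewrite cartan ev_dth1 !frameE vD0 vD1 /fpb; ring.
  have e2 : con thb (brk Z Zb) = - fp.
    rewrite -[brk Z Zb]cjK -fconj_con (_ : cj (brk Z Zb) = brk Zb Z).
      by rewrite con_brkN e1 fconjN conj_fpb.
    by rewrite cj_brk cjK.
  rewrite [brk Z Zb](c_full F) e0 e1 e2 !conDr !conZr -/fq -/fp.
  by rewrite (_ : con om Zb = - fpb); [ring|rewrite /fpb opprK].
move=> _ E; rewrite /fW; apply: (eq_comb (c := 1) E).
by rewrite -/fp (_ : con om Zb = - fpb) ?/fpb ?opprK//; rewrite vDN; ring.
Qed.

(** Cartan's formula on (Z, T). The conclusion is the hypothesis [Tp] of the torsion-free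
    computations; [dom_ZbT] conjugates it into [Tpb]. *)
Lemma dom_ZT : fab = 0 -> ev (dd om) Z T = 0 -> vD T fp = vD Z fq + fq * fp.
Proof.
move=> ab0 d0; have := cartan om Z T; rewrite d0.
have e0 : con th (brk Z T) = 0.
  by rewrite cartan ev_dth !frameE vD0 vD1; ring.
have e1 : con th1 (brk Z T) = - fq.
  by rewrite cartan ev_dth1 !frameE vD0 vD1 /fq; ring.
have -> : con om (brk Z T) = - fq * fp.
  by rewrite [brk Z T](c_full F) e0 e1 -/fab ab0 !conDr !conZr -/fp -/fq; ring.
by rewrite -/fp -/fq => E; apply: (eq_comb (c := 1) E); ring.
Qed.

Lemma dom_ZbT : vD T fp = vD Z fq + fq * fp -> vD T fpb = - vD Zb fq - fq * fpb.
Proof.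
move=> /(congr1 (@fconj R 3 O)); rewrite fconjD fconjM !fconj_vD cT_real conj_fp conj_fq => ->.
by rewrite vDN; ring.
Qed.

End FrameOf.

Definition inO (R : realType) n (O : openset R n) (x : 'rV[R]_n) : Prop := oset O x.
Coercion inO : openset >-> Funclass.

Section DualBasis.
Variable (K : fieldType).
Implicit Types (v T Z Y a b d : 'rV[K]_3).

(** Duality says P Q = 1 for square matrices; then Q P = 1, which is the expansion of v. *)
Lemma dual_basis T Z Y a b d :
  pairing a T = 1 -> pairing a Z = 0 -> pairing a Y = 0 ->
  pairing b T = 0 -> pairing b Z = 1 -> pairing b Y = 0 ->
  pairing d T = 0 -> pairing d Z = 0 -> pairing d Y = 1 ->
  forall v, v = pairing a v *: T + pairing b v *: Z + pairing d v *: Y.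
Proof.
move=> aT aZ aY bT bZ bY dT dZ dY v.
pose P : 'M[K]_3 := \matrix_(i, j) (nth 0 [:: T; Z; Y] i) 0 j.
pose Q : 'M[K]_3 := \matrix_(j, i) (nth 0 [:: a; b; d] i) 0 j.
have PQE i k : (P *m Q) i k = pairing (nth 0 [:: a; b; d] k) (nth 0 [:: T; Z; Y] i).
  by rewrite mxE; apply: eq_bigr => j _; rewrite !mxE mulrC.
have PQ : P *m Q = 1%:M.
  apply/matrixP => i k; rewrite PQE mxE.
  case: i => [[|[|[|//]]] ?]; case: k => [[|[|[|//]]] ?] /=;
  by rewrite ?(aT, aZ, aY, bT, bZ, bY, dT, dZ, dY).
have QP := mulmx1C PQ.
have vQ k : (v *m Q) 0 k = pairing (nth 0 [:: a; b; d] k) v.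
  by rewrite mxE; apply: eq_bigr => j _; rewrite !mxE mulrC.
rewrite -[v in LHS]mulmx1 -QP mulmxA; apply/rowP => j.
rewrite mxE !big_ord_recl big_ord0 !vQ !mxE /= addr0.
by rewrite addrA.
Qed.

End DualBasis.

(** * Local frames as elements of the ring of smooth functions *)

Section Concrete.
Context {R : realType}.
Local Notation C := R[i].

Lemma derive_fun (V : normedModType R) (f g : V -> R) v x : f =1 g -> 'D_v f x = 'D_v g x.
Proof. by move=> /funext->. Qed.

Lemma mx_addZ (M N : 'M[C]_3) a i j : (M + a *: N) i j = M i j + a * N i j.
Proof. by rewrite !mxE. Qed.

Lemma lin3_row (a b d : C) (u v w : 'rV[C]_3) i :
  (a *: u + b *: v + d *: w) 0 i = a * u 0 i + b * v 0 i + d * w 0 i.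
Proof. by rewrite !mxE. Qed.

Section Vec.
Context {O : openset R 3}.

Lemma smoothC_coord (a : 'rV[R]_3 -> 'rV[C]_3) i : smoothC O a -> smC O (fun x => a x 0 i).
Proof.
move=> [a1 a2]; split=> k.
  by apply: Ck_ext (Ck_coord 0 i (@osetP _ _ O) (a1 k)) => [|x _]; [exact: osetP|rewrite mxE].
by apply: Ck_ext (Ck_coord 0 i (@osetP _ _ O) (a2 k)) => [|x _]; [exact: osetP|rewrite mxE].
Qed.

Lemma smoothC_cmx (v : 'rV[R]_3 -> 'rV[R]_3) : smooth_open O v ->
  smoothC O (fun x => cmx (v x)).
Proof.
move=> vs; split=> k.
  by apply: Ck_ext (vs k) => [|x _]; [exact: osetP|apply/rowP => i; rewrite !mxE].
apply: Ck_ext (Ck_cst k O (0 : 'rV[R]_3)) => [|x _]; first exact: osetP.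
by apply/rowP => i; rewrite !mxE.
Qed.

Definition vecE (a : 'rV[R]_3 -> 'rV[C]_3) (sa : smoothC O a) (i : 'I_3) : smf O :=
  mkf (smoothC_coord i sa).

Lemma vecE_val a (sa : smoothC O a) i x : O x -> vecE sa i x = a x 0 i.
Proof. by move=> Ox; rewrite mkfE. Qed.

Lemma con_val (a X : 'I_3 -> smf O) x : O x ->
  con a X x = pairing (\row_i a i x) (\row_i X i x).
Proof.
by move=> Ox; rewrite /con fval_sum//; apply: eq_bigr => i _; rewrite fvalM// !mxE.
Qed.

Lemma row_vecE a (sa : smoothC O a) x : O x -> \row_i vecE sa i x = a x.
Proof. by move=> Ox; apply/rowP => i; rewrite mxE vecE_val. Qed.

Lemma row_cj (a : 'I_3 -> smf O) x : O x -> \row_i cj a i x = mxconj (\row_i a i x).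
Proof. by move=> Ox; apply/rowP => i; rewrite !mxE /cj fval_conj. Qed.

Lemma ReIm_ii (a b : R) : (a%:C + ii * b%:C)%C = Complex a b.
Proof. by apply: complex_eq; rewrite /= !(mul0r, mul1r, subr0, addr0, add0r). Qed.

Lemma ReB (z w : C) : complex.Re (z - w) = complex.Re z - complex.Re w.
Proof. by case: z; case: w. Qed.
Lemma ImB (z w : C) : complex.Im (z - w) = complex.Im z - complex.Im w.
Proof. by case: z; case: w. Qed.

Lemma dd_vecE a (sa : smoothC O a) i j x : O x -> dd (vecE sa) i j x = extdC a x i j.
Proof.
move=> Ox; rewrite /dd fvalB// !fval_d//.
have E k l : dC (delta_mx 0 k) (vecE sa l) x = dC (delta_mx 0 k) (fun y => a y 0 l) x.
  by apply: dC_eq (@osetP _ _ O) Ox _ => y; rewrite inE => Oy; rewrite vecE_val.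
rewrite !E /extdC !mxE /pderiv ReIm_ii; apply: complex_eq.
  rewrite ReB !dC_Re /=.
  by apply: (f_equal2 (fun a b => a - b)); apply: derive_fun => y; rewrite mxE.
rewrite ImB !dC_Im /=.
by apply: (f_equal2 (fun a b => a - b)); apply: derive_fun => y; rewrite mxE.
Qed.

Lemma dd_real (v : 'rV[R]_3 -> 'rV[R]_3) (sv : smoothC O (fun x => cmx (v x))) i j x : O x ->
  dd (vecE sv) i j x = (extd v x i j)%:C%C.
Proof.
move=> Ox; rewrite dd_vecE// /extdC !mxE /pderiv ReIm_ii; apply: complex_eq => /=.
  by apply: (f_equal2 (fun a b => a - b)); apply: derive_fun => y; rewrite !mxE.
have z k l : 'D_k (fun y => mxIm (cmx (v y)) 0 l) x = 0.
  by rewrite (derive_fun (g := cst 0)) ?derive_cst// => y; rewrite !mxE.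
by rewrite !z subrr.
Qed.

Lemma wed_val (a b : 'I_3 -> smf O) i j x : O x ->
  wed a b i j x = wedge11 (\row_i a i x) (\row_i b i x) i j.
Proof. by move=> Ox; rewrite /wed fvalB// !fvalM// !mxE. Qed.

End Vec.

Section Frames.
Context (X : CR3 R).
Implicit Types (theta : form1 X) (c : chart X).

Definition zrow (O : openset R 3) (F : cframe O) x : 'rV[C]_3 := \row_i cZ F i x.

Definition adapted theta c (O : openset R 3) (F : cframe O) : Prop :=
  forall x, O x ->
  [/\ img c x, forall i, cth F i x = (theta c x 0 i)%:C%C,
      xi c x (mxRe (zrow F x)), xi c x (mxIm (zrow F x)) &
      zrow F x *m cmx (Jcr c x) = ii *: zrow F x].

Lemma pairing_cmx (a v : 'rV[R]_3) : pairing (cmx a) (cmx v) = (pairing a v)%:C%C.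
Proof. by rewrite /pairing rmorph_sum; apply: eq_bigr => i _; rewrite !mxE rmorphM. Qed.

Lemma pairing_Re_Im (a : 'rV[R]_3) (z : 'rV[C]_3) :
  pairing a (mxRe z) = 0 -> pairing a (mxIm z) = 0 -> pairing (cmx a) z = 0.
Proof.
move=> h1 h2; apply: complex_eq => /=.
  rewrite -[RHS]h1 /pairing raddf_sum; apply: eq_bigr => i _.
  by rewrite !mxE -[LHS]/(complex.Re _) ReM /= mul0r subr0.
rewrite -[RHS]h2 /pairing raddf_sum; apply: eq_bigr => i _.
by rewrite !mxE -[LHS]/(complex.Im _) ImM /= mul0r addr0.
Qed.

Lemma pairing_conj (a v : 'rV[C]_3) : pairing (mxconj a) (mxconj v) = conjc (pairing a v).
Proof. by rewrite /pairing rmorph_sum; apply: eq_bigr => i _; rewrite !mxE rmorphM. Qed.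

Lemma mxconjK (v : 'rV[C]_3) : mxconj (mxconj v) = v.
Proof. by apply/rowP => i; rewrite !mxE conjcK. Qed.

Lemma mxconj_cmx (v : 'rV[R]_3) : mxconj (cmx v) = cmx v.
Proof. by apply/rowP => i; rewrite !mxE conjc_real. Qed.

Lemma frame_at_full theta c x T Z th1 h : contact_at (xi c x) (theta c) x ->
  frame_at theta c x T Z th1 h ->
  forall v, v = pairing (cmx (theta c x)) v *: cmx T + pairing th1 v *: Z +
    pairing (mxconj th1) v *: mxconj Z.
Proof.
move=> [kerE _] [[thT _] [/kerE ZR /kerE ZI] _ [t1 t2 t3] _].
have thZ := pairing_Re_Im ZR ZI.
apply: dual_basis; [|exact: thZ| |exact: t3|exact: t1|exact: t2| | |].
- by rewrite pairing_cmx thT.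
- by rewrite -(mxconj_cmx (theta c x)) pairing_conj thZ rmorph0.
- by rewrite -(mxconj_cmx T) pairing_conj t3 rmorph0.
- by rewrite -[Z]mxconjK pairing_conj t2 rmorph0.
- by rewrite pairing_conj t1 rmorph1.
Qed.

Section Build.
Variables (theta : form1 X) (c : chart X) (V : set 'rV[R]_3).
Variables (T : 'rV[R]_3 -> 'rV[R]_3) (Z th1 om : 'rV[R]_3 -> 'rV[C]_3) (A : 'rV[R]_3 -> C).
Hypotheses (thc : is_contact_form theta)
  (lf : local_frame theta c V T Z th1 (fun=> 1)) (se : structure_eq theta c V th1 om A).
Variables (O : openset R 3) (OV : O `<=` V).

Lemma smooth_sub (W1 W2 : normedModType R) (U U' : set W1) (f : W1 -> W2) :
  U' `<=` U -> smooth_open U f -> smooth_open U' f.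
Proof. by move=> UU fs k; apply: Ck_sub (fs k). Qed.

Lemma build_frame : exists F : cframe O, [/\ adapted theta c F,
   forall x, O x -> cA F x = A x,
   forall x i, O x -> com F i x = om x 0 i,
   forall x i, O x -> cth1 F i x = th1 x 0 i &
   forall i j x, O x -> dd (com F) i j x = extdC om x i j].
Proof.
have [[oV Vimg] sT [sZ1 sZ2] [sth1 sth2] fr] := lf.
have [[som1 som2] str] := se.
have [[sth _] ctc] := thc.
have Oimg : O `<=` img c by move=> x /OV/Vimg.
have ST : smoothC O (fun x => cmx (T x)) by apply: smoothC_cmx; apply: smooth_sub sT.
have STH : smoothC O (fun x => cmx (theta c x)).
  by apply: smoothC_cmx; apply: smooth_sub (sth c).
have SZ : smoothC O Z by split; [apply: smooth_sub sZ1|apply: smooth_sub sZ2].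
have S1 : smoothC O th1 by split; [apply: smooth_sub sth1|apply: smooth_sub sth2].
have SO : smoothC O om by split; [apply: smooth_sub som1|apply: smooth_sub som2].
pose t := vecE ST; pose z := vecE SZ; pose h := vecE STH; pose h1 := vecE S1; pose o := vecE SO.
(* In the structure equation A is a bare function. A smooth one is recovered as - d theta^1 (Zb, T),
   and [aE] shows that it agrees with A. *)
pose a : smf O := - ev (dd h1) (cj z) t.
have trow x : O x -> \row_i t i x = cmx (T x) by exact: row_vecE.
have zr x : O x -> \row_i z i x = Z x by exact: row_vecE.
have zbr x : O x -> \row_i cj z i x = mxconj (Z x) by move=> Ox; rewrite row_cj// zr.
have hr x : O x -> \row_i h i x = cmx (theta c x) by exact: row_vecE.
have h1r x : O x -> \row_i h1 i x = th1 x by exact: row_vecE.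
have hbr x : O x -> \row_i cj h1 i x = mxconj (th1 x) by move=> Ox; rewrite row_cj// h1r.
have orow x : O x -> \row_i o i x = om x by exact: row_vecE.
have ct : cj t = t.
  apply/funext => i; apply: smf_eq => x Ox.
  by rewrite /cj fval_conj// vecE_val// mxE conjc_real.
have ch : cj h = h.
  apply/funext => i; apply: smf_eq => x Ox.
  by rewrite /cj fval_conj// vecE_val// mxE conjc_real.
have pT x : O x -> pairing (cmx (theta c x)) (cmx (T x)) = 1.
  by move=> /OV/fr[[thT _] _ _ _ _]; rewrite pairing_cmx thT.
have pZ x : O x -> pairing (cmx (theta c x)) (Z x) = 0.
  move=> /[dup] /Oimg/(ctc c)[kerE _] /OV/fr[_ [/kerE h1' /kerE h2'] _ _ _].
  exact: pairing_Re_Im.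
have e1 : con h t = 1 by apply: smf_eq => x Ox; rewrite con_val// hr// trow// fval1// pT.
have e2 : con h z = 0 by apply: smf_eq => x Ox; rewrite con_val// hr// zr// fval0// pZ.
have e3 : con h1 t = 0.
  apply: smf_eq => x Ox; rewrite con_val// h1r// trow// fval0//.
  by have [_ _ _ [_ _ ->] _] := fr _ (OV Ox).
have e4 : con h1 z = 1.
  apply: smf_eq => x Ox; rewrite con_val// h1r// zr// fval1//.
  by have [_ _ _ [-> _ _] _] := fr _ (OV Ox).
have e5 : con h1 (cj z) = 0.
  apply: smf_eq => x Ox; rewrite con_val// h1r// zbr// fval0//.
  by have [_ _ _ [_ -> _] _] := fr _ (OV Ox).
have e6 i : o i + fconj (o i) = 0.
  apply: smf_eq => x Ox; rewrite fvalD// fval_conj// fval0// vecE_val//.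
  by have [/rowP/(_ i)] := str _ (OV Ox); rewrite !mxE.
have e7 i j : dd h i j = fcst O ii * wed h1 (cj h1) i j.
  apply: smf_eq => x Ox; rewrite dd_real// fvalM// fval_cst// wed_val// h1r// hbr//.
  by have [_ _ _ _ /matrixP/(_ i j)] := fr _ (OV Ox); rewrite [X in X = _ -> _]mxE [X in _ = X -> _]mxE mulr1.
have dh1 i j x : O x -> dd h1 i j x = wed h1 o i j x + A x * wed h (cj h1) i j x.
  move=> Ox; rewrite dd_vecE//; have [_ ->] := str _ (OV Ox).
  by rewrite mx_addZ (wed_val h1 o i j Ox) (wed_val h (cj h1) i j Ox) (h1r _ Ox) (orow _ Ox) (hr _ Ox) (hbr _ Ox).
have aE x : O x -> a x = A x.
  move=> Ox; rewrite /a fvalN//.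
  (* A is frozen at x, since it is not yet an element of the ring and only the value at x is
     compared. *)
  pose Ax : smf O := fcst O (A x).
  have -> : ev (dd h1) (cj z) t x = (ev (wed h1 o) (cj z) t + Ax * ev (wed h (cj h1)) (cj z) t) x.
    rewrite fvalD// fvalM// fval_cst// /ev !fval_sum// mulr_sumr -big_split.
    apply: eq_bigr => i _; rewrite /= !fval_sum// mulr_sumr -big_split; apply: eq_bigr => j _ /=.
    by rewrite !fvalM// dh1//; ring.
  have e2b : con h (cj z) = 0 by rewrite -ch -fconj_con e2 fconj0.
  have e4b : con (cj h1) (cj z) = 1 by rewrite -fconj_con e4 fconj1.
  have e3b : con (cj h1) t = 0 by rewrite -ct -fconj_con e3 fconj0.
  have -> : ev (wed h1 o) (cj z) t + Ax * ev (wed h (cj h1)) (cj z) t = - Ax.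
    by rewrite !ev_wed e1 e2b e3 e3b e4b e5; ring.
  by rewrite fvalN// fval_cst// opprK.
have e8 i j : dd h1 i j = wed h1 o i j + a * wed h (cj h1) i j.
  apply: smf_eq => x Ox; rewrite dh1// -aE//.
  by rewrite -(fvalM Ox) -(fvalD Ox).
have e9 (Y : 'I_3 -> smf O) : Y = fun i => con h Y * t i + con h1 Y * z i + con (cj h1) Y * cj z i.
  apply/funext => i; apply: smf_eq => x Ox.
  rewrite !fvalD// !fvalM// !con_val// hr// h1r// hbr//.
  have /rowP/(_ i) := frame_at_full (ctc _ _ (Oimg _ Ox)) (fr _ (OV Ox)) (\row_i Y i x).
  by rewrite lin3_row mxE => ->; rewrite -(zbr _ Ox) mxE !vecE_val// mxE.
exists (CFrame ct ch e1 e2 e3 e4 e5 e6 e7 e8 e9); split=> //.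
- move=> x Ox; have [_ [h1' h2'] h3' _ _] := fr _ (OV Ox).
  split; [exact: Oimg|by move=> i; rewrite /= vecE_val// mxE| | |];
  by rewrite /zrow /= zr.
- by move=> x i Ox; rewrite /= vecE_val.
- by move=> x i Ox; rewrite /= vecE_val.
- by move=> i j x Ox; rewrite /= dd_vecE.
Qed.

End Build.
End Frames.
End Concrete.

Section Existence.
Context {R : realType} (X : CR3 R).
Local Notation C := R[i].
Implicit Types (theta : form1 X) (c : chart X).

Definition hasW c (O : openset R 3) (F : cframe O) (W : X -> R) : Prop :=
  forall y, O y -> fW F y = (W (param c y))%:C%C.

Lemma ev_val (O : openset R 3) (M N : 'I_3 -> 'I_3 -> smf O) Y Z x : O x ->
  (forall i j, M i j x = N i j x) -> ev M Y Z x = ev N Y Z x.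
Proof.
move=> Ox MN; rewrite /ev !fval_sum//; apply: eq_bigr => i _.
by rewrite !fval_sum//; apply: eq_bigr => j _; rewrite !fvalM// MN.
Qed.

Lemma fcst0 (O : openset R 3) : fcst O 0 = 0.
Proof. by apply: smf_eq => z Oz; rewrite fval_cst// fval0. Qed.

Lemma ev_comb (O : openset R 3) (a b d : smf O) (M N P : 'I_3 -> 'I_3 -> smf O) Y Z :
  ev (fun i j => a * M i j + (b * N i j + d * P i j)) Y Z =
  a * ev M Y Z + (b * ev N Y Z + d * ev P Y Z).
Proof. by rewrite evD evD !evZ. Qed.

Lemma two_ii_Im (z : C) : 2 * ii * (complex.Im z)%:C%C = z - conjc z.
Proof. by case: z => a b; apply: complex_eq; rewrite /=; ring. Qed.

Lemma cmx_mxIm (M : 'M[C]_3) i j : cmx (mxIm M) i j = (complex.Im (M i j))%:C%C.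
Proof. by rewrite !mxE. Qed.

Lemma scale_entry (M : 'M[C]_3) k i j : (k *: M) i j = k * M i j.
Proof. by rewrite mxE. Qed.

Lemma extd_om_entry (t1 th : 'rV[C]_3) (w k : C) i j :
  (w *: wedge11 t1 (mxconj t1) + (2 * ii) *: cmx (mxIm (k *: wedge11 t1 th))) i j =
  w * wedge11 t1 (mxconj t1) i j + (k * wedge11 t1 th i j - conjc k *
     wedge11 (mxconj t1) (mxconj th) i j).
Proof.
rewrite mx_addZ scale_entry cmx_mxIm two_ii_Im scale_entry; congr (_ + _).
rewrite rmorphM; congr (_ - _ * _).
by rewrite !mxE rmorphB !rmorphM.
Qed.

Lemma gradC_zero (f : 'rV[R]_3 -> C) (V : set 'rV[R]_3) x : open V -> V x ->
  (forall y, V y -> f y = 0) -> gradC f x = 0.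
Proof.
move=> oV Vx f0; apply/rowP => i; rewrite !mxE /pderiv.
have z (g : 'rV[R]_3 -> R) : (forall y, V y -> g y = 0) -> 'D_(delta_mx 0 i) g x = 0.
  move=> g0; rewrite (near_eq_derive (g := cst 0)) ?derive_cst//.
  by apply: open_eq_near oV Vx _ => y; rewrite inE => /g0.
by rewrite !z ?mulr0 ?addr0// => y /f0 ->.
Qed.

(** Frames are provided on every open subset of V so that neighbourhoods coming from several
    definitions can be intersected. The last clause holds because a torsion vanishing on O has
    vanishing covariant derivative, which leaves only the W term in d omega. *)
Lemma tw_frame_ex theta c W x : is_contact_form theta -> is_TW_curvature theta W ->
  img c x -> exists V, [/\ open V, V x, V `<=` img c & forall O : openset R 3, O `<=` V ->
    exists F : cframe O, [/\ adapted theta c F, hasW c F W &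
      cA F = 0 -> ev (dd (com F)) (cZ F) (cT F) = 0]].
Proof.
move=> thc tw /tw[V [T [Z [th1 [om [A [Vx lf se twE]]]]]]].
have [[oV Vimg] _ _ _ fr] := lf.
exists V; split=> // O OV.
have [F [Fad FA Fom F1 Fdom]] := build_frame thc lf se OV.
pose k y := A11_1bar Z om A y.
have E y Y1 Y2 : O y -> ev (dd (com F)) Y1 Y2 y =
   (fcst O (W (param c y))%:C%C * ev (wed (cth1 F) (cj (cth1 F))) Y1 Y2 +
    (fcst O (k y) * ev (wed (cth1 F) (cth F)) Y1 Y2 +
     fcst O (- conjc (k y)) * ev (wed (cj (cth1 F)) (cth F)) Y1 Y2)) y.
  move=> Oy; rewrite -ev_comb; apply: (ev_val _ _ Oy) => i j.
  rewrite Fdom// (twE _ (OV _ Oy)) extd_om_entry.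
  have r1 : \row_l cth1 F l y = th1 y by apply/rowP => l; rewrite mxE F1.
  have r0 : \row_l cth F l y = cmx (theta c y).
    by have [_ th _ _ _] := Fad _ Oy; apply/rowP => l; rewrite !mxE th.
  rewrite !(fvalD Oy) !(fvalM Oy) !(fval_cst Oy) !(wed_val _ _ _ _ Oy) (row_cj _ Oy) r1 r0.
  by rewrite mulNr mxconj_cmx.
exists F; split=> //.
- move=> y Oy; rewrite -dom_ZZb (E _ _ _ Oy) !ev_wed !frameE -[RHS](fval_cst Oy).
  by congr (fval _ _); ring.
move=> A0; apply: smf_eq => y Oy; rewrite (fval0 Oy) (E _ _ _ Oy) !ev_wed !frameE.
have -> : k y = 0.
  have Az z : O z -> A z = 0 by move=> Oz; rewrite -FA// A0 fval0.
  rewrite /k /A11_1bar (gradC_zero (@osetP _ _ O) Oy); last first.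
    by move=> z Oz; rewrite /A11 Az// rmorph0.
  rewrite /A11 Az// rmorph0 mulr0 subr0 /pairing big1// => i _.
  by rewrite mxE mul0r.
rewrite -[RHS](fval0 Oy); congr (fval _ _).
by rewrite rmorph0 oppr0 fcst0; ring.
Qed.

Lemma tf_frame_ex theta c x : is_contact_form theta -> vanishing_torsion theta ->
  img c x -> exists V, [/\ open V, V x, V `<=` img c & forall O : openset R 3, O `<=` V ->
    exists F : cframe O, adapted theta c F /\ cA F = 0].
Proof.
move=> thc tf /tf[V [T [Z [th1 [om [A [Vx lf se A0]]]]]]].
have [[oV Vimg] _ _ _ fr] := lf.
exists V; split=> // O OV.
have [F [Fad FA Fom F1 Fdom]] := build_frame thc lf se OV.
exists F; split=> //; apply: smf_eq => y Oy; rewrite fval0// FA//.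
by apply: A0; apply: OV.
Qed.

End Existence.

(** * Two frames over one open set of a chart *)

Section Compare.
Context {R : realType} (X : CR3 R) (c : chart X) (O : openset R 3).
Local Notation C := R[i].

Lemma con_Re_Im (a z : 'I_3 -> smf O) x (th : 'rV[R]_3) : O x ->
  (forall i, a i x = (th 0 i)%:C%C) -> pairing th (mxRe (\row_i z i x)) = 0 ->
  pairing th (mxIm (\row_i z i x)) = 0 -> con a z x = 0.
Proof.
move=> Ox ath h1 h2; rewrite con_val// -[RHS](pairing_Re_Im h1 h2).
by congr pairing; apply/rowP => i; rewrite !mxE ath.
Qed.

(* The i-eigenspace of J on the complexified contact plane is spanned by Z. *)
Lemma eigen_Zb (theta : form1 X) (F : cframe O) x (z : 'rV[C]_3) :
  adapted theta c F -> O x ->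
  pairing (\row_i cth F i x) z = 0 -> z *m cmx (Jcr c x) = ii *: z ->
  pairing (mxconj (\row_i cth1 F i x)) z = 0.
Proof.
move=> Fad Ox tz zJ; have [_ _ _ _ ZJ] := Fad _ Ox.
set b := pairing _ z; pose a := pairing (\row_i cth1 F i x) z.
have zE : z = a *: zrow F x + b *: mxconj (zrow F x).
  apply/rowP => i.
  have /(congr1 (fun f => fval (f i) x)) := c_full F (fun i => fcst O (z 0 i)).
  rewrite !fvalD// !fvalM// !con_val// fval_cst//.
  have -> : \row_i0 fcst O (z 0 i0) x = z by apply/rowP => l; rewrite mxE fval_cst.
  rewrite tz mul0r add0r row_cj// -/a -/b => ->.
  by rewrite !mxE /cj fval_conj.
have ZbJ : mxconj (zrow F x) *m cmx (Jcr c x) = - ii *: mxconj (zrow F x).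
  have -> : - ii = conjc ii :> C by apply: complex_eq; rewrite /= ?oppr0.
  apply/rowP => i; have /rowP/(_ i)/(congr1 conjc) := ZJ.
  rewrite !mxE rmorphM rmorph_sum => <-; apply: eq_bigr => j _.
  by rewrite !mxE [RHS]rmorphM; congr (_ * _); apply/esym; exact: conjc_real.
have : (2 * ii * b) *: mxconj (zrow F x) = 0.
  rewrite [in LHS]zE in zJ; move: zJ.
  rewrite mulmxDl -!scalemxAl ZJ ZbJ [in RHS]zE => /eqP.
  rewrite scalerDr !scalerA [ii * a]mulrC (inj_eq (addrI _)) mulrN scaleNr.
  rewrite eq_sym -subr_eq0 opprK -scalerDl => /eqP <-.
  by congr (_ *: _); ring.
move=> /rowP h; have := thb_Zb F => /(congr1 (fun f => fval f x)).
rewrite con_val// fval1// row_cj//.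
have -> : \row_i cj (cZ F) i x = mxconj (zrow F x) by rewrite row_cj.
move=> h1; have : 2 * ii * b = 0.
  rewrite -[LHS]mulr1 -[X in _ * X = _]h1 /pairing mulr_sumr big1// => i _.
  by have hi := h i; rewrite mxE [RHS]mxE in hi; rewrite mulrCA hi mulr0.
have i0 : 2 * ii != 0 :> C.
  by rewrite mulf_neq0 ?pnatr_eq0// eq_complex /= oner_eq0 andbF.
by move/eqP; rewrite mulf_eq0 (negPf i0) => /eqP.
Qed.

Variables (theta theta' : form1 X) (F F' : cframe O).
Hypotheses (thc : is_contact_form theta) (thc' : is_contact_form theta').
Hypotheses (Fad : adapted theta c F) (Fad' : adapted theta' c F').

Lemma cmp_th_Z : con (cth F) (cZ F') = 0.
Proof.
apply: smf_eq => x Ox; rewrite fval0//; have [xc thE _ _ _] := Fad Ox.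
have [_ _ /(thc.2 _ _ xc).1 h1 /(thc.2 _ _ xc).1 h2 _] := Fad' Ox.
exact: con_Re_Im thE h1 h2.
Qed.

Lemma cmp_thb_Z : con (cj (cth1 F)) (cZ F') = 0.
Proof.
apply: smf_eq => x Ox; rewrite fval0// con_val// row_cj//.
apply: (eigen_Zb Fad Ox); last by have [_ _ _ _] := Fad' Ox.
by rewrite -con_val// cmp_th_Z fval0.
Qed.

Definition cmp_l := con (cth1 F) (cZ F').

(** By [cmp_th_Z] and [cmp_thb_Z] only the Z component remains: both fields lie in the i-eigenline
    of J. *)
Lemma cmp_Z : cZ F' = fun i => cmp_l * cZ F i.
Proof.
rewrite [LHS](c_full F) cmp_th_Z cmp_thb_Z; apply/funext => i.
by rewrite /cmp_l; ring.
Qed.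

Lemma vD_scale (l : smf O) Y u : vD (fun i => l * Y i) u = l * vD Y u.
Proof. by rewrite /vD mulr_sumr; apply: eq_bigr => i _; rewrite mulrA. Qed.

Lemma cmp_vZ u : vD (cZ F') u = cmp_l * vD (cZ F) u.
Proof. by rewrite {1}cmp_Z vD_scale. Qed.

Lemma cmp_vZb u : vD (cj (cZ F')) u = fconj cmp_l * vD (cj (cZ F)) u.
Proof.
rewrite -vD_scale; congr vD; apply/funext => i; rewrite /cj [in LHS]cmp_Z.
by rewrite fconjM.
Qed.

Lemma cmp_vT u : vD (cT F') u = con (cth F) (cT F') * vD (cT F) u +
  con (cth1 F) (cT F') * vD (cZ F) u + con (cj (cth1 F)) (cT F') * vD (cj (cZ F)) u.
Proof. by rewrite {1}[cT F'](c_full F) vD_lin3. Qed.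

Lemma cmp_f_val x s : O x -> (forall i, theta c x 0 i = s * theta' c x 0 i) ->
  con (cth F) (cT F') x = s%:C%C.
Proof.
move=> Ox h; have [_ thE _ _ _] := Fad Ox; have [_ thE' _ _ _] := Fad' Ox.
rewrite -[RHS]mulr1 -(fval1 Ox) -(cth_T F') /con !fval_sum// mulr_sumr.
by apply: eq_bigr => i _; rewrite !fvalM// thE thE' h rmorphM mulrA.
Qed.

Lemma cmp_f : con (cth F) (cT F') = cmp_l * fconj cmp_l.
Proof. by have [] := conf_ZZb (fJJ (O := O)) (S := pshf_of F) (S' := pshf_of F') cmp_vZ cmp_vZb cmp_vT. Qed.

End Compare.

Lemma cmp_li (R : realType) (X : CR3 R) (c : chart X) (O : openset R 3)
  (theta theta' : form1 X) (F F' : cframe O)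
  (thc : is_contact_form theta) (thc' : is_contact_form theta')
  (Fad : adapted theta c F) (Fad' : adapted theta' c F') :
  cmp_l F F' * cmp_l F' F = 1.
Proof.
by rewrite -(cth1_Z F') [in RHS](cmp_Z thc Fad Fad') conZr.
Qed.

(** Vanishing torsion and curvature come with unrelated frames, and this lemma merges them: two
    frames of one form are a conformal change with f = 1, and f_11 = 0. *)
Lemma cmp_torsion (R : realType) (X : CR3 R) (c : chart X) (O : openset R 3)
  (theta : form1 X) (F F' : cframe O) (thc : is_contact_form theta)
  (Fad : adapted theta c F) (Fad' : adapted theta c F') : cA F = 0 -> cA F' = 0.
Proof.
move=> A0; have f1 : cmp_l F F' * fconj (cmp_l F F') = 1.
  rewrite -(cmp_f thc Fad Fad'); apply: smf_eq => x Ox.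
  rewrite (cmp_f_val Fad Fad' (s := 1) Ox) ?fval1// => i.
  by rewrite mul1r.
have ll := cmp_li thc thc Fad Fad'.
have llb : fconj (cmp_l F F') * fconj (cmp_l F' F) = 1 by rewrite -fconjM ll fconj1.
have : pab (pshf_of F') = 0.
  apply: (conf_torsion0 (fJJ (O := O)) (S := pshf_of F) (S' := pshf_of F') ll llb (cmp_vZ thc Fad Fad')
    (cmp_vZb thc Fad Fad') (cmp_vT F F')).
    by rewrite /= fab_cA A0 fconj0.
  by rewrite f1 pZ1 pZ0 mulr0.
by rewrite /= fab_cA => /(congr1 (@fconj R 3 O)); rewrite fconjK fconj0.
Qed.

(** * The invariants of a torsion-free spherical structure *)

Section Values.
Context {R : realType} (O : openset R 3).
Local Notation C := R[i].

Lemma vD_val (Y : 'I_3 -> smf O) u x : O x ->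
  vD Y u x = dC (mxRe (\row_i Y i x)) u x + ii * dC (mxIm (\row_i Y i x)) u x.
Proof.
move=> Ox; rewrite !(dC_sum_delta _ (@osetP _ _ O) Ox (smfP u)) mulr_sumr -big_split.
rewrite /vD fval_sum//; apply: eq_bigr => i _ /=; rewrite fvalM// fval_d// !mxE mulrA -mulrDl.
by congr (_ * _); case: (Y i x) => a b /=; rewrite ReIm_ii.
Qed.

Lemma vD_cj_val (Y : 'I_3 -> smf O) u x : O x ->
  vD (cj Y) u x = dC (mxRe (\row_i Y i x)) u x - ii * dC (mxIm (\row_i Y i x)) u x.
Proof.
move=> Ox; rewrite !(dC_sum_delta _ (@osetP _ _ O) Ox (smfP u)) mulr_sumr -sumrB.
rewrite /vD fval_sum//; apply: eq_bigr => i _ /=; rewrite fvalM// fval_d// !mxE mulrA -mulrBl.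
congr (_ * _); rewrite /cj fval_conj//; case: (Y i x) => a b /=.
by rewrite -mulrN -rmorphN /= ReIm_ii.
Qed.

End Values.

(** * The coordinates of a local CR map to the sphere *)

Section Sphere.
Context {R : realType} (X : CR3 R) (c : chart X).
Local Notation C := R[i].
Local Notation C2 := ('rV[R]_2 * 'rV[R]_2)%type.

Definition c2re (k : 'I_2) (q : C2) : R := q.1 0 k.
Definition c2im (k : 'I_2) (q : C2) : R := q.2 0 k.

Lemma c2re_linear k : linear (c2re k).
Proof. by move=> a u v; rewrite /c2re !mxE. Qed.
Lemma c2im_linear k : linear (c2im k).
Proof. by move=> a u v; rewrite /c2im !mxE. Qed.

HB.instance Definition _ k := GRing.isLinear.Build R C2 R *:%R (c2re k) (c2re_linear k).
HB.instance Definition _ k := GRing.isLinear.Build R C2 R *:%R (c2im k) (c2im_linear k).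

Lemma c2re_continuous k : continuous (c2re k).
Proof.
move=> q; apply: (@continuous_comp C2 'rV[R]_2 R fst (coordf 0 k) q).
  exact: cvg_fst.
exact: coordf_continuous.
Qed.
Lemma c2im_continuous k : continuous (c2im k).
Proof.
move=> q; apply: (@continuous_comp C2 'rV[R]_2 R snd (coordf 0 k) q).
  exact: cvg_snd.
exact: coordf_continuous.
Qed.

Definition c2C k (q : C2) : C := Complex (q.1 0 k) (q.2 0 k).

Lemma c2C_mulI k q : c2C k (mulI q) = ii * c2C k q.
Proof. by apply: complex_eq; rewrite /= ?mxE; ring. Qed.

Lemma dot_c2 (q w : C2) : dot q w =
  complex.Re (conjc (c2C 0 q) * c2C 0 w + conjc (c2C 1 q) * c2C 1 w).
Proof.
rewrite /dot /pairing !big_ord_recl !big_ord0 /= !addr0.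
rewrite (_ : lift ord0 ord0 = 1 :> 'I_2); last exact/val_inj.
by ring.
Qed.

Lemma Im_Re_ii (z : C) : complex.Re (ii * z) = - complex.Im z.
Proof. by case: z => a b /=; ring. Qed.

Variables (V : set 'rV[R]_3) (Phi : 'rV[R]_3 -> C2) (O : openset R 3).
Hypotheses (OV : O `<=` V) (Vsm : smooth_open V Phi) (VS : forall y, V y -> S3 (Phi y)).
Hypothesis Phi_inj : forall y v, V y -> 'D_v Phi y = 0 -> v = 0.
Hypothesis Phi_CR : forall y v, V y ->
  (xi c y v <-> HS3 (Phi y) ('D_v Phi y)) /\
  (xi c y v -> 'D_(v *m Jcr c y) Phi y = mulI ('D_v Phi y)).
Variables (theta : form1 X) (F : cframe O).
Hypothesis Fad : adapted theta c F.

Lemma c2C_sm k : smC O (fun y => c2C k (Phi y)).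
Proof.
split=> n.
  by apply: (Ck_lin (L := c2re k)) (Ck_sub OV (Vsm n)); [exact: c2re_continuous|exact: osetP].
by apply: (Ck_lin (L := c2im k)) (Ck_sub OV (Vsm n)); [exact: c2im_continuous|exact: osetP].
Qed.

Definition sF k : smf O := mkf (c2C_sm k).

Lemma dC_sF k v y : O y -> dC v (sF k) y = c2C k ('D_v Phi y).
Proof.
move=> Oy; have Vy := OV Oy.
have -> : dC v (sF k) y = dC v (fun y => c2C k (Phi y)) y.
  by apply: dC_eq (@osetP _ _ O) Oy _ => z; rewrite inE => Oz; rewrite mkfE.
have dF : derivable Phi y v by exact: Ck_derivable (Vsm 1) Vy.
apply: complex_eq; rewrite ?dC_Re ?dC_Im /=.
  exact: (derive_lin (L := c2re k) (@c2re_continuous k) dF).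
exact: (derive_lin (L := c2im k) (@c2im_continuous k) dF).
Qed.

Lemma mxIm_mul (z : 'rV[C]_3) (J : 'M[R]_3) : mxIm (z *m cmx J) = mxIm z *m J.
Proof.
apply/rowP => i; rewrite !mxE raddf_sum; apply: eq_bigr => j _.
by rewrite !mxE -[LHS]/(complex.Im _) ImM /= mulr0 add0r.
Qed.
Lemma mxIm_ii (z : 'rV[C]_3) : mxIm (ii *: z) = mxRe z.
Proof. by apply/rowP => i; rewrite !mxE ImM /=; ring. Qed.

Lemma DPhi_JE y : O y -> 'D_(mxRe (zrow F y)) Phi y = mulI ('D_(mxIm (zrow F y)) Phi y).
Proof.
move=> Oy; have [_ _ _ xiI ZJ] := Fad Oy.
rewrite -((Phi_CR _ (OV Oy)).2 xiI); congr ('D__ _ _).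
by rewrite -mxIm_mul ZJ mxIm_ii.
Qed.

Lemma sZb k : vD (cj (cZ F)) (sF k) = 0.
Proof.
apply: smf_eq => y Oy; rewrite fval0// vD_cj_val// !dC_sF// -/(zrow F y) DPhi_JE//.
by rewrite c2C_mulI subrr.
Qed.

Lemma sZ_val k y : O y -> vD (cZ F) (sF k) y = 2 * ii * c2C k ('D_(mxIm (zrow F y)) Phi y).
Proof.
move=> Oy; rewrite vD_val// !dC_sF// -/(zrow F y) DPhi_JE// c2C_mulI; ring.
Qed.

Lemma sFF : sF 0 * fconj (sF 0) + sF 1 * fconj (sF 1) = 1.
Proof.
apply: smf_eq => y Oy; rewrite fval1// fvalD// !fvalM// !fval_conj// !mkfE//.
have := VS (OV Oy); rewrite /S3 /= dot_c2 => h.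
apply: complex_eq; first by rewrite -[RHS]h mulrC [X in _ + X]mulrC.
by rewrite /=; ring.
Qed.

Lemma sFdF : fconj (sF 0) * vD (cZ F) (sF 0) + fconj (sF 1) * vD (cZ F) (sF 1) = 0.
Proof.
apply: smf_eq => y Oy; rewrite fval0// fvalD// !fvalM// !sZ_val// !fval_conj// !mkfE//.
have [_ _ _ xiI _] := Fad Oy.
have [d1 d2] := ((Phi_CR _ (OV Oy)).1).1 xiI.
rewrite !dot_c2 !c2C_mulI in d1 d2.
set w := 'D__ _ _ in d1 d2 *.
have d3 : complex.Im (conjc (c2C 0 (Phi y)) * c2C 0 w + conjc (c2C 1 (Phi y)) * c2C 1 w) = 0.
  apply: oppr_inj; rewrite oppr0 -Im_Re_ii -[RHS]d2; congr complex.Re; ring.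
have -> : 0 = 2 * ii * (conjc (c2C 0 (Phi y)) * c2C 0 w + conjc (c2C 1 (Phi y)) * c2C 1 w) :> C.
  by rewrite [X in _ * X](complex_eq (w := 0) d1 d3) mulr0.
by ring.
Qed.

(** The factor between Z and the standard field of the sphere: by [sFdF] the vector (Z F0, Z F1) of
    derivatives of the coordinates [sF] is a multiple of (conj F1, - conj F0), and this is the
    coefficient. *)
Definition sm := sF 1 * vD (cZ F) (sF 0) - sF 0 * vD (cZ F) (sF 1).

Lemma sZ0 : vD (cZ F) (sF 0) = sm * fconj (sF 1).
Proof.
rewrite -[LHS]mulr1 -sFF /sm; apply: (eq_comb (c := sF 0) sFdF); ring.
Qed.

Lemma sZ1 : vD (cZ F) (sF 1) = - (sm * fconj (sF 0)).
Proof.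
rewrite -[LHS]mulr1 -sFF /sm; apply: (eq_comb (c := sF 1) sFdF); ring.
Qed.

(** Where the factor vanishes, the differential of Phi kills the real and imaginary parts of Z;
    injectivity of the differential gives Z = 0, against theta^1(Z) = 1. *)
Lemma sm_neq0 y : O y -> sm y != 0.
Proof.
move=> Oy; apply/eqP => m0; have Vy := OV Oy.
have i0 : 2 * ii != 0 :> C.
  by rewrite mulf_neq0 ?pnatr_eq0// eq_complex /= oner_eq0 andbF.
have Zk k : c2C k ('D_(mxIm (zrow F y)) Phi y) = 0.
  apply/eqP; rewrite -(mulrI_eq0 _ (mulfI i0)) -sZ_val//.
  have [->|->] : k = 0 \/ k = 1.
    by case: k => [[|[|//]] ?]; [left|right]; exact/val_inj.
  - by rewrite sZ0 fvalM// m0 mul0r.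
  - by rewrite sZ1 fvalN// fvalM// m0 mul0r oppr0.
have DI0 : 'D_(mxIm (zrow F y)) Phi y = 0.
  rewrite [LHS]surjective_pairing; congr pair; apply/rowP => k; rewrite mxE.
    by have /(congr1 (@complex.Re R)) := Zk k.
  by have /(congr1 (@complex.Im R)) := Zk k.
have DR0 : 'D_(mxRe (zrow F y)) Phi y = 0.
  by rewrite DPhi_JE// DI0 /mulI /= oppr0.
have I0 := Phi_inj Vy DI0; have R0 := Phi_inj Vy DR0.
have := cth1_Z F => /(congr1 (fun f => fval f y)); rewrite con_val// fval1//.
rewrite /pairing big1 => [/esym/eqP|i _]; first by rewrite oner_eq0.
rewrite [X in _ * X](_ : _ = 0) ?mulr0// -/(zrow F y).
apply: complex_eq.
  by have /rowP/(_ i) := R0; rewrite !mxE.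
by have /rowP/(_ i) := I0; rewrite !mxE.
Qed.

Lemma sphere_hessian : fab F = 0 ->
  vD (cZ F) (vD (cZ F) (fW F)) = fp F * vD (cZ F) (fW F).
Proof.
move=> ab0; have [mi mmi] := smf_inv sm_neq0.
have nni : fconj sm * fconj mi = 1 by rewrite -fconjM mmi fconj1.
have ZbG k : vD (cZ F) (fconj (sF k)) = 0.
  by rewrite -[cZ F]cjK -fconj_vD sZb fconj0.
apply: (@sphere_W11 _ _ (fJJ (O := O)) (pshf_of F) (sF 0) (sF 1) (fconj (sF 0)) (fconj (sF 1))
  sm (fconj sm) mi (fconj mi)) => //.
- exact: sFF.
- exact: sZb.
- exact: sZb.
- exact: ZbG.
- exact: ZbG.
- exact: sZ0.
- exact: sZ1.
- by rewrite /pZb /= -fconj_vD sZ0 fconjM fconjK.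
- by rewrite /pZb /= -fconj_vD sZ1 fconjN fconjM fconjK.
Qed.

End Sphere.

Section Hat.
Context {R : realType} (X : CR3 R).
Local Notation C := R[i].
Implicit Types (c : chart X).

Definition good (theta : form1 X) c (O : openset R 3) (F : cframe O) (W : X -> R) : Prop :=
  [/\ adapted theta c F, hasW c F W, cA F = 0,
      vD (cT F) (fp F) = vD (cZ F) (fq F) + fq F * fp F &
      vD (cZ F) (vD (cZ F) (fW F)) = fp F * vD (cZ F) (fW F)].

Lemma hat_frame (theta : form1 X) W c x : spherical X -> is_contact_form theta ->
  vanishing_torsion theta -> is_TW_curvature theta W -> img c x ->
  exists V, [/\ open V, V x, V `<=` img c &
    forall O : openset R 3, O `<=` V -> exists F : cframe O, good theta c F W].
Proof.
move=> sph thc tf tw xc.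
have [V1 [oV1 V1x V1c H1]] := tw_frame_ex thc tw xc.
have [V2 [oV2 V2x _ H2]] := tf_frame_ex thc tf xc.
have [V3 [Phi [[oV3 V3x _] [sPhi _ [U' _ imPhi] injPhi] CRPhi]]] := sph c x xc.
exists (V1 `&` (V2 `&` V3)); split.
- by apply: openI => //; apply: openI.
- by [].
- by move=> y [/V1c].
move=> O OV.
have O1 : O `<=` V1 by move=> y /OV[].
have O2 : O `<=` V2 by move=> y /OV[_ []].
have O3 : O `<=` V3 by move=> y /OV[_ []].
have [F [Fad FW Fdom]] := H1 O O1; have [F2 [F2ad F20]] := H2 O O2.
have F0 := cmp_torsion thc F2ad Fad F20.
have Fab : fab F = 0 by rewrite fab_cA F0 fconj0.
exists F; split=> //.
  by apply: dom_ZT => //; apply: Fdom.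
apply: (sphere_hessian O3 sPhi _ injPhi CRPhi Fad) => //.
move=> y V3y; have : (U' `&` S3) (Phi y) by rewrite -imPhi; exists y.
by case.
Qed.

Section Constants.
Variables (theta : form1 X) (c : chart X) (O : openset R 3) (F : cframe O) (W : X -> R).
Hypothesis Fg : good theta c F W.
Local Notation S := (pshf_of F).
Local Notation Sb := (conj_frame S).

Let a0 : pa S = 0. Proof. by have [_ _ A0 _ _] := Fg; rewrite /= fa_cA. Qed.
Let ab0 : pab S = 0. Proof. by have [_ _ A0 _ _] := Fg; rewrite /= fab_cA A0 fconj0. Qed.
Let Tp : pT S (pp S) = pZ S (pq S) + pq S * pp S.
Proof. by have [_ _ _ h _] := Fg. Qed.
Let Tpb : pT S (ppb S) = - pZb S (pq S) - pq S * ppb S.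
Proof. by have [_ _ _ h _] := Fg; exact: dom_ZbT. Qed.
Let W11 : pZ S (pZ S (pW S)) = pp S * pZ S (pW S).
Proof. by have [_ _ _ _ h] := Fg. Qed.

Lemma fconj_J : fconj (fcst O ii) = - fcst O ii.
Proof. by rewrite fconj_cst -fcstN; congr fcst; apply: complex_eq; rewrite /= ?oppr0. Qed.

Lemma fconj_fW : fconj (fW F) = fW F.
Proof.
have n2 : fconj (2 : smf O) = 2 by rewrite -[2]/(1 + 1) fconjD fconj1.
rewrite /fW; move: (conj_fp F) (conj_fpb F) (conj_fq F).
move: (fp F) (fpb F) (fq F) => p pb q pE pbE qE.
rewrite !(fconjD, fconjN, fconjM) !fconj_vD ?n2 ?fconj1 pE pbE qE fconj_J cjK.
by ring.
Qed.

Let W11b : pZb S (pZb S (pW S)) = ppb S * pZb S (pW S).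
Proof.
have := congr1 (@fconj R 3 O) W11; rewrite /= fconjM !fconj_vD fconj_fW conj_fp.
by [].
Qed.

Let TpB : pT Sb (pp Sb) = pZ Sb (pq Sb) + pq Sb * pp Sb.
Proof. by have := Tpb; rewrite /= (vDN _ (fq F)) => ->; ring. Qed.
Let TpbB : pT Sb (ppb Sb) = - pZb Sb (pq Sb) - pq Sb * ppb Sb.
Proof. by have := Tp; rewrite /= (vDN _ (fq F)) => ->; ring. Qed.

Lemma lapW_conj : lapW Sb = lapW S.
Proof. by rewrite (lapW_sym (fJJ (O := O)) a0 ab0 Tp Tpb). Qed.
Lemma kapW_conj : kapW Sb = kapW S.
Proof. by rewrite /kapW lapW_conj. Qed.
Lemma c6W_conj : c6W Sb = c6W S.
Proof. by rewrite /c6W kapW_conj /= [vD (cj _) _ * _]mulrC. Qed.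

Lemma good_lapW_sym : lapW S = pZ S (pZb S (pW S)) + pp S * pZb S (pW S).
Proof. exact: (lapW_sym (fJJ (O := O)) a0 ab0 Tp Tpb). Qed.

Let mJJ : - fcst O ii * - fcst O ii = -1.
Proof. by rewrite mulrNN fJJ. Qed.

Lemma kap_const : [/\ pZ S (kapW S) = 0, pZb S (kapW S) = 0 & pT S (kapW S) = 0].
Proof.
have z := Z_kapW (fJJ (O := O)) a0 ab0 Tp Tpb W11.
have zb : pZb S (kapW S) = 0.
  by have := @Z_kapW _ _ mJJ Sb ab0 a0 TpB TpbB W11b; rewrite kapW_conj.
by split=> //; exact: (T_of_ZZb (fJJ (O := O)) z zb).
Qed.

Lemma c6_const : [/\ pZ S (c6W S) = 0, pZb S (c6W S) = 0 & pT S (c6W S) = 0].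
Proof.
have z := Z_c6W (fJJ (O := O)) a0 ab0 Tp Tpb W11.
have zb : pZb S (c6W S) = 0.
  by have := @Z_c6W _ _ mJJ Sb ab0 a0 TpB TpbB W11b; rewrite c6W_conj.
by split=> //; exact: (T_of_ZZb (fJJ (O := O)) z zb).
Qed.

End Constants.

(** The frame spans all vector fields, so every partial derivative of k vanishes on O. *)
Lemma frame_const_near (O : openset R 3) (F : cframe O) (k : smf O) x : O x ->
  vD (cZ F) k = 0 -> vD (cj (cZ F)) k = 0 -> vD (cT F) k = 0 ->
  \forall y \near x, k y = k x.
Proof.
move=> Ox z zb t.
have d0 j : fd (delta_mx 0 j) k = 0.
  have <- : vD (fun i => (i == j)%:R) k = fd (delta_mx 0 j) k.
    rewrite /vD (bigD1 j)//= big1 ?addr0 ?eqxx ?mul1r// => i ij.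
    by rewrite (negPf ij) mul0r.
  by rewrite [fun i => _](c_full F) vD_lin3 z zb t; ring.
have D0 v y : O y -> dC v k y = 0.
  move=> Oy; rewrite (dC_sum_delta _ (@osetP _ _ O) Oy (smfP k)) big1// => i _.
  by rewrite -fval_d// d0 fval0// mulr0.
have [k1 k2] := smfP k.
have n1 : \forall y \near x, complex.Re (k y) = complex.Re (k x).
  apply: (deriv_zero_near (@osetP _ _ O) Ox) => y v Oy.
  by apply: DeriveDef; [exact: Ck_derivable (k1 1) Oy|rewrite -dC_Re D0].
have n2 : \forall y \near x, complex.Im (k y) = complex.Im (k x).
  apply: (deriv_zero_near (@osetP _ _ O) Ox) => y v Oy.
  by apply: DeriveDef; [exact: Ck_derivable (k2 1) Oy|rewrite -dC_Im D0].
by apply: filterS2 n1 n2 => y; exact: complex_eq.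
Qed.

End Hat.

Lemma full_val (R : realType) (O : openset R 3) (F : cframe O) x (z : 'rV[R[i]]_3) : O x ->
  z = pairing (\row_i cth F i x) z *: (\row_i cT F i x) +
      pairing (\row_i cth1 F i x) z *: zrow F x +
      pairing (mxconj (\row_i cth1 F i x)) z *: mxconj (zrow F x).
Proof.
move=> Ox; apply/rowP => i.
have /(congr1 (fun f => fval (f i) x)) := c_full F (fun i => fcst O (z 0 i)).
rewrite !fvalD// !fvalM// !con_val// fval_cst//.
have -> : \row_i0 fcst O (z 0 i0) x = z by apply/rowP => l; rewrite mxE fval_cst.
rewrite row_cj// => ->; rewrite lin3_row; congr (_ * _ + _ * _ + _ * _).
- by rewrite mxE.
- by rewrite mxE.
- by rewrite !mxE /cj fval_conj.
Qed.

(** * Pullback of a frame along a transition map *)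

Section Transfer.
Context {R : realType} (X : CR3 R) (c d : chart X).
Local Notation C := R[i].
Local Notation phi := (coord d \o param c).
Variables (O' O : openset R 3) (theta : form1 X) (F' : cframe O') (F : cframe O).
Hypothesis thc : is_contact_form theta.
Hypotheses (Fad' : adapted theta c F') (Fad : adapted theta d F).
Hypotheses (O'd : forall y, O' y -> dom d (param c y)) (O'O : forall y, O' y -> O (phi y)).

Lemma img_param (e : chart X) y : img e y -> dom e (param e y) /\ coord e (param e y) = y.
Proof. by move=> [p dp <-]; rewrite coordK. Qed.

Let pc y : O' y -> dom c (param c y).
Proof. by move=> Oy; have [/img_param[]] := Fad' Oy. Qed.
Let cp y : O' y -> coord c (param c y) = y.
Proof. by move=> Oy; have [/img_param[]] := Fad' Oy. Qed.

Lemma phi_smooth : smooth_open O' phi.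
Proof.
apply: smooth_sub (transition_smooth c d) => y Oy.
by exists (param c y); [split; [exact: pc|exact: O'd]|exact: cp].
Qed.

Lemma rho_sm (u : smf O) : smC O' (u \o phi).
Proof.
have [u1 u2] := smfP u; split=> k.
  exact: (Ck_comp (@osetP _ _ O') (@osetP _ _ O) O'O phi_smooth (u1 k)).
exact: (Ck_comp (@osetP _ _ O') (@osetP _ _ O) O'O phi_smooth (u2 k)).
Qed.

Definition rho u := mkf (rho_sm u).

Lemma rho_val u y : O' y -> rho u y = u (phi y).
Proof. by move=> Oy; rewrite mkfE. Qed.

Lemma rhoD : {morph rho : u v / u + v}.
Proof.
move=> u v; apply: smf_eq => y Oy.
by rewrite fvalD// !rho_val// fvalD//; exact: O'O.
Qed.
Lemma rhoM : {morph rho : u v / u * v}.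
Proof.
move=> u v; apply: smf_eq => y Oy.
by rewrite fvalM// !rho_val// fvalM//; exact: O'O.
Qed.
Lemma rho_cst k : rho (fcst O k) = fcst O' k.
Proof. by apply: smf_eq => y Oy; rewrite rho_val// !fval_cst//; exact: O'O. Qed.
Lemma rho_conj u : rho (fconj u) = fconj (rho u).
Proof.
apply: smf_eq => y Oy; rewrite fval_conj// !rho_val// fval_conj//; exact: O'O.
Qed.

Lemma phi_comp_sm j : smC O' (fun y => (phi y 0 j)%:C%C).
Proof. by apply: smC_real => k; apply: Ck_coord; [exact: osetP|exact: phi_smooth]. Qed.
Definition phiE j := mkf (phi_comp_sm j).

Lemma phi_derivable y v : O' y -> derivable phi y v.
Proof. by move=> Oy; exact: Ck_derivable (phi_smooth 1) Oy. Qed.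

Lemma dC_phiE j v y : O' y -> dC v (phiE j) y = ('D_v phi y 0 j)%:C%C.
Proof.
move=> Oy; rewrite (@dC_eq _ _ O' _ (fun y => (phi y 0 j)%:C%C) _ y (@osetP _ _ O') Oy).
  apply: complex_eq; rewrite ?dC_Re ?dC_Im /=; last exact: derive_cst.
  by rewrite (derive_coordE (f := phi)) //; exact: phi_derivable.
by move=> z; rewrite inE => Oz; rewrite mkfE.
Qed.

Lemma dC_rho v u y : O' y ->
  dC v (rho u) y = \sum_j ('D_v phi y 0 j)%:C%C * dC (delta_mx 0 j) u (phi y).
Proof.
move=> Oy; rewrite (@dC_eq _ _ O' _ (u \o phi) _ y (@osetP _ _ O') Oy); last first.
  by move=> z; rewrite inE => Oz; rewrite rho_val.
have [u1 u2] := smfP u; have Op := O'O Oy; have dp : derivable phi y v by exact: phi_derivable.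
have E1 := is_derive_chain (@osetP _ _ O) Op (u1 1) dp.
have E2 := is_derive_chain (@osetP _ _ O) Op (u2 1) dp.
apply: complex_eq; rewrite ?dC_Re ?dC_Im.
  have [_ e1] := E1; apply: (etrans e1); rewrite raddf_sum; apply: eq_bigr => j _.
  by rewrite -[RHS]/(complex.Re _) ReM dC_Re /= mul0r subr0.
have [_ e2] := E2; apply: (etrans e2); rewrite raddf_sum; apply: eq_bigr => j _.
by rewrite -[RHS]/(complex.Im _) ImM dC_Im /= mul0r addr0.
Qed.

Lemma fd_rho i u : fd (delta_mx 0 i) (rho u) =
  \sum_j fd (delta_mx 0 i) (phiE j) * rho (fd (delta_mx 0 j) u).
Proof.
apply: smf_eq => y Oy; rewrite fval_d// dC_rho// fval_sum//; apply: eq_bigr => j _.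
by rewrite fvalM// fval_d// dC_phiE// rho_val// fval_d//; exact: O'O.
Qed.

Definition pushE (Y : 'I_3 -> smf O') (j : 'I_3) : smf O' := vD Y (phiE j).

Lemma vD_rho Y u : vD Y (rho u) = \sum_j pushE Y j * rho (fd (delta_mx 0 j) u).
Proof.
rewrite /pushE /vD; under eq_bigr do rewrite fd_rho mulr_sumr.
rewrite exchange_big; apply: eq_bigr => j _; rewrite mulr_suml.
by apply: eq_bigr => i _; rewrite mulrA.
Qed.

Lemma rho_sum n (f : 'I_n -> smf O) : rho (\sum_i f i) = \sum_i rho (f i).
Proof.
apply: smf_eq => y Oy; rewrite rho_val// !fval_sum//; last exact: O'O.
by apply: eq_bigr => i _; rewrite rho_val.
Qed.

Lemma rho_vD Y u : rho (vD Y u) = \sum_j rho (Y j) * rho (fd (delta_mx 0 j) u).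
Proof. by rewrite /vD rho_sum; apply: eq_bigr => j _; rewrite rhoM. Qed.

Lemma row_push Y y : O' y -> \row_j pushE Y j y =
  cmx (push c d y (mxRe (\row_i Y i y))) + ii *: cmx (push c d y (mxIm (\row_i Y i y))).
Proof.
move=> Oy; apply/rowP => j; rewrite mxE /pushE vD_val// !dC_phiE//.
by rewrite !mxE.
Qed.

Lemma mxRe_ri (u w : 'rV[R]_3) : mxRe (cmx u + ii *: cmx w) = u.
Proof. by apply/rowP => j; rewrite !mxE ReIm_ii. Qed.
Lemma mxIm_ri (u w : 'rV[R]_3) : mxIm (cmx u + ii *: cmx w) = w.
Proof. by apply/rowP => j; rewrite !mxE ReIm_ii. Qed.

Lemma push_xi y v : O' y -> xi c y v -> xi d (phi y) (push c d y v).
Proof.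
move=> Oy; have [H _] := xi_contact X.
by have := H c d _ (pc Oy) (O'd Oy) v; rewrite cp// => -[].
Qed.

Lemma push_theta y v : O' y -> pairing (theta c y) v = pairing (theta d (phi y)) (push c d y v).
Proof.
move=> Oy; have [[_ H] _] := thc.
by have := H c d _ (pc Oy) (O'd Oy) v; rewrite cp.
Qed.

Let dp y : O' y -> img d (phi y).
Proof. by move=> Oy; exists (param c y) => //; exact: O'd. Qed.

Lemma cmx_mul (v : 'rV[R]_3) (J : 'M[R]_3) : cmx v *m cmx J = cmx (v *m J).
Proof.
apply/rowP => i; rewrite !mxE rmorph_sum; apply: eq_bigr => j _.
by rewrite !mxE rmorphM.
Qed.

Lemma cmxN (v : 'rV[R]_3) : cmx (- v) = - cmx v.
Proof. by apply/rowP => i; rewrite !mxE rmorphN. Qed.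

Lemma cmx_eigen (u w : 'rV[R]_3) (J : 'M[R]_3) : u *m J = - w -> w *m J = u ->
  (cmx u + ii *: cmx w) *m cmx J = ii *: (cmx u + ii *: cmx w).
Proof.
move=> e2 e1; rewrite mulmxDl -scalemxAl !cmx_mul e1 e2 cmxN scalerDr scalerA ii2 scaleN1r.
by rewrite addrC.
Qed.

Definition tr_l := con (fun i => rho (cth1 F i)) (pushE (cZ F')).

Lemma rho_row (a : 'I_3 -> smf O) y : O' y ->
  \row_i rho (a i) y = \row_i a i (phi y).
Proof. by move=> Oy; apply/rowP => i; rewrite !mxE rho_val. Qed.

(** The differential of the transition map respects xi and J, so the image of Z' is again an
    i-eigenvector in the complexified contact plane. *)
Lemma tr_Z j : pushE (cZ F') j = tr_l * rho (cZ F j).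
Proof.
apply: smf_eq => y Oy; have Op := O'O Oy.
set z := \row_l pushE (cZ F') l y.
have [_ _ xR xI ZJ] := Fad' Oy; have [_ thE _ _ _] := Fad Op.
have zE : z = cmx (push c d y (mxRe (zrow F' y))) + ii *: cmx (push c d y (mxIm (zrow F' y))).
  exact: row_push.
have pR := push_xi Oy xR; have pI := push_xi Oy xI.
have [kerE _] := thc.2 _ _ (dp Oy).
have thr : \row_i cth F i (phi y) = cmx (theta d (phi y)).
  by apply/rowP => i; rewrite !mxE thE.
have z0 : pairing (\row_i cth F i (phi y)) z = 0.
  rewrite thr; apply: pairing_Re_Im; rewrite zE.
    by rewrite mxRe_ri; apply/kerE.
  by rewrite mxIm_ri; apply/kerE.
have zJ : z *m cmx (Jcr d (phi y)) = ii *: z.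
  have [_ _ J2 pJ] := Jcr_CR X.
  have e1 : push c d y (mxIm (zrow F' y)) *m Jcr d (phi y) = push c d y (mxRe (zrow F' y)).
    have := pJ c d _ (mxIm (zrow F' y)) (pc Oy) (O'd Oy); rewrite cp// => /(_ xI) <-.
    by rewrite -mxIm_mul ZJ mxIm_ii.
  have e2 : push c d y (mxRe (zrow F' y)) *m Jcr d (phi y) = - push c d y (mxIm (zrow F' y)).
    by rewrite -e1; apply: J2 => //; exact: dp.
  by rewrite zE; apply: cmx_eigen.
have zb := eigen_Zb Fad Op z0 zJ.
have := full_val F z Op; rewrite z0 zb !scale0r add0r addr0 => /rowP/(_ j).
by rewrite mxE => ->; rewrite mxE fvalM// con_val// rho_row// rho_val// mxE.
Qed.

Lemma tr_vZ u : vD (cZ F') (rho u) = tr_l * rho (vD (cZ F) u).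
Proof.
by rewrite vD_rho rho_vD mulr_sumr; apply: eq_bigr => j _; rewrite tr_Z mulrA.
Qed.

Lemma tr_vZb u : vD (cj (cZ F')) (rho u) = fconj tr_l * rho (vD (cj (cZ F)) u).
Proof.
rewrite -[u in LHS]fconjK rho_conj -fconj_vD tr_vZ fconjM; congr (_ * _).
by rewrite -rho_conj fconj_vD fconjK.
Qed.

Lemma tr_vT : exists a b, forall u, vD (cT F') (rho u) =
  rho (vD (cT F) u) + a * rho (vD (cZ F) u) + b * rho (vD (cj (cZ F)) u).
Proof.
exists (con (fun i => rho (cth1 F i)) (pushE (cT F'))),
  (con (fun i => rho (cj (cth1 F) i)) (pushE (cT F'))) => u.
rewrite vD_rho !rho_vD !mulr_sumr -!big_split; apply: eq_bigr => j _ /=.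
rewrite -[rho (cT F j) * _]mul1r !mulrA -!mulrDl; congr (_ * _).
apply: smf_eq => y Oy; have Op := O'O Oy.
set t := \row_l pushE (cT F') l y.
have [_ thE _ _ _] := Fad Op; have [_ thE' _ _ _] := Fad' Oy.
have thr : \row_i cth F i (phi y) = cmx (theta d (phi y)).
  by apply/rowP => i; rewrite !mxE thE.
have t1 : pairing (\row_i cth F i (phi y)) t = 1.
  have Tim : mxIm (\row_i cT F' i y) = 0.
    apply/rowP => i; rewrite !mxE; have := congr1 (fun f => fval (f i) y) (cT_real F').
    rewrite /cj fval_conj//; case: (cT F' i y) => a b /= [] /eqP.
    by rewrite -subr_eq0 -opprD oppr_eq0 -mulr2n mulrn_eq0 /= => /eqP.
  have tE : t = cmx (push c d y (mxRe (\row_i cT F' i y))).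
    rewrite /t row_push// Tim /push derive0.
    by apply/rowP => i; rewrite !mxE mulr0 addr0.
  rewrite tE thr pairing_cmx -push_theta//.
  have := cth_T F' => /(congr1 (fun f => fval f y)); rewrite con_val// fval1// => <-.
  rewrite -pairing_cmx; congr pairing; apply/rowP => i.
    by rewrite !mxE thE'.
  have /rowP/(_ i) := Tim; rewrite !mxE; case: (cT F' i y) => a b /= ->.
  by [].
have := full_val F t Op; rewrite t1 scale1r => /rowP/(_ j) E.
rewrite mxE in E; apply: (etrans E).
rewrite !fvalD// !fvalM// fval1// !con_val// !rho_val// !rho_row// row_cj// !mxE mul1r.
by rewrite /cj fval_conj.
Qed.

Lemma tr_ind x y z : (forall u, x * rho (vD (cZ F) u) + y * rho (vD (cj (cZ F)) u)
  + z * rho (vD (cT F) u) = 0) -> [/\ x = 0, y = 0 & z = 0].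
Proof.
move=> h.
have vDc Y j : vD Y (fcoord O j) = Y j.
  rewrite /vD (bigD1 j)//= big1 ?addr0 => [|i ij]; first by rewrite fd_coord eqxx mulr1.
  by rewrite fd_coord (negPf ij) mulr0.
have hj j : x * rho (cZ F j) + y * rho (cj (cZ F) j) + z * rho (cT F j) = 0.
  by have := h (fcoord O j); rewrite !vDc.
have rc a Y : rho (con a Y) = con (fun j => rho (a j)) (fun j => rho (Y j)).
  by rewrite /con rho_sum; apply: eq_bigr => j _; rewrite rhoM.
have hc a : x * rho (con a (cZ F)) + y * rho (con a (cj (cZ F))) + z * rho (con a (cT F)) = 0.
  rewrite !rc /con !mulr_sumr -!big_split /= big1// => j _.
  by rewrite -[RHS](mulr0 (rho (a j))) -(hj j); ring.
have r1 : rho 1 = 1 by exact: rho_cst.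
have r0 : rho 0 = 0 by exact: rho_cst.
have := hc (cth1 F); have := hc (cj (cth1 F)); have := hc (cth F).
by rewrite !frameE r1 r0 !mulr0 !mulr1 !add0r !addr0 => -> -> ->.
Qed.

Variable W : X -> R.
Hypotheses (FW' : hasW c F' W) (FW : hasW d F W).

Lemma tr_W : rho (fW F) = fW F'.
Proof.
apply: smf_eq => y Oy; rewrite rho_val// FW' // FW; last exact: O'O.
by rewrite /= coordK//; exact: O'd.
Qed.

Lemma tr_kap : rho (kapW (pshf_of F)) = kapW (pshf_of F') /\
  rho (c6W (pshf_of F)) = c6W (pshf_of F').
Proof.
have [a [b TE]] := tr_vT.
have JB0 : fcst O' ii * fcst O' ii + 1 = 0 by rewrite fJJ addNr.
have L := @chart_lap _ _ _ _ (pshf_of F) (pshf_of F') rho rhoD rhoM (rho_cst ii)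
  tr_l (fconj tr_l) a b tr_vZ tr_vZb TE tr_ind JB0.
have G := @chart_grad _ _ _ _ (pshf_of F) (pshf_of F') rho rhoD rhoM (rho_cst ii)
  tr_l (fconj tr_l) a b tr_vZ tr_vZb TE tr_ind JB0.
have rn n : rho n%:R = n%:R.
  by elim: n => [|n IH]; [exact: rho_cst|rewrite -!natr1 rhoD IH; congr (_ + _); exact: rho_cst].
have rN u : rho (- u) = - rho u.
  by apply: smf_eq => y Oy; rewrite fvalN// !rho_val// fvalN//; exact: O'O.
have kE : rho (kapW (pshf_of F)) = kapW (pshf_of F').
  by rewrite /kapW rhoD !rhoM rn /lapW -L /= tr_W.
split=> //; rewrite /c6W !(rhoD, rN) !rhoM !rn kE tr_W.
by rewrite -rhoM -G /= tr_W.
Qed.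

End Transfer.

(** * The two constants attached to a point *)

Section LocallyConstant.
Context {R : realType} (X : CR3 R) (theta : form1 X) (W : X -> R).
Hypotheses (sph : spherical X) (thc : is_contact_form theta)
  (tf : vanishing_torsion theta) (tw : is_TW_curvature theta W).

(* k and c6 are the values at q of the invariants kapW and c6W. *)
Definition LC_in (c : chart X) (q : X) (k c6 : R) : Prop :=
  exists (O : openset R 3) (F : cframe O), [/\ dom c q, O (coord c q), good theta c F W,
    kapW (pshf_of F) (coord c q) = k%:C%C & c6W (pshf_of F) (coord c q) = c6%:C%C].

Definition LC q k c6 := exists c, LC_in c q k c6.

Lemma real_val (O : openset R 3) (u : smf O) x : O x -> fconj u = u ->
  u x = (complex.Re (u x))%:C%C.
Proof.
move=> Ox /(congr1 (fun f => fval f x)); rewrite fval_conj//.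
case: (u x) => a b /= [] h; congr Complex.
have : b + b = 0 by rewrite -[X in X + _]h addNr.
by move/eqP; rewrite -mulr2n mulrn_eq0 => /eqP.
Qed.

Lemma fconj_n (O : openset R 3) n : fconj (n%:R : smf O) = n%:R.
Proof. by elim: n => [|n IH]; [exact: fconj0|rewrite -natr1 fconjD IH fconj1]. Qed.

Lemma fconj_lapW (c : chart X) (O : openset R 3) (F : cframe O) : good theta c F W ->
  fconj (lapW (pshf_of F)) = lapW (pshf_of F).
Proof.
move=> Fg; rewrite [in RHS](good_lapW_sym Fg) /lapW fconjD fconjM /= !fconj_vD fconj_fW cjK.
by rewrite conj_fpb.
Qed.

Lemma fconj_kapW (c : chart X) (O : openset R 3) (F : cframe O) : good theta c F W ->
  fconj (kapW (pshf_of F)) = kapW (pshf_of F).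
Proof.
by move=> Fg; rewrite /kapW fconjD !fconjM (fconj_lapW Fg) fconj_n /= fconj_fW.
Qed.

Lemma fconj_c6W (c : chart X) (O : openset R 3) (F : cframe O) : good theta c F W ->
  fconj (c6W (pshf_of F)) = c6W (pshf_of F).
Proof.
move=> Fg; rewrite /c6W !(fconjD, fconjN) !fconjM (fconj_kapW Fg) !fconj_n /= fconj_fW.
rewrite !fconj_vD fconj_fW cjK; congr (6 * _ - _ + _); exact: mulrC.
Qed.

Lemma LC_in_exists c q : dom c q -> exists k c6, LC_in c q k c6.
Proof.
move=> dq; have xc : img c (coord c q) by exists q.
have [V [oV Vx Vc H]] := hat_frame sph thc tf tw xc.
have [F Fg] := H (OpenSet oV) (@subset_refl _ _).
have Ox : OpenSet oV (coord c q) by [].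
exists (complex.Re (kapW (pshf_of F) (coord c q))), (complex.Re (c6W (pshf_of F) (coord c q))).
exists (OpenSet oV), F; split=> //; apply: real_val => //.
  exact: fconj_kapW Fg.
exact: fconj_c6W Fg.
Qed.

Lemma dom_chart (q : X) : exists c, dom c q.
Proof. exact: dom_cover. Qed.

Lemma LC_exists (q : X) : exists k c6, LC q k c6.
Proof.
by have [c /LC_in_exists[k [c6 h]]] := dom_chart q; exists k, c6, c.
Qed.

Lemma coord_near (c : chart X) (q : X) (P : set 'rV[R]_3) : dom c q ->
  (\forall y \near coord c q, P y) -> \forall q' \near q, dom c q' /\ P (coord c q').
Proof.
move=> dq nP; apply: (@filterI _ (nbhs q) (nbhs_filter q)).
  by apply: open_nbhs_nbhs; split=> //; exact: dom_open.
exact: (coord_continuous dq nP).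
Qed.

Lemma LC_near q k c6 : LC q k c6 -> \forall q' \near q, LC q' k c6.
Proof.
move=> [c [U [F [dq Ox Fg kE cE]]]].
have [z zb t] := kap_const Fg; have [z' zb' t'] := c6_const Fg.
have n1 := frame_const_near Ox z zb t; have n2 := frame_const_near Ox z' zb' t'.
have n3 : \forall y \near coord c q, U y by apply: open_nbhs_nbhs; split=> //; exact: osetP.
have n4 := coord_near dq (filterI n3 (filterI n1 n2)).
near=> q'.
have [dq' [Oy [e1 e2]]] : dom c q' /\ U (coord c q') /\
    kapW (pshf_of F) (coord c q') = kapW (pshf_of F) (coord c q) /\
    c6W (pshf_of F) (coord c q') = c6W (pshf_of F) (coord c q).
  by near: q'; exact: n4.
by exists c, U, F; split=> //; rewrite ?e1 ?e2.
Unshelve. all: by end_near. Qed.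

(** The two frames may live in different charts. Both are pulled back to one frame of the chart c
    around q, where [tr_kap] identifies the values. *)
Lemma LC_uniq q k1 c1 k2 c2 : LC q k1 c1 -> LC q k2 c2 -> k1 = k2 /\ c1 = c2.
Proof.
move=> [c [U1 [F1 [dq Ox1 Fg1 kE1 cE1]]]] [d [U2 [F2 [dq2 Ox2 Fg2 kE2 cE2]]]].
have xc : img c (coord c q) by exists q.
have [V [oV Vx Vc H]] := hat_frame sph thc tf tw xc.
pose P e (O : openset R 3) := [set y | dom e (param c y) /\ O (coord e (param c y))].
have nP e (O : openset R 3) : dom e q -> O (coord e q) -> nbhs (coord c q) (P e O).
  move=> de Oe.
  have n1 : \forall q' \near q, dom e q' /\ O (coord e q').
    by apply: coord_near => //; apply: open_nbhs_nbhs; split=> //; exact: osetP.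
  rewrite -[q in \forall q' \near q, _](coordK dq) in n1.
  exact: (param_continuous xc n1).
have : nbhs (coord c q) ((V `&` (P c U1 `&` P d U2))^°).
  apply: open_nbhs_nbhs; split; first exact: open_interior.
  apply: filterI; first exact: open_nbhs_nbhs.
  by apply: filterI; exact: nP.
move=> /nbhs_singleton Ix; pose O := OpenSet (open_interior (V `&` (P c U1 `&` P d U2))).
have OV : O `<=` V `&` (P c U1 `&` P d U2) by exact: interior_subset.
have [F Fg] := H O (subset_trans OV (@subIsetl _ _ _)).
have [Fad FW _ _ _] := Fg; have [F1ad F1W _ _ _] := Fg1; have [F2ad F2W _ _ _] := Fg2.
have d1 y : O y -> dom c (param c y) by move=> /OV[_ [[]]].
have d2 y : O y -> dom d (param c y) by move=> /OV[_ [_ []]].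
have p1 y : O y -> U1 ((coord c \o param c) y) by move=> /OV[_ [[]]].
have p2 y : O y -> U2 ((coord d \o param c) y) by move=> /OV[_ [_ []]].
have Ox : O (coord c q) by [].
have [a1 b1] := tr_kap thc Fad F1ad d1 p1 FW F1W.
have [a2 b2] := tr_kap thc Fad F2ad d2 p2 FW F2W.
have ev e (O' : openset R 3) (pp : forall y, O y -> O' ((coord e \o param c) y))
    (F' : cframe O') dd' (u : smf O') (u' : smf O) : dom e q ->
    @rho _ X c e O O' theta F Fad dd' pp u = u' -> u (coord e q) = u' (coord c q).
  by move=> de <-; rewrite rho_val//= coordK.
split.
  have := ev _ _ _ F1 _ _ _ dq a1; have := ev _ _ _ F2 _ _ _ dq2 a2.
  by rewrite kE1 kE2 => <- /(congr1 (@complex.Re R)).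
have := ev _ _ _ F1 _ _ _ dq b1; have := ev _ _ _ F2 _ _ _ dq2 b2.
by rewrite cE1 cE2 => <- /(congr1 (@complex.Re R)).
Qed.

End LocallyConstant.

(** * Extremum conditions and the Levi form *)

(** For small h > 0 the derivative dphi h is positive, so the mean value theorem makes phi exceed
    phi 0 on the right of 0. *)
Lemma not_max_of_second_derivative (R : realType) (phi dphi : R -> R) (e : R) : 0 < e ->
  (forall s : R, `|s| < e -> is_derive s 1 phi (dphi s)) -> dphi 0 = 0 ->
  (\forall h \near 0^', 0 < h^-1 * dphi h) ->
  (forall s : R, `|s| < e -> phi s <= phi 0) -> False.
Proof.
move=> e0 pd d00 /nbhs_ballP[d /= d0 Hd] mx.
have m0 : 0 < Num.min e d by rewrite lt_min e0.
pose h := Num.min e d / 2.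
have h0 : 0 < h by rewrite divr_gt0.
have hm : h < Num.min e d by rewrite ltr_pdivrMr// ltr_pMr// ltr1n.
have [he hd] : h < e /\ h < d by move: hm; rewrite lt_min => /andP.
have pc : {within `[0, h], continuous phi}.
  apply: derivable_within_continuous => s; rewrite in_itv/= => /andP[s0 sh].
  have se : `|s| < e by rewrite ger0_norm// (le_lt_trans sh).
  by have [] := pd s se.
have [s | s sI E] := @MVT R phi dphi 0 h h0 _ pc.
  rewrite in_itv/= => /andP[s0 sh]; apply: pd.
  by rewrite gtr0_norm// (lt_trans sh).
move: sI; rewrite in_itv/= => /andP[s0 sh].
have : 0 < s^-1 * dphi s.
  apply: Hd; last by rewrite /= gt_eqF.
  by rewrite /ball /= sub0r normrN gtr0_norm// (lt_trans sh).
rewrite pmulr_rgt0 ?invr_gt0// => ds.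
have hb : `|h| < e by rewrite gtr0_norm.
have := mx h hb.
by rewrite leNgt -subr_gt0 E subr0 mulr_gt0.
Qed.

Lemma realX (R : realType) (a : R) n : ((a ^+ n)%:C = a%:C ^+ n :> R[i])%C.
Proof. by elim: n => [|n IH] //; rewrite !exprS -IH rmorphM. Qed.

Lemma norm_ge0 (R : realType) (z : R[i]) (r : R) : 6 * (z * conjc z) = r%:C%C -> 0 <= r.
Proof.
case: z => a b [<- _] /=.
rewrite [leRHS](_ : _ = 6 * (a ^+ 2 + b ^+ 2)); last by ring.
by rewrite mulr_ge0// addr_ge0 ?sqr_ge0.
Qed.

(** The algebra of [conf_W] at a point where Z f = b Z w: z1, z2 are the first derivatives of w, A1,
    A2 the second derivatives of f and B1, B2 those of w. The Laplacian of f is replaced by that of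
    b w up to m, the Laplacian of s (f - b w), which is nonpositive at a maximum. *)
Lemma conf_W_at_critical (R : realType) (f V w b k g m s : R) (A1 A2 B1 B2 z1 z2 p q : R[i]) :
  (f%:C * V%:C = 2 * f%:C * ((A1 + q * (b%:C * z1)) + (A2 + p * (b%:C * z2)))
    + w%:C * (f%:C * f%:C) - 6 * ((b%:C * z1) * (b%:C * z2)))%C ->
  (B1 + q * z1) + (B2 + p * z2) = (k - w ^+ 2)%:C%C -> 6 * (z1 * z2) = g%:C%C ->
  s%:C%C * (A1 - b%:C%C * B1) + s%:C%C * (A2 - b%:C%C * B2) = m%:C%C -> 0 < f -> m <= 0 ->
  s * (V * f) <= s * (2 * f * b * (k - w ^+ 2) + w * f ^+ 2 - b ^+ 2 * g).
Proof.
move=> PW Lx Gx L f0 m0.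
have key : (s%:C * (V%:C * f%:C) = 2 * f%:C * m%:C + s%:C * (2 * f%:C * b%:C * (k - w ^+ 2)%:C +
    w%:C * f%:C ^+ 2 - b%:C ^+ 2 * g%:C))%C.
  by rewrite [(V%:C * _)%C]mulrC PW -Lx -Gx -L; ring.
have r2 : (2 : R[i]) = (2%:R : R)%:C%C by rewrite rmorph_nat.
move: key; rewrite r2 -!realX -?rmorphM -?rmorphB -?rmorphD => /(congr1 (@complex.Re R)) /= E.
have -> : s * (V * f) = 2 * f * m +
   s * (2 * f * b * (k - w ^+ 2) + w * f ^+ 2 - b ^+ 2 * g).
  by rewrite E; ring.
by rewrite gerDr mulr_ge0_le0// mulr_ge0// ltW.
Qed.

Section SecondOrder.
Context {R : realType} {V : normedModType R}.

Lemma local_max_derive (g : V -> R) (U : set V) x u : open U -> U x -> Ck 2 U g ->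
  (\forall y \near x, g y <= g x) -> 'D_u g x = 0 /\ 'D_u (fun y => 'D_u g y) x <= 0.
Proof.
move=> oU Ux g2 mx.
pose phi (s : R) := g (s *: u + x).
have lc : (s *: u + x) @[s --> (0 : R)] --> x.
  by have := @line_continuous R V x u 0; rewrite /continuous_at scale0r add0r.
have : \forall s \near (0 : R), U (s *: u + x) /\ g (s *: u + x) <= g x.
  have nP : nbhs x (fun y => U y /\ g y <= g x).
    by apply: filterI => //; exact: open_nbhs_nbhs.
  exact: (lc _ nP).
move=> /nbhs_ballP[e /= e0 He].
have Hb (s : R) : `|s| < e -> U (s *: u + x) /\ g (s *: u + x) <= g x.
  by move=> se; apply: He; rewrite /ball /= sub0r normrN.
have pd (s : R) : `|s| < e -> is_derive s 1 phi ('D_u g (s *: u + x)).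
  by move=> /Hb[Us _]; apply: is_derive_line; exact: Ck_derivable (CkS g2) Us.
have p0 : phi 0 = g x by rewrite /phi scale0r add0r.
have inb (s : R) : s \in `]- e, e[%R -> `|s| < e by rewrite in_itv /= ltr_norml.
have D0 : 'D_u g x = 0.
  have h0 : is_derive (0 : R) 1 phi 0.
    apply: (@derive1_at_max _ phi (- e) e 0).
    - by rewrite ltW// gtrN.
    - by move=> s /inb/pd[].
    - by rewrite in_itv /= oppr_lt0 e0.
    - by move=> s /inb/Hb[_]; rewrite p0.
  have z0 : `|0 : R| < e by rewrite normr0.
  have [_ h1] := pd 0 z0.
  by case: h0 => _ h2; rewrite scale0r add0r in h1; rewrite -h1 h2.
split=> //; rewrite leNgt; apply/negP => D2.
pose dphi (s : R) := 'D_u g (s *: u + x).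
have dd : is_derive (0 : R) 1 dphi ('D_u (fun y => 'D_u g y) x).
  have := @is_derive_line R V (fun y => 'D_u g y) x u 0; rewrite scale0r add0r; apply.
  exact: Ck_derivable (Ck_derive u g2) Ux.
have [ddd ddv] := dd.
have dphi0 : dphi 0 = 0 by rewrite /dphi scale0r add0r.
apply: (not_max_of_second_derivative e0 pd dphi0).
  have cv : (fun h : R => h^-1 *: ((dphi \o shift 0) (h *: 1) - dphi 0)) @ 0^' -->
      'D_u (fun y => 'D_u g y) x by rewrite -ddv.
  move/cvgr_gt : (cv) => /(_ _ D2); apply: filterS => h.
  by rewrite /= addr0 [_%:A]mulr1 dphi0 subr0.
by move=> s /Hb[_]; rewrite p0.
Qed.

End SecondOrder.

(** * Second derivatives at a critical point in a complex frame *)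

Section Critical.
Local Opaque fd.
Context {R : realType} (O : openset R 3) (g : smf O) (x : 'rV[R]_3).
Hypotheses (Ox : O x) (g0 : forall u, dC u g x = 0).

Lemma dC_fd_delta u v :
  dC u (fd v g) x = \sum_i (v 0 i)%:C%C * fval (fd u (fd (delta_mx 0 i) g)) x.
Proof.
have e1 : fval (fd u (fd v g)) x = dC u (fd v g) x by exact: fval_d.
have e2 : fval (fd v (fd u g)) x = dC v (fd u g) x by exact: fval_d.
apply: etrans (esym e1) _; rewrite (fd_swap v u g); apply: (etrans e2).
apply: etrans (dC_sum_delta v (@osetP _ _ O) Ox (smfP (fd u g))) _.
apply: eq_bigr => i _; congr (_ * _).
rewrite (fd_swap (delta_mx 0 i) u g); apply/esym; exact: fval_d.
Qed.

Lemma dC_vD u (Y : 'I_3 -> smf O) : dC u (vD Y g) x =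
  dC u (fd (mxRe (\row_i Y i x)) g) x + ii * dC u (fd (mxIm (\row_i Y i x)) g) x.
Proof.
have e1 : fval (fd u (vD Y g)) x = dC u (vD Y g) x by exact: fval_d.
apply: etrans (esym e1) _; have -> : fd u (vD Y g) = \sum_i (fd u (Y i) * fd (delta_mx 0 i) g +
    Y i * fd u (fd (delta_mx 0 i) g)).
  rewrite /vD.
  have fdsum m (h : 'I_m -> smf O) : fd u (\sum_i h i) = \sum_i fd u (h i).
    elim/big_ind2 : _ => [|a a' d d' <- <-|//]; last exact: fdD.
    by rewrite -{1}fcst0 fd_cst.
  by rewrite fdsum; apply: eq_bigr => i _; rewrite fdM.
rewrite (fval_sum Ox) !dC_fd_delta mulr_sumr -big_split; apply: eq_bigr => i _.
have e2 : fval (fd (delta_mx 0 i) g) x = 0 by rewrite -(g0 (delta_mx 0 i)); exact: fval_d.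
rewrite (fvalD Ox) (fvalM Ox) (fvalM Ox) e2 mulr0 add0r.
move: (fval (fd u _) x) => z; rewrite [RHS]/= mulrA -mulrDl; congr (_ * _).
by rewrite !mxE; case: (Y i x) => a a'; rewrite ReIm_ii.
Qed.

Lemma fval_nat n : fval (n%:R : smf O) x = n%:R.
Proof. by elim: n => [|n IH]; [exact: fval0|rewrite -!natr1 fvalD// IH fval1]. Qed.

Lemma fval_affine (a b : R[i]) (u v : smf O) :
  fval (fcst O a * (u - fcst O b * v)) x = a * (fval u x - b * fval v x).
Proof. by rewrite (fvalM Ox) (fvalB Ox) (fvalM Ox) !(fval_cst Ox). Qed.

Lemma fval_conf_W (e V a b p q u v w : smf O) (E V' U1 V1 W1 : R[i]) :
  e x = E -> V x = V' -> u x = U1 -> v x = V1 -> w x = W1 ->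
  e * V = 2 * e * ((a + q * u) + (b + p * v)) + w * (e * e) - 6 * (u * v) ->
  E * V' = 2 * E * ((a x + q x * U1) + (b x + p x * V1)) + W1 * (E * E) - 6 * (U1 * V1).
Proof.
move=> <- <- <- <- <- /(congr1 (fun g => fval g x)).
by rewrite !(fval_nat, fvalB Ox, fvalM Ox, fvalD Ox).
Qed.

Lemma fval_lap (a b p q u v : smf O) :
  fval ((a + q * u) + (b + p * v)) x = (a x + q x * u x) + (b x + p x * v x).
Proof. by rewrite !(fvalD Ox, fvalM Ox). Qed.

Lemma dC_fd_swap u v : dC v (fd u g) x = dC u (fd v g) x.
Proof.
have e1 : fval (fd v (fd u g)) x = dC v (fd u g) x by exact: fval_d.
by apply: etrans (esym e1) _; rewrite fd_swap; exact: fval_d.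
Qed.

(** At a critical point the derivatives of the coefficients of Y do not contribute, and the mixed
    terms of (Re Y - i Im Y)(Re Y + i Im Y) cancel by symmetry. *)
Lemma critical_laplacian (Y : 'I_3 -> smf O) : vD (cj Y) (vD Y g) x =
  dC (mxRe (\row_i Y i x)) (fd (mxRe (\row_i Y i x)) g) x +
  dC (mxIm (\row_i Y i x)) (fd (mxIm (\row_i Y i x)) g) x.
Proof.
apply: etrans (vD_cj_val Y (vD Y g) Ox) _.
rewrite (dC_vD (mxRe _)) (dC_vD (mxIm _)).
rewrite (dC_fd_swap (mxRe _) (mxIm _)).
move: (dC _ (fd _ g) x) (dC (mxIm _) (fd (mxIm _) g) x) (dC (mxRe _) (fd (mxRe _) g) x) => a b d.
by apply: (eq_comb (c := - b) (ii2 (R := R))); ring.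
Qed.

End Critical.

(** * The initial form and a second contact form near one point *)

Section Pair.
Context {R : realType} (X : CR3 R) (hat theta' : form1 X) (w W' f : X -> R).
Local Notation C := R[i].
Hypotheses (sph : spherical X) (hc : is_contact_form hat)
  (htf : vanishing_torsion hat) (htw : is_TW_curvature hat w).
Hypotheses (tc : is_contact_form theta') (ttw : is_TW_curvature theta' W').
Hypothesis fE : forall c x, img c x -> hat c x = f (param c x) *: theta' c x.

Lemma pair_frames c q k c6 : dom c q -> LC hat w q k c6 ->
  exists (U : openset R 3) (F Ft : cframe U), [/\ U (coord c q), good hat c F w,
    adapted theta' c Ft /\ hasW c Ft W',
    kapW (pshf_of F) (coord c q) = k%:C%C & c6W (pshf_of F) (coord c q) = c6%:C%C].
Proof.
move=> dq lc; have xc : img c (coord c q) by exists q.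
have [V1 [oV1 V1x _ H1]] := hat_frame sph hc htf htw xc.
have [V2 [oV2 V2x _ H2]] := tw_frame_ex tc ttw xc.
pose U := OpenSet (openI oV1 oV2).
have [F Fg] := H1 U (@subIsetl _ _ _); have [Ft [Fta FtW _]] := H2 U (@subIsetr _ _ _).
have Ux : U (coord c q) by [].
have kr := real_val Ux (fconj_kapW Fg); have cr := real_val Ux (fconj_c6W Fg).
have lc' : LC hat w q (complex.Re (kapW (pshf_of F) (coord c q)))
  (complex.Re (c6W (pshf_of F) (coord c q))) by exists c, U, F.
have [e1 e2] := LC_uniq sph hc htf htw lc lc'.
by exists U, F, Ft; split=> //; rewrite ?e1 ?e2.
Qed.

Section AtPoint.
Variables (c : chart X) (q : X) (k c6 : R) (U : openset R 3) (F Ft : cframe U).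
Local Notation x := (coord c q).
Hypotheses (dq : dom c q) (Ux : U x) (Fg : good hat c F w)
  (Fta : adapted theta' c Ft) (FtW : hasW c Ft W')
  (kE : kapW (pshf_of F) x = k%:C%C) (cE : c6W (pshf_of F) x = c6%:C%C).

Let Fad : adapted hat c F. Proof. by case: Fg. Qed.
Let FW : hasW c F w. Proof. by case: Fg. Qed.

(** The factor f as a ring element: hat = f theta' and theta'(T') = 1 give f = hat(T'). *)
Definition fel := con (cth F) (cT Ft).

Lemma fel_val y : U y -> fel y = (f (param c y))%:C%C.
Proof.
move=> Uy; apply: (cmp_f_val Fad Fta Uy) => i; have [yc _ _ _ _] := Fad Uy.
by rewrite fE// mxE.
Qed.

Lemma fel_l : fel = cmp_l F Ft * fconj (cmp_l F Ft).
Proof. exact: cmp_f hc Fad Fta. Qed.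

Lemma f_norm : (f q)%:C%C = cmp_l F Ft x * conjc (cmp_l F Ft x).
Proof. by rewrite -[q in LHS](coordK dq) -fel_val// fel_l fvalM// fval_conj. Qed.

Lemma f_gt0_at : 0 < f q.
Proof.
have := f_norm; have := cmp_li hc tc Fad Fta => /(congr1 (fun u => fval u x)).
rewrite fvalM// fval1//; case: (cmp_l F Ft x) => a b; set m := cmp_l Ft F x => lm.
have fab : f q = a * a + b * b -> 0 < f q.
  move=> ->; rewrite lt_neqAle addr_ge0 ?andbT -?expr2 ?sqr_ge0// eq_sym.
  rewrite paddr_eq0 ?sqr_ge0// !sqrf_eq0; apply/negP => /andP[/eqP a0 /eqP b0].
  move: lm; rewrite a0 b0 (_ : (0 +i* 0)%C = 0) // mul0r => /eqP.
  by rewrite eq_sym oner_eq0.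
by move=> [E _]; apply: fab; rewrite E; ring.
Qed.

Let ll := cmp_li hc tc Fad Fta.
Let llb : fconj (cmp_l F Ft) * fconj (cmp_l Ft F) = 1.
Proof. by rewrite -fconjM ll fconj1. Qed.

Lemma pair_W : fel * fW Ft = 2 * fel * ((vD (cj (cZ F)) (vD (cZ F) fel) + fpb F * vD (cZ F) fel)
   + (vD (cZ F) (vD (cj (cZ F)) fel) + fp F * vD (cj (cZ F)) fel))
  + fW F * (fel * fel) - 6 * (vD (cZ F) fel * vD (cj (cZ F)) fel).
Proof.
rewrite fel_l.
exact: (conf_W (fJJ (O := U)) (S := pshf_of F) (S' := pshf_of Ft) ll llb
  (cmp_vZ hc Fad Fta) (cmp_vZb hc Fad Fta) (cmp_vT F Ft)).
Qed.

Lemma wx : fW F x = (w q)%:C%C. Proof. by rewrite FW// coordK. Qed.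

Lemma lap_x : 2 * lapW (pshf_of F) x = (k - w q ^+ 2)%:C%C.
Proof.
have := kE; rewrite /kapW fvalD// !fvalM// /= wx => E.
have n2 : (2 : smf U) x = 2 by rewrite -[2 in LHS]/(1 + 1) fvalD// fval1.
rewrite n2 in E; rewrite rmorphB /= realX -E; ring.
Qed.

Lemma grad_x : 6 * (vD (cZ F) (fW F) x * vD (cj (cZ F)) (fW F) x) =
  (c6 + 3 * k * w q - w q ^+ 3)%:C%C.
Proof.
have nn n : (n%:R : smf U) x = n%:R.
  by elim: n => [|n IH]; [exact: fval0|rewrite -!natr1 fvalD// IH fval1].
have := cE; rewrite /c6W fvalD// fvalB// !fvalM// kE /= wx !nn => E.
rewrite rmorphB rmorphD /= realX !rmorphM /= -E; ring.
Qed.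

Lemma grad_ge0 : 0 <= c6 + 3 * k * w q - w q ^+ 3.
Proof.
have e : vD (cj (cZ F)) (fW F) x = conjc (vD (cZ F) (fW F) x).
  by rewrite -fval_conj// fconj_vD fconj_fW.
by have := grad_x; rewrite e; exact: norm_ge0.
Qed.

Section Extremum.
Variables (s b : R).
Hypothesis s0 : s != 0.
Hypothesis ext : \forall q' \near q, s * (f q' - b * w q') <= s * (f q - b * w q).

(** The real function s (f - b w) as a ring element; the sign of s lets one computation serve the
    maxima and the minima of f - b w. *)
Definition vel := fcst U s%:C%C * (fel - fcst U b%:C%C * fW F).

Lemma vel_val y : U y -> vel y = (s * (f (param c y) - b * w (param c y)))%:C%C.
Proof.
move=> Uy; rewrite fvalM// fvalB// fvalM// !fval_cst// fel_val// FW//.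
by rewrite rmorphM rmorphB rmorphM.
Qed.

Lemma vel_max : \forall y \near x, complex.Re (vel y) <= complex.Re (vel x).
Proof.
have n1 : \forall y \near x, s * (f (param c y) - b * w (param c y)) <=
    s * (f q - b * w q).
  have xc : img c x by exists q.
  have pc : param c y @[y --> x] --> param c x := param_continuous xc.
  rewrite (coordK dq) in pc.
  exact: (pc _ ext).
have n2 : \forall y \near x, U y by apply: open_nbhs_nbhs; split=> //; exact: osetP.
near=> y.
rewrite !vel_val//=; last by near: y.
by rewrite coordK//; near: y.
Unshelve. all: by end_near. Qed.

Lemma vel_d u : dC u vel x = 0.
Proof.
have [v1 v2] := smfP vel.
apply: complex_eq; [rewrite dC_Re|rewrite dC_Im].
  by have [] := local_max_derive u (@osetP _ _ U) Ux (v1 2) vel_max.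
rewrite (near_eq_derive (g := cst 0)) ?derive_cst//.
apply: (open_eq_near (@osetP _ _ U) Ux) => y; rewrite inE => Uy.
by rewrite vel_val.
Qed.

Lemma vel_dd u : exists2 m : R, dC u (fd u vel) x = m%:C%C & m <= 0.
Proof.
have [v1 v2] := smfP vel.
exists ('D_u (fun y => 'D_u (fun z => complex.Re (vel z)) y) x); last first.
  by have [] := local_max_derive u (@osetP _ _ U) Ux (v1 2) vel_max.
have -> : dC u (fd u vel) x = dC u (dC u vel) x.
  by apply: dC_eq (@osetP _ _ U) Ux _ => y; rewrite inE => Uy; rewrite fval_d.
apply: complex_eq; [by rewrite dC_Re|rewrite dC_Im].
have z y : U y -> complex.Im (dC u vel y) = 0.
  move=> Uy; rewrite dC_Im (near_eq_derive (g := cst 0)) ?derive_cst//.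
  apply: (open_eq_near (@osetP _ _ U) Uy) => y'; rewrite inE => Uy'.
  by rewrite vel_val.
rewrite (near_eq_derive (g := cst 0)) ?derive_cst//.
by apply: (open_eq_near (@osetP _ _ U) Ux) => y; rewrite inE => /z.
Qed.

Lemma vD_vel Y : vD Y vel x = 0.
Proof. by rewrite vD_val// !vel_d mulr0 addr0. Qed.

Lemma vel_lap : exists2 m : R,
  vD (cj (cZ F)) (vD (cZ F) vel) x + vD (cZ F) (vD (cj (cZ F)) vel) x = m%:C%C & m <= 0.
Proof.
set u := mxRe (\row_i cZ F i x); set v := mxIm (\row_i cZ F i x).
have [m1 e1 m10] := vel_dd u; have [m2 e2 m20] := vel_dd v.
exists (2 * (m1 + m2)); last by lra.
have Z1 : vD (cj (cZ F)) (vD (cZ F) vel) x = m1%:C%C + m2%:C%C.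
  by rewrite -e1 -e2; exact: critical_laplacian vel_d _.
have Z2 : vD (cZ F) (vD (cj (cZ F)) vel) x = m1%:C%C + m2%:C%C.
  have rv : fconj vel = vel.
    by apply: smf_eq => y Uy; rewrite fval_conj// vel_val// conjc_real.
  have e : vD (cZ F) (vD (cj (cZ F)) vel) = fconj (vD (cj (cZ F)) (vD (cZ F) vel)).
    by rewrite !fconj_vD cjK rv.
  by rewrite e fval_conj// Z1 rmorphD; congr (_ + _); exact: conjc_real.
by rewrite Z1 Z2 -!rmorphD; congr (_%:C%C); ring.
Qed.

Local Opaque fel vD.

(** The second derivative test is inserted in the curvature formula, and [lap_x] and [grad_x]
    replace the Laplacian and the gradient norm of w by polynomials in w, so that no derivative is
    left. *)
Lemma ext_ineq_at : s * (W' q * f q) <= s * (2 * f q * b * (k - w q ^+ 2) +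
  w q * f q ^+ 2 - b ^+ 2 * (c6 + 3 * k * w q - w q ^+ 3)).
Proof.
have [m mE m0] := vel_lap.
have f0 := f_gt0_at.
have fx : fel x = (f q)%:C%C by rewrite fel_val// coordK.
have W'x : fW Ft x = (W' q)%:C%C by rewrite FtW// coordK.
have EvD Y : vD Y vel = fcst U s%:C%C * (vD Y fel - fcst U b%:C%C * vD Y (fW F)).
  by rewrite /vel vDM vD_cst vDD vDN vDM vD_cst; ring.
have sC0 : s%:C%C != 0 :> C by rewrite eq_complex /= negb_and s0.
have Zf Y : vD Y fel x = b%:C%C * vD Y (fW F) x.
  have := vD_vel Y; rewrite EvD fvalM// fvalB// fvalM// !fval_cst// => /eqP.
  by rewrite mulf_eq0 (negPf sC0) subr_eq0 => /eqP.
have E2 Y Y' : vD Y (vD Y' vel) x = s%:C%C * (vD Y (vD Y' fel) x - b%:C%C * vD Y (vD Y' (fW F)) x).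
  by rewrite EvD vDM vD_cst vDD vDN vDM vD_cst !mul0r !add0r -(fval_affine Ux).
have PW := fval_conf_W Ux fx W'x (Zf (cZ F)) (Zf (cj (cZ F))) wx pair_W.
have L := etrans (esym (congr2 +%R (E2 (cj (cZ F)) (cZ F)) (E2 (cZ F) (cj (cZ F))))) mE.
apply: (conf_W_at_critical PW _ grad_x L f0 m0).
rewrite -lap_x -(fval_lap Ux) mulr_natl mulr2n; apply: etrans (fvalD Ux _ _).
by rewrite {2}(good_lapW_sym Fg) /lapW.
Qed.

End Extremum.
End AtPoint.

Lemma LC_ge0 q k c6 : LC hat w q k c6 -> 0 <= c6 + 3 * k * w q - w q ^+ 3.
Proof.
move=> lc; have [c dq] := dom_chart q.
have [U [F [Ft [Ux Fg [Fta FtW] kE cE]]]] := pair_frames dq lc.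
exact: grad_ge0 dq Ux Fg kE cE.
Qed.

Lemma ext_ineq q k c6 s b : LC hat w q k c6 -> s != 0 ->
  (\forall q' \near q, s * (f q' - b * w q') <= s * (f q - b * w q)) ->
  s * (W' q * f q) <= s * (2 * f q * b * (k - w q ^+ 2) +
  w q * f q ^+ 2 - b ^+ 2 * (c6 + 3 * k * w q - w q ^+ 3)).
Proof.
move=> lc s0 ext; have [c dq] := dom_chart q.
have [U [F [Ft [Ux Fg [Fta FtW] kE cE]]]] := pair_frames dq lc.
exact: (ext_ineq_at dq Ux Fg Fta FtW kE cE s0 ext).
Qed.

End Pair.

Section PairingAlgebra.
Context {R : realType}.
Local Notation C := R[i].
Implicit Types (a b u v : 'rV[C]_3).

Lemma pairingD a u v : pairing a (u + v) = pairing a u + pairing a v.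
Proof. by rewrite /pairing -big_split; apply: eq_bigr => i _; rewrite mxE mulrDr. Qed.

Lemma pairingZ a (k : C) u : pairing a (k *: u) = k * pairing a u.
Proof. by rewrite /pairing mulr_sumr; apply: eq_bigr => i _; rewrite mxE mulrCA. Qed.

Lemma ev2_wedge11 a b u v :
  ev2 (wedge11 a b) u v = pairing a u * pairing b v - pairing a v * pairing b u.
Proof.
rewrite /ev2 /pairing ![in RHS]big_distrlr /= -[X in _ - X]exchange_big -sumrB /=.
apply: eq_bigr => i _; rewrite -sumrB; apply: eq_bigr => j _; rewrite !mxE; ring.
Qed.

End PairingAlgebra.

(** * The Levi form and the derivative of w along contact vectors *)

Section Levi.
Context {R : realType} (X : CR3 R) (theta : form1 X).
Local Notation C := R[i].
Hypothesis tc : is_contact_form theta.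
Implicit Types (c : chart X).

Lemma levi_coef (v : 'rV[R]_3) (Z th1 : 'rV[C]_3) (v1 v1b : C) :
  pairing th1 Z = 1 -> pairing th1 (mxconj Z) = 0 -> cmx v = v1 *: mxconj Z + v1b *: Z ->
  v1b = pairing th1 (cmx v) /\ v1 = conjc (pairing th1 (cmx v)).
Proof.
move=> t1 t2 vE; have e1 : pairing th1 (cmx v) = v1b.
  by rewrite vE pairingD !pairingZ t1 t2 mulr0 mulr1 add0r.
split=> //; rewrite -pairing_conj mxconj_cmx vE pairingD !pairingZ.
by rewrite -[Z in X in _ + X]mxconjK !pairing_conj t1 t2 !rmorph0 rmorph1 mulr0 mulr1 addr0.
Qed.

Lemma levi_real c x v r : is_levi theta c x v v r -> exists T Z th1 v1,
  [/\ frame_at theta c x T Z th1 1, cmx v = conjc v1 *: mxconj Z + v1 *: Z &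
    r%:C%C = 2 * (v1 * conjc v1)].
Proof.
move=> [T [Z [th1 [v1 [v1b [u1 [u1b [fr vE uE rE]]]]]]]].
have [_ _ _ [t1 t2 _] _] := fr.
have [e1 e2] := levi_coef t1 t2 vE; have [e3 e4] := levi_coef t1 t2 uE.
exists T, Z, th1, (pairing th1 (cmx v)); split=> //; first by rewrite -e2 -e1.
by rewrite rE e1 e2 e3 e4; ring.
Qed.

Lemma levi_ge0 c x v r : is_levi theta c x v v r -> 0 <= r.
Proof.
move=> /levi_real[T [Z [th1 [v1 [_ _ rE]]]]].
have h : 6 * (v1 * conjc v1) = (r + r + r)%:C%C by rewrite !rmorphD /= rE; ring.
have := norm_ge0 h; lra.
Qed.

Lemma levi_exists W c x v : is_TW_curvature theta W -> img c x -> xi c x v ->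
  exists r, is_levi theta c x v v r.
Proof.
move=> ttw xc xv; have [V [T [Z [th1 [om [A [Vx lf _ _]]]]]]] := ttw c x xc.
have [_ _ _ _ fr] := lf; have fx := fr x Vx.
have full := frame_at_full (tc.2 _ _ xc) fx (cmx v).
have tv : pairing (theta c x) v = 0 by apply/((tc.2 _ _ xc).1 v).
rewrite pairing_cmx tv scale0r add0r in full.
set a := pairing (th1 x) (cmx v) in full.
have e : pairing (mxconj (th1 x)) (cmx v) = conjc a by rewrite -mxconj_cmx pairing_conj.
rewrite e in full.
exists (complex.Re (a * conjc a + a * conjc a)), (T x), (Z x), (th1 x), (conjc a), a, (conjc a), a.
split=> //; rewrite addrC//.
by case: a {full e} => p q; apply: complex_eq => /=; ring.
Qed.

End Levi.

Section Pair.
Context {R : realType} (X : CR3 R) (hat theta' : form1 X) (w W' f : X -> R).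
Local Notation C := R[i].
Hypotheses (sph : spherical X) (hc : is_contact_form hat)
  (htf : vanishing_torsion hat) (htw : is_TW_curvature hat w).
Hypotheses (tc : is_contact_form theta') (ttw : is_TW_curvature theta' W').
Hypothesis fE : forall c x, img c x -> hat c x = f (param c x) *: theta' c x.

Lemma cthE (theta : form1 X) c (O : openset R 3) (F : cframe O) x i j : adapted theta c F -> O x ->
  fval (dd (cth F) i j) x = (extd (theta c) x i j)%:C%C.
Proof.
move=> Fad Ox.
have E k l : fval (fd (delta_mx 0 k) (cth F l)) x = (pderiv k (fun y => theta c y 0 l) x)%:C%C.
  apply: (etrans (fval_d Ox _ _)).
  apply: etrans (_ : dC (delta_mx 0 k) (fun y => (theta c y 0 l)%:C%C) x = _).
    by apply: dC_eq (@osetP _ _ O) Ox _ => y; rewrite inE => Oy; have [_ ->] := Fad _ Oy.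
  apply: complex_eq; rewrite ?dC_Re ?dC_Im//=.
  by rewrite derive_cst.
by rewrite /dd (fvalB Ox) !E mxE rmorphB.
Qed.

(** By [eigen_Zb] the vector Z is a multiple a of the Z of F; as h = 1 in both frames, comparing d
    theta' on (Z, Zb) gives |a| = 1. *)
Lemma frame_at_phase c (O : openset R 3) (F : cframe O) x T Z th1 : adapted theta' c F -> O x ->
  frame_at theta' c x T Z th1 1 -> exists2 a, Z = a *: zrow F x & a * conjc a = 1.
Proof.
move=> Fad Ox [_ [ZR ZI] ZJ [t1 t2 _] dE].
have [xc thE _ _ _] := Fad _ Ox.
have rE : \row_i fval (cth F i) x = cmx (theta' c x) by apply/rowP => i; rewrite !mxE thE.
have tZ : pairing (\row_i fval (cth F i) x) Z = 0.
  by rewrite rE; apply: pairing_Re_Im; apply/((tc.2 _ _ xc).1 _).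
have bZ := eigen_Zb Fad Ox tZ ZJ.
have := full_val F Z Ox; rewrite tZ bZ !scale0r addr0 add0r.
set a := pairing _ Z => Za; exists a => //.
have wE : wedge11 (\row_i fval (cth1 F i) x) (mxconj (\row_i fval (cth1 F i) x)) =
    wedge11 th1 (mxconj th1).
  apply/matrixP => i j; have := congr1 (fun M : 'M[C]_3 => M i j) dE.
  rewrite mulr1 [in LHS]mxE [in RHS]mxE -(cthE i j Fad Ox) cdth (fvalM Ox) (fval_cst Ox).
  rewrite (wed_val _ _ _ _ Ox) (row_cj _ Ox).
  by move=> h; apply: (mulfI _ h); rewrite eq_complex /= oner_eq0 andbF.
have := congr1 (fun M => ev2 M Z (mxconj Z)) wE; rewrite !ev2_wedge11 t1 t2.
rewrite !pairing_conj t1 bZ mulr0 mul0r !subr0 => ->.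
by rewrite mul1r rmorph1.
Qed.

(** With y = v a l z the hypotheses give D = 2 Re y and r f0 g = 12 |y|^2; the factor 1/3 is
    4/12. *)
Lemma real_part_sq_le (D r g f0 : R) (v a l z : C) :
  D%:C%C = v * (a * (l * z)) + conjc (v * (a * (l * z))) -> a * conjc a = 1 ->
  f0%:C%C = l * conjc l -> 6 * (z * conjc z) = g%:C%C -> r%:C%C = 2 * (v * conjc v) ->
  D ^+ 2 <= r * f0 * g / 3.
Proof.
move=> DE aE fE' gE rE; set y := v * (a * (l * z)) in DE.
have : (r * f0 * g)%:C%C = 12 * (y * conjc y).
  rewrite !rmorphM /= rE fE' -gE /y.
  by rewrite -[LHS]mulr1 -[X in _ * X = _]aE; ring.
case: y DE => p q [DE _] [rfE _].
rewrite rfE DE ler_pdivlMr//; have := sqr_ge0 q; nra.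
Qed.

(** Cauchy-Schwarz for the differential of w: up to a phase the field Z of theta' is l times that of
    the initial form, with |l|^2 = f, and 6 |w_1|^2 is the cubic in w. *)
Lemma levi_ineq c q k c6 v r : dom c q -> LC hat w q k c6 ->
  is_levi theta' c (coord c q) v v r ->
  ('D_v (w \o param c) (coord c q)) ^+ 2 <= r * f q * (c6 + 3 * k * w q - w q ^+ 3) / 3.
Proof.
move=> dq lc lev; have [U [F [Ft [Ux Fg [Fta FtW] kE cE]]]] := pair_frames sph hc htf htw tc ttw dq lc.
have [T [Z [th1 [v1 [fr vE rE]]]]] := levi_real lev.
have [a Za aa] := frame_at_phase Fta Ux fr.
have [Fad FW _ _ _] := Fg.
set x := coord c q in lev fr Za Ux *.
set l := fval (cmp_l F Ft) x.
have fl : (f q)%:C%C = l * conjc l by have := f_norm hc fE dq Ux Fg Fta.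
have Zt : zrow Ft x = l *: zrow F x.
  apply/rowP => i; have := congr1 (fun g => fval (g i) x) (cmp_Z hc Fad Fta).
  by rewrite (fvalM Ux) !mxE.
set z := fval (vD (cZ F) (fW F)) x.
have zb : fval (vD (cj (cZ F)) (fW F)) x = conjc z.
  by rewrite -(fval_conj Ux) fconj_vD fconj_fW.
have gx : 6 * (z * conjc z) = (c6 + 3 * k * w q - w q ^+ 3)%:C%C.
  by rewrite -zb; exact: grad_x dq Ux Fg kE cE.
apply: (real_part_sq_le (v := v1) (a := a) (l := l) (z := z)) => //.
pose d := \row_i dC (delta_mx 0 i) (fW F) x.
have vDd Y : fval (vD Y (fW F)) x = pairing d (\row_i fval (Y i) x).
  rewrite /vD (fval_sum Ux) /pairing; apply: eq_bigr => i _.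
  by rewrite (fvalM Ux) (fval_d Ux) mulrC; congr (_ * _); rewrite [RHS]mxE.
have -> : ('D_v (w \o param c) x)%:C%C = dC v (fW F) x.
  apply: etrans (_ : dC v (fun y => ((w \o param c) y)%:C%C) x = _).
    by apply: complex_eq; rewrite ?dC_Re ?dC_Im//= derive_cst.
  by apply: dC_eq (@osetP _ _ U) Ux _ => y; rewrite inE => Uy; rewrite FW.
rewrite (dC_sum_delta v (@osetP _ _ U) Ux (smfP _)).
have -> : \sum_i (v 0 i)%:C%C * dC (delta_mx 0 i) (fW F) x = pairing d (cmx v).
  by rewrite /pairing; apply: eq_bigr => i _; rewrite mulrC; congr (_ * _); rewrite [RHS]mxE.
have e1 : pairing d (zrow F x) = z by rewrite /z vDd.
have e2 : pairing d (mxconj (zrow F x)) = conjc z by rewrite -zb vDd row_cj.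
rewrite vE Za Zt pairingD !pairingZ e1.
have -> : mxconj (a *: (l *: zrow F x)) = (conjc a * conjc l) *: mxconj (zrow F x).
  by apply/rowP => i; rewrite !mxE !rmorphM mulrA.
by rewrite pairingZ e2 !rmorphM; ring.
Qed.

End Pair.

(** * The curvature of the initial form at its extrema *)

Section Critical.
Context {R : realType} (X : CR3 R) (hat : form1 X) (w : X -> R).
Hypotheses (sph : spherical X) (hc : is_contact_form hat)
  (htf : vanishing_torsion hat) (htw : is_TW_curvature hat w).

Lemma w_smooth c q : dom c q ->
  exists U, [/\ open U, U (coord c q), U `<=` img c & smooth_open U (w \o param c)].
Proof.
move=> dq; have [k [c6 lc]] := LC_exists sph hc htf htw q.
have [U [F [Ft [Ux Fg _ _ _]]]] := pair_frames sph hc htf htw hc htw dq lc.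
have [Fad FW _ _ _] := Fg.
have [s1 _] := smfP (fW F).
exists U; split=> //; [exact: osetP|by move=> y /Fad[]|].
move=> n; apply: Ck_ext (@osetP _ _ U) _ (s1 n) => y; rewrite inE => Uy.
by rewrite (FW _ Uy).
Qed.

(** [ext_ineq] for theta' = hat and f = 1. An extremum of w is one of 1 - b w for every b of the
    proper sign, and [crit_max] and [crit_min] exploit this free parameter. *)
Lemma crit_ineq q k c6 s b : LC hat w q k c6 -> s != 0 ->
  (\forall q' \near q, s * (- b * w q') <= s * (- b * w q)) ->
  0 <= s * (2 * b * (k - w q ^+ 2) - b ^+ 2 * (c6 + 3 * k * w q - w q ^+ 3)).
Proof.
move=> lc s0 ext.
have fE c x : img c x -> hat c x = (fun=> 1) (param c x) *: hat c x by rewrite scale1r.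
have ext' : \forall q' \near q,
    s * ((fun=> 1) q' - b * w q') <= s * ((fun=> 1) q - b * w q).
  apply: filterS ext => q'; rewrite !mulrDr !mulr1 lerD2l.
  by rewrite !mulNr !mulrN.
have := ext_ineq sph hc htf htw hc htw fE lc s0 ext'.
rewrite /= expr1n !mulr1 -subr_ge0 -mulrBr.
by congr (0 <= s * _); ring.
Qed.

(** The inequality b^2 g <= 2 b h for all b >= 0, where g is the cubic at q, forces g = 0, which
    says that the gradient of w vanishes at q. *)
Lemma crit_max q k c6 : LC hat w q k c6 -> (\forall q' \near q, w q' <= w q) ->
  c6 + 3 * k * w q - w q ^+ 3 = 0 /\ k <= w q ^+ 2.
Proof.
move=> lc mx.
have g0 := LC_ge0 sph hc htf htw hc htw lc.
have E b : 0 <= b -> b ^+ 2 * (c6 + 3 * k * w q - w q ^+ 3) <= 2 * b * (w q ^+ 2 - k).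
  move=> b0; have := @crit_ineq q k c6 1 (- b) lc (oner_neq0 _).
  have h : \forall q' \near q, 1 * (- - b * w q') <= 1 * (- - b * w q).
    by apply: filterS mx => q' h; rewrite !mul1r opprK ler_wpM2l.
  by move=> /(_ h); lra.
move: g0 E; set g := c6 + _ - _; set h := w q ^+ 2 - k => g0 E.
have h0 : 0 <= h by have := E 1 ler01; rewrite expr1n; lra.
split; last by rewrite -subr_ge0.
apply/le_anti; rewrite g0 andbT leNgt; apply/negP => gp.
(* For this b the inequality would read (2 h + 1)^2 / g <= 2 h (2 h + 1) / g. *)
have bp : 0 <= (2 * h + 1) / g by rewrite divr_ge0// addr_ge0// mulr_ge0.
have := E _ bp; rewrite expr2 -!mulrA mulVf ?gt_eqF// mulr1.
set z := g^-1; have zp : 0 < z by rewrite invr_gt0.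
have -> : (2 * h + 1) * (z * (2 * h + 1)) = ((2 * h + 1) * z) * (2 * h + 1) by ring.
have -> : 2 * ((2 * h + 1) * (z * h)) = ((2 * h + 1) * z) * (2 * h) by ring.
by rewrite ler_pM2l ?mulr_gt0// ?ltr_wpDl ?mulr_ge0// gerDl ler10.
Qed.

Lemma crit_min q k c6 : LC hat w q k c6 -> (\forall q' \near q, w q <= w q') ->
  c6 + 3 * k * w q - w q ^+ 3 = 0 /\ w q ^+ 2 <= k.
Proof.
move=> lc mx.
have g0 := LC_ge0 sph hc htf htw hc htw lc.
have E b : 0 <= b -> b ^+ 2 * (c6 + 3 * k * w q - w q ^+ 3) <= 2 * b * (k - w q ^+ 2).
  move=> b0; have := @crit_ineq q k c6 1 b lc (oner_neq0 _).
  have h : \forall q' \near q, 1 * (- b * w q') <= 1 * (- b * w q).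
    by apply: filterS mx => q' h; rewrite !mul1r !mulNr lerN2 ler_wpM2l.
  by move=> /(_ h); lra.
move: g0 E; set g := c6 + _ - _; set h := k - w q ^+ 2 => g0 E.
have h0 : 0 <= h by have := E 1 ler01; rewrite expr1n; lra.
split; last by rewrite -subr_ge0.
apply/le_anti; rewrite g0 andbT leNgt; apply/negP => gp.
have bp : 0 <= (2 * h + 1) / g by rewrite divr_ge0// addr_ge0// mulr_ge0.
have := E _ bp; rewrite expr2 -!mulrA mulVf ?gt_eqF// mulr1.
set z := g^-1; have zp : 0 < z by rewrite invr_gt0.
have -> : (2 * h + 1) * (z * (2 * h + 1)) = ((2 * h + 1) * z) * (2 * h + 1) by ring.
have -> : 2 * ((2 * h + 1) * (z * h)) = ((2 * h + 1) * z) * (2 * h) by ring.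
by rewrite ler_pM2l ?mulr_gt0// ?ltr_wpDl ?mulr_ge0// gerDl ler10.
Qed.

End Critical.

(** * The cubic differential equation *)

Section RealCalculus.
Context {R : realType}.
Implicit Types (f df : R -> R) (a b : R).

Lemma is_derive_continuous_within f df a b :
  (forall x : R, x \in `[a, b] -> is_derive x 1 f (df x)) -> {within `[a, b], continuous f}.
Proof.
by move=> H; apply: derivable_within_continuous => x xab; have [] := H x xab.
Qed.

Lemma derive_gt0_incr f df a b :
  (forall x : R, x \in `[a, b] -> is_derive x 1 f (df x)) ->
  (forall x : R, x \in `[a, b] -> 0 < df x) -> a < b -> f a < f b.
Proof.
move=> H P ab; have s : {subset `]a, b[ <= `[a, b]} by apply: subset_itvW.
have [x xab E] := MVT ab (fun x h => H x (s x h)) (is_derive_continuous_within H).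
by rewrite -subr_gt0 E mulr_gt0 ?subr_gt0// P// s.
Qed.

Lemma derive_ge0_ndecr f df a b :
  (forall x : R, x \in `[a, b] -> is_derive x 1 f (df x)) ->
  (forall x : R, x \in `[a, b] -> 0 <= df x) -> a <= b -> f a <= f b.
Proof.
move=> H P; rewrite le_eqVlt => /predU1P[->//|ab].
have s : {subset `]a, b[ <= `[a, b]} by apply: subset_itvW.
have [x xab E] := MVT ab (fun x h => H x (s x h)) (is_derive_continuous_within H).
by rewrite -subr_ge0 E mulr_ge0 ?subr_ge0 ?P ?s// ltW.
Qed.

(** The solution of y' = 1 / h(y) is the inverse function of a primitive F of h, with time shifted
    by F y0. *)
Lemma separable_ode (h : R -> R) a y0 y1 b : a < y0 -> y0 < y1 -> y1 < b ->
  (forall y, a < y < b -> {for y, continuous h} /\ 0 < h y) ->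
  exists (T : R) (g : R -> R), [/\ 0 < T, g 0 = y0, g T = y1 &
    forall t, 0 <= t <= T -> y0 <= g t <= y1 /\ is_derive t 1 g (h (g t))^-1].
Proof.
move=> ay y01 yb H.
(* A margin around [y0, y1] inside ]a, b[, so that F is differentiable on both sides of y0 and
   y1. *)
pose a' := (a + y0) / 2; pose b' := (y1 + b) / 2.
have a1 : a < a' by rewrite /a'; lra.
have a2 : a' < y0 by rewrite /a'; lra.
have b1 : b' < b by rewrite /b'; lra.
have b2 : y1 < b' by rewrite /b'; lra.
have ab' : a' < b' by lra.
have hc : {within `[a', b'], continuous h}.
  apply: continuous_in_subspaceT => y; rewrite inE /= in_itv /= => /andP[u1 u2].
  by apply: (H y _).1; lra.
have hi : (@lebesgue_measure R).-integrable `[a', b'] (EFin \o h).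
  by apply: continuous_compact_integrable => //; exact: segment_compact.
pose F (y : R) := (\int[@lebesgue_measure R]_(t in [set` `[a', y]]) (h t))%R.
have dF (y : R) : a' < y < b' -> is_derive y 1 F (h y).
  move=> /andP[u1 u2].
  have [d1 d2] := @continuous_FTC1_closed R h a' y b' u2 hi u1 (H y ltac:(lra)).1.
  by rewrite derive1E in d2; exact: DeriveDef d1 d2.
have Finc u v : a' < u -> v < b' -> u < v -> F u < F v.
  move=> u1 v1 uv; apply: (@derive_gt0_incr F h u v) => // x; rewrite in_itv /= => xu.
    by apply: dF; lra.
  by apply: (H x _).2; lra.
have Finj u v : a' < u < b' -> a' < v < b' -> F u = F v -> u = v.
  move=> uu vv E; apply/eqP; rewrite eq_le !leNgt; apply/andP; split; apply/negP => lt.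
    by have := Finc v u ltac:(lra) ltac:(lra) lt; rewrite E ltxx.
  by have := Finc u v ltac:(lra) ltac:(lra) lt; rewrite E ltxx.
pose g (s : R) := xget 0 [set y | a' < y < b' /\ F y = s].
have gK y : a' < y < b' -> g (F y) = y.
  move=> yy; rewrite /g; case: xgetP => [z _ [zz E]|/(_ y)[]]; last by split.
  exact: Finj zz yy E.
have nI (y : R) : a' < y < b' -> \forall z \near y, a' < z < b'.
  move=> /andP[u1 u2]; near=> z; apply/andP; split; near: z.
    exact: lt_nbhsr.
  exact: lt_nbhsl.
have dg (y : R) : a' < y < b' -> is_derive (F y) 1 g (h y)^-1.
  move=> yy; apply: is_derive_inverse (dF y yy) _.
  - by apply: filterS (nI y yy) => z; exact: gK.
  - apply: filterS (nI y yy) => z zz; apply: differentiable_continuous.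
    by apply/derivable1_diffP; have [] := dF z zz.
  - by rewrite gt_eqF//; apply: (H y _).2; lra.
have yy0 : a' < y0 < b' by lra.
have yy1 : a' < y1 < b' by lra.
exists (F y1 - F y0), (fun t => g (F y0 + t)); split.
- by rewrite subr_gt0; apply: Finc => //; lra.
- by rewrite addr0 gK.
- by rewrite addrC subrK gK.
move=> t /andP[t0 t1].
have [y yI Fy] : exists2 y, y \in `[y0, y1] & F y = F y0 + t.
  apply: IVT; first exact: ltW.
    apply: (@is_derive_continuous_within F h) => x; rewrite in_itv /= => xx.
    by apply: dF; lra.
  have e := Finc y0 y1 ltac:(lra) ltac:(lra) y01.
  by rewrite (min_idPl (ltW e)) (max_idPr (ltW e)); lra.
move: yI; rewrite in_itv /= => yI; have yy : a' < y < b' by lra.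
rewrite -Fy gK//; split=> //.
have dd := dg y yy; rewrite Fy in dd.
have ds : is_derive t 1 (fun t => F y0 + t) 1.
  by rewrite -[X in is_derive _ _ _ X]add0r; apply: is_deriveD.
by have := @is_derive1_comp R g (fun t => F y0 + t) t _ _ dd ds; rewrite mulr1.
Unshelve. all: by end_near. Qed.

End RealCalculus.

(** * Explicit solution of the ODE for alpha and beta *)

Section CubicODE.
Context {R : realType} (w1 w2 : R).
Hypotheses (w2_gt0 : 0 < w2) (w21 : w2 <= w1).

Let k := (w1 ^+ 2 + w1 * w2 + w2 ^+ 2) / 3.
Let c6 := - (w1 * w2 * (w1 + w2)).
(** For y = beta / alpha the conservation law alpha^3 - 3 k alpha beta^2 + c6 beta^3 = 1 reads
    alpha^3 P(y) = 1, and the ODE gives y' = 2 / alpha^2. Hence alpha = A(y) with A = P^(-1/3), and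
    a single quadrature is left. *)
Let P (y : R) := (1 + w1 * y) * (1 + w2 * y) * (1 - (w1 + w2) * y).

Lemma cubicE y : P y = 1 - 3 * k * y ^+ 2 + c6 * y ^+ 3.
Proof. by rewrite /P /k /c6; field. Qed.

(** The zeros of P are - 1 / w1, - 1 / w2 and 1 / (w1 + w2). The left bound is a convenient negative
    number above the first two; it puts the initial value 0 inside an open interval. *)
Lemma cubic_gt0 y : - (2 * w1)^-1 < y < (w1 + w2)^-1 -> 0 < P y.
Proof.
move=> /andP[y1 y2]; have w1_gt0 : 0 < w1 by apply: lt_le_trans w21.
have h1 : y * (w1 + w2) < 1 by rewrite -ltr_pdivlMr ?div1r// addr_gt0.
have h2 : - 1 < y * (2 * w1).
  by rewrite -ltr_pdivrMr ?mulr_gt0// mulNr div1r.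
rewrite /P !mulr_gt0//; [nra| |lra].
have [y0|y0] := leP 0 y; first by rewrite ltr_wpDr// mulr_ge0// ltW.
have : 0 <= (w1 - w2) * - y by rewrite mulr_ge0 ?subr_ge0// oppr_ge0 ltW.
lra.
Qed.

Lemma is_derive_cubic (y : R) : is_derive y 1 P (- 6 * k * y + 3 * c6 * y ^+ 2).
Proof.
have -> : P = (fun y => 1 - (3 * k) * y ^+ 2 + c6 * y ^+ 3) by apply/funext => z; exact: cubicE.
by apply: is_derive_eq; rewrite /GRing.scale /=; ring.
Qed.

Let A (y : R) := expR (- (ln (P y) / 3)).

Lemma A_gt0 y : 0 < A y. Proof. exact: expR_gt0. Qed.

Lemma A_cube y : 0 < P y -> A y ^+ 3 * P y = 1.
Proof.
move=> P0; rewrite /A -expRM_natl -[X in _ * X](lnK P0) -expRD.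
by rewrite -[RHS]expR0; congr expR; field.
Qed.

Lemma is_derive_A (y : R) : 0 < P y ->
  is_derive y 1 A (- A y ^+ 4 * (- 6 * k * y + 3 * c6 * y ^+ 2) / 3).
Proof.
move=> P0; have dP := is_derive_cubic y.
have dl : is_derive y 1 (fun y => ln (P y)) ((P y)^-1 * (- 6 * k * y + 3 * c6 * y ^+ 2)).
  exact: (is_derive1_comp (is_derive1_ln P0) dP).
have dm : is_derive y 1 (fun y => - (ln (P y) / 3))
    (- ((P y)^-1 * (- 6 * k * y + 3 * c6 * y ^+ 2) / 3)).
  by apply: is_derive_eq; rewrite /GRing.scale /=; ring.
apply: is_derive_eq (is_derive1_comp (is_derive_expR _) dm) _.
have Pn : P y != 0 by rewrite gt_eqF.
have <- : A y ^+ 3 = (P y)^-1 by apply: (mulIf Pn); rewrite A_cube// mulVf.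
by rewrite -/(A y); ring.
Qed.

Lemma A_unbounded (B : R) : exists2 y, 0 < y < (w1 + w2)^-1 & B < A y.
Proof.
have w1_gt0 : 0 < w1 by apply: lt_le_trans w21.
pose B' := `|B| + 1; have B'0 : 1 <= B' by rewrite lerDr.
have BB : B < B' by rewrite (le_lt_trans (ler_norm _))// ltrDl.
(* With (w1 + w2) y = 1 - e one has P y <= 4 e, so that P y B'^3 <= 1/2. *)
pose e := (8 * B' ^+ 3)^-1.
have B3 : 1 <= B' ^+ 3 by rewrite exprn_ege1.
have e0 : 0 < e by rewrite invr_gt0 mulr_gt0// (lt_le_trans _ B3).
have e1 : e * (8 * B' ^+ 3) = 1 by rewrite mulVf// gt_eqF// mulr_gt0// (lt_le_trans _ B3).
have e2 : e < 1 by nra.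
pose s := w1 + w2; have s0 : 0 < s by rewrite addr_gt0.
pose y := (1 - e) / s.
have sy : s * y = 1 - e by rewrite mulrC divfK// gt_eqF.
have y0 : 0 < y by rewrite divr_gt0// subr_gt0.
have y1 : y < s^-1 by rewrite -[s^-1]mul1r ltr_pM2r ?invr_gt0//; lra.
exists y; first by rewrite y0.
have w1y : w1 * y <= 1.
  have : w1 * y <= s * y by rewrite ler_pM2r// lerDl ltW.
  lra.
have w2y : w2 * y <= 1 by rewrite (le_trans _ w1y)// ler_pM2r.
have w1p : 0 < w1 * y by rewrite mulr_gt0.
have w2p : 0 < w2 * y by rewrite mulr_gt0.
have Pe : P y = (1 + w1 * y) * (1 + w2 * y) * e by rewrite /P -/s sy; ring.
have m4 : (1 + w1 * y) * (1 + w2 * y) <= 4 by nra.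
have P0 : 0 < P y by rewrite Pe !mulr_gt0//; lra.
have PB : P y * B' ^+ 3 < 1.
  have : P y * B' ^+ 3 <= 4 * (e * B' ^+ 3).
    rewrite Pe -mulrA ler_pM2r// mulr_gt0// (lt_le_trans _ B3)//.
  have : 8 * (e * B' ^+ 3) = 1 by rewrite -[RHS]e1; ring.
  lra.
have : B' ^+ 3 < A y ^+ 3.
  rewrite -(ltr_pM2r P0) A_cube// mulrC; exact: PB.
rewrite ltr_pXn2r ?nnegrE// ?(ltW (A_gt0 _)) ?(le_trans _ B'0)//.
exact: (lt_trans BB).
Qed.

(** B < al T means that the solution is followed as close to its blow-up as desired; [flow_solution]
    plays this against a bound on the conformal factor. *)
Lemma cubic_ode (B : R) : exists (T : R) (al be : R -> R), [/\ 0 < T, al 0 = 1, be 0 = 0, B < al T &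
  forall t : R, 0 <= t <= T -> [/\ 0 < al t, 0 <= be t,
    al t ^+ 3 - 3 * k * al t * be t ^+ 2 + c6 * be t ^+ 3 = 1,
    is_derive t 1 al (4 * k * al t * be t - 2 * c6 * be t ^+ 2) &
    is_derive t 1 be (2 * al t ^+ 2 - 2 * k * be t ^+ 2)]].
Proof.
have w1_gt0 : 0 < w1 by apply: lt_le_trans w21.
have [y1 /andP[y10 y11] Ay] := A_unbounded B.
have ay : - (2 * w1)^-1 < 0 :> R by rewrite oppr_lt0 invr_gt0 mulr_gt0.
have [|T [r [T0 r0 rT H]]] := separable_ode (h := fun y => A y ^+ 2 / 2) ay y10 y11.
  move=> y /cubic_gt0 P0; split; last by rewrite divr_gt0// exprn_gt0// A_gt0.
  have cA : {for y, continuous A}.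
    by apply: differentiable_continuous; apply/derivable1_diffP; have [] := is_derive_A P0.
  by apply: continuousM; [apply: continuousM|exact: cst_continuous].
exists T, (A \o r), (fun t => A (r t) * r t); split=> //.
- by rewrite /= r0 /A /P !mulr0 addr0 subr0 !mulr1 ln1 mul0r oppr0 expR0.
- by rewrite r0 mulr0.
- by rewrite /= rT.
move=> t tT; have [/andP[h1 h2] dr] := H t tT.
have P0 : 0 < P (r t) by apply: cubic_gt0; rewrite (lt_le_trans ay h1) (le_lt_trans h2).
have A0 := A_gt0 (r t); have A3 := A_cube P0; rewrite cubicE in A3.
have dA := is_derive_A P0.
have An : A (r t) != 0 by rewrite gt_eqF.
have da : is_derive t 1 (A \o r) (4 * k * A (r t) * (A (r t) * r t) - 2 * c6 * (A (r t) * r t) ^+ 2).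
  apply: is_derive_eq (is_derive1_comp dA dr) _.
  by field.
split=> //.
- by rewrite mulr_ge0// ltW.
- by rewrite -[RHS]A3 /=; ring.
have dn : is_derive t 1 ((A \o r) * r) (A (r t) *: (A (r t) ^+ 2 / 2)^-1 + r t *:
  (4 * k * A (r t) * (A (r t) * r t) - 2 * c6 * (A (r t) * r t) ^+ 2)) by exact: is_deriveM.
apply: is_derive_eq dn _; rewrite /GRing.scale /=.
have -> : A (r t) * (A (r t) ^+ 2 / 2)^-1 = 2 * (A (r t) ^+ 3 *
    (1 - 3 * k * r t ^+ 2 + c6 * r t ^+ 3)) / A (r t) by rewrite A3; field.
by field.
Qed.

End CubicODE.

(** * The curvature formula and the Harnack quantity *)

Section CurvatureFormula.
Context {R : realType}.
Implicit Types (a b w : R).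

Definition flow_factor a b w := a + b * w.
(** The product f W' for f = a + b w: the value of 2 f b (k - w^2) + w f^2 - b^2 (c6 + 3 k w - w^3)
    once the terms in w^2 and w^3 have cancelled. *)
Definition flow_num (k c6 : R) a b w := 2 * a * b * k - b ^+ 2 * c6 + w * (a ^+ 2 - b ^+ 2 * k).
Definition flow_curv (k c6 : R) a b w := flow_num k c6 a b w / flow_factor a b w.
(** The analogue of k in which w1 and w2 are replaced by their evolved values, as [flow_kapE]
    shows. *)
Definition flow_kap (k c6 : R) a b := k * a ^+ 2 - c6 * (a * b) + k ^+ 2 * b ^+ 2.

(** [flow_curv] is a Moebius function of w whose determinant is the conserved cubic in a and b,
    equal to 1. *)
Lemma flow_curvB (k c6 : R) a b (w w' : R) : a ^+ 3 - 3 * k * a * b ^+ 2 + c6 * b ^+ 3 = 1 ->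
  flow_factor a b w != 0 -> flow_factor a b w' != 0 ->
  flow_curv k c6 a b w - flow_curv k c6 a b w' =
  (w - w') / (flow_factor a b w * flow_factor a b w').
Proof.
move=> D f0 f0'; rewrite -[w - w' in RHS]mulr1 -D /flow_curv /flow_num.
by move: f0 f0'; rewrite /flow_factor => f0 f0'; field; rewrite f0 f0'.
Qed.

(** * The Harnack quantity at a fixed time *)

Section Roots.
Variables (w1 w2 a b : R).
Hypotheses (w2_gt0 : 0 < w2) (w21 : w2 <= w1) (a0 : 0 < a) (b0 : 0 <= b).
Let k := (w1 ^+ 2 + w1 * w2 + w2 ^+ 2) / 3.
Let c6 := - (w1 * w2 * (w1 + w2)).
Hypothesis D : a ^+ 3 - 3 * k * a * b ^+ 2 + c6 * b ^+ 3 = 1.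
Local Notation f := (flow_factor a b).
Local Notation E := (flow_curv k c6 a b).

Lemma flow_factor_gt0 w : w2 <= w -> 0 < f w.
Proof. by move=> h; rewrite /flow_factor ltr_wpDr// mulr_ge0// (le_trans _ h)// ltW. Qed.

Lemma flow_curv_mono (w w' : R) : w2 <= w' -> w' <= w -> E w' <= E w.
Proof.
move=> h1 h2; have f1 := flow_factor_gt0 h1; have f2 := flow_factor_gt0 (le_trans h1 h2).
rewrite -subr_ge0 flow_curvB// ?gt_eqF//.
by rewrite divr_ge0// ?subr_ge0// ltW// mulr_gt0.
Qed.

Lemma flow_curv_gt0 w : w2 <= w -> 0 < E w.
Proof.
move=> h; apply: lt_le_trans (flow_curv_mono (lexx _) h).
have w1_gt0 : 0 < w1 by apply: lt_le_trans w21.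
rewrite divr_gt0 ?flow_factor_gt0//.
have -> : flow_num k c6 a b w2 = 2 * k * (a * b) + w2 * a ^+ 2 +
    b ^+ 2 * (w2 * (2 * w1 ^+ 2 + 2 * w1 * w2 - w2 ^+ 2) / 3).
  by rewrite /flow_num /c6 /k; field.
have k0 : 0 < k by rewrite divr_gt0// !addr_gt0 ?exprn_gt0 ?mulr_gt0.
have g1 : 0 <= 2 * k * (a * b).
  by apply: mulr_ge0; [apply: mulr_ge0 => //; exact: ltW|apply: mulr_ge0 => //; exact: ltW].
have g2 : 0 < w2 * a ^+ 2 by rewrite mulr_gt0// exprn_gt0.
have g3 : 0 <= 2 * w1 ^+ 2 + 2 * w1 * w2 - w2 ^+ 2.
  have h1 : 0 <= (w1 - w2) * (w1 + w2) by rewrite mulr_ge0 ?subr_ge0// addr_ge0// ltW.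
  have h2 : 0 < w1 * w2 by rewrite mulr_gt0.
  have h3 := sqr_ge0 w1; nra.
have g4 : 0 <= b ^+ 2 * (w2 * (2 * w1 ^+ 2 + 2 * w1 * w2 - w2 ^+ 2) / 3).
  by rewrite mulr_ge0 ?sqr_ge0// divr_ge0// mulr_ge0// ltW.
lra.
Qed.

Lemma flow_kapE : 3 * flow_kap k c6 a b = E w1 ^+ 2 + E w1 * E w2 + E w2 ^+ 2.
Proof.
have := flow_factor_gt0 w21; have := flow_factor_gt0 (lexx w2).
rewrite /flow_kap /flow_curv /flow_num /flow_factor /c6 /k => /gt_eqF/negbT f1 /gt_eqF/negbT f2.
by field; rewrite f1 f2.
Qed.

Lemma flow_curv_sum w : w2 <= w -> E w + E w1 + E w2 = (w + w1 + w2) * (f w1 * f w2) / f w.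
Proof.
move=> h; have := flow_factor_gt0 w21; have := flow_factor_gt0 (lexx w2).
have := flow_factor_gt0 h; rewrite /flow_curv /flow_num /flow_factor /c6 /k.
move=> /gt_eqF/negbT f0 /gt_eqF/negbT f1 /gt_eqF/negbT f2.
by field; rewrite f0 f1 f2.
Qed.

(** The factorization - (w - w1) (w - w2) (w + w1 + w2) is carried to the same expression in E: the
    first two factors by [flow_curvB], the third by [flow_curv_sum]. *)
Lemma flow_cubic w : w2 <= w ->
  (c6 + 3 * k * w - w ^+ 3) / f w ^+ 3 = - ((E w - E w1) * (E w - E w2) * (E w + E w1 + E w2)).
Proof.
move=> h; have := flow_factor_gt0 w21; have := flow_factor_gt0 (lexx w2).
have := flow_factor_gt0 h => /gt_eqF/negbT f0 /gt_eqF/negbT f1 /gt_eqF/negbT f2.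
rewrite flow_curv_sum// !flow_curvB//; move: (f w) (f w1) (f w2) f0 f1 f2 => x y z x0 y0 z0.
by rewrite /k /c6; field; rewrite x0 y0 z0.
Qed.

(** The right side is the time derivative of ln E at w minus the gradient term of [harnack_rate_ge];
    at w1 the gradient term vanishes. In terms of e, e1, e2 the difference L is a sum of two terms
    with the factor e1 - e >= 0. *)
Lemma flow_harnack w : w2 <= w -> w <= w1 ->
  (4 * flow_kap k c6 a b - 2 * E w1 ^+ 2) / E w1 <=
  (4 * flow_kap k c6 a b - 2 * E w ^+ 2) / E w
    - 4 / 3 * ((c6 + 3 * k * w - w ^+ 3) / f w ^+ 3) / E w ^+ 2.
Proof.
move=> h1 h2; rewrite flow_cubic//.
have -> : flow_kap k c6 a b = (E w1 ^+ 2 + E w1 * E w2 + E w2 ^+ 2) / 3.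
  by rewrite -flow_kapE mulrAC mulfV ?mul1r.
have := flow_curv_mono h1 h2; have := flow_curv_gt0 h1; have := flow_curv_gt0 (lexx w2).
move: (E w) (E w1) (E w2) => e e1 e2 e2p ep le.
have e1p : 0 < e1 by exact: lt_le_trans le.
have en : e != 0 by rewrite gt_eqF.
have e1n : e1 != 0 by rewrite gt_eqF.
rewrite -subr_ge0.
set L := (X in 0 <= X).
have -> : L = 2 / 3 * (e1 - e) + 4 / 3 * (e1 * e2 * (e1 + e2)) * ((e1 - e) * (e1 + e)) * ((e * e1) ^- 2).
  by rewrite /L; field; rewrite en e1n.
have d0 : 0 <= e1 - e by rewrite subr_ge0.
have m0 : 0 < e1 * e2 * (e1 + e2) by rewrite !mulr_gt0// addr_gt0.
have s0 : 0 < e1 + e by rewrite addr_gt0.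
have i0 : 0 < (e * e1) ^- 2 by rewrite invr_gt0 exprn_gt0// mulr_gt0.
apply: addr_ge0; first by rewrite mulr_ge0.
apply: mulr_ge0; last exact: ltW.
apply: mulr_ge0; first by rewrite mulr_ge0// ltW.
by rewrite mulr_ge0// ltW.
Qed.

End Roots.

(** * Evolution of the curvature in time and along a path *)

Section Along.
Variables (w1 w2 T : R) (al be : R -> R).
Hypotheses (w2_gt0 : 0 < w2) (w21 : w2 <= w1).
Let k := (w1 ^+ 2 + w1 * w2 + w2 ^+ 2) / 3.
Let c6 := - (w1 * w2 * (w1 + w2)).
Hypothesis H : forall t : R, 0 <= t <= T -> [/\ 0 < al t, 0 <= be t,
    al t ^+ 3 - 3 * k * al t * be t ^+ 2 + c6 * be t ^+ 3 = 1,
    is_derive t 1 al (4 * k * al t * be t - 2 * c6 * be t ^+ 2) &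
    is_derive t 1 be (2 * al t ^+ 2 - 2 * k * be t ^+ 2)].
Let f w t := flow_factor (al t) (be t) w.
Let E w t := flow_curv k c6 (al t) (be t) w.
Let kap t := flow_kap k c6 (al t) (be t).

(** For fixed w this is the Riccati equation e' = 4 kap - 2 e^2. The motion of u adds D dE/dw, and
    dE/dw = 1 / f^2 because the determinant is 1. *)
Lemma is_derive_flow_curv (u : R -> R) (D t : R) : 0 <= t <= T -> w2 <= u t ->
  is_derive t 1 u D ->
  is_derive t 1 (fun s => E (u s) s) (4 * kap t - 2 * E (u t) t ^+ 2 + D / f (u t) t ^+ 2).
Proof.
move=> tT ut du; have [a0 b0 D1 da db] := H tT.
have f0 : f (u t) t != 0 by rewrite gt_eqF// (flow_factor_gt0 w2_gt0).
have df : is_derive t 1 (fun s => f (u s) s) (2 * flow_num k c6 (al t) (be t) (u t) + be t * D).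
  rewrite /f /flow_factor; apply: is_derive_eq; rewrite /GRing.scale /= /flow_num; ring.
have dN : is_derive t 1 (fun s => flow_num k c6 (al s) (be s) (u s))
    (4 * kap t * f (u t) t + D * (al t ^+ 2 - be t ^+ 2 * k)).
  rewrite /flow_num /f /kap /flow_factor /flow_kap.
  by apply: is_derive_eq; rewrite /GRing.scale /=; ring.
have di := @is_deriveV R (fun s => f (u s) s) t _ 1 f0 df.
have dd := is_deriveM dN di.
apply: is_derive_eq dd _; rewrite /GRing.scale /= /E /flow_curv.
have -> : D / f (u t) t ^+ 2 = D * (al t ^+ 3 - 3 * k * al t * be t ^+ 2 + c6 * be t ^+ 3)
   / f (u t) t ^+ 2 by rewrite D1 mulr1.
rewrite -/(f (u t) t) /flow_num; move: f0; rewrite /f /flow_factor => f0.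
by field.
Qed.

(** q = 1 / e1 has q' = 2 - 4/3 (1 + rho + rho^2) with rho = e2 / e1. Concavity and q(0) > 0 give t
    q'(t) <= q(t), and - q' / q is the quotient to be bounded. *)
Lemma flow_curv_max_harnack t : 0 < t -> t <= T ->
  - t^-1 <= (4 * kap t - 2 * E w1 t ^+ 2) / E w1 t.
Proof.
move=> t0 tT; have inT s : 0 <= s <= t -> 0 <= s <= T by lra.
have e1p s : 0 <= s <= t -> 0 < E w1 s.
  by move=> /inT/H[a0 b0 D1 _ _]; exact: flow_curv_gt0.
have e2p s : 0 <= s <= t -> 0 < E w2 s.
  by move=> /inT/H[a0 b0 D1 _ _]; exact: flow_curv_gt0.
have le s : 0 <= s <= t -> E w2 s <= E w1 s.
  by move=> /inT/H[a0 b0 D1 _ _]; exact: flow_curv_mono.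
have kE s : 0 <= s <= t -> 3 * kap s = E w1 s ^+ 2 + E w1 s * E w2 s + E w2 s ^+ 2.
  by move=> /inT/H[a0 b0 D1 _ _]; exact: flow_kapE.
have de w s : w2 <= w -> 0 <= s <= t -> is_derive s 1 (E w) (4 * kap s - 2 * E w s ^+ 2).
  move=> h hs; have dc : is_derive s 1 (cst w) (0 : R) by exact: is_derive_cst.
  have := is_derive_flow_curv (inT _ hs) (h : w2 <= cst w s) dc.
  by rewrite mul0r addr0.
have dq s : 0 <= s <= t -> is_derive s 1 (fun s => (E w1 s)^-1) (- ((4 * kap s - 2 * E w1 s ^+ 2) / E w1 s ^+ 2)).
  move=> hs; have n1 : E w1 s != 0 by rewrite gt_eqF// e1p.
  apply: is_derive_eq (@is_deriveV R (E w1) s _ 1 n1 (de _ _ w21 hs)) _.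
  by rewrite /GRing.scale /=; field.
have dr s : 0 <= s <= t -> is_derive s 1 (fun s => E w2 s / E w1 s)
    ((E w1 s - E w2 s) * (4 * kap s + 2 * E w1 s * E w2 s) / E w1 s ^+ 2).
  move=> hs; have n1 : E w1 s != 0 by rewrite gt_eqF// e1p.
  apply: is_derive_eq (is_deriveM (de _ _ (lexx _) hs) (@is_deriveV R (E w1) s _ 1 n1 (de _ _ w21 hs))) _.
  by rewrite /GRing.scale /=; field.
have kp s : 0 <= s <= t -> 0 < kap s.
  move=> hs; have := kE s hs; have := e1p s hs; have := e2p s hs; nra.
have rm s : 0 <= s <= t -> E w2 s / E w1 s <= E w2 t / E w1 t.
  move=> /andP[s0 st]; apply: (@derive_ge0_ndecr R (fun s => E w2 s / E w1 s)
    (fun s => (E w1 s - E w2 s) * (4 * kap s + 2 * E w1 s * E w2 s) / E w1 s ^+ 2) s t _ _ st)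
    => z; rewrite in_itv /= => /andP[z1 z2].
    by apply: dr; rewrite (le_trans s0 z1) z2.
  have hz : 0 <= z <= t by rewrite (le_trans s0 z1) z2.
  have p1 := e1p _ hz; have p2 := e2p _ hz; have pk := kp _ hz; have pl := le _ hz.
  rewrite divr_ge0 ?sqr_ge0// mulr_ge0 ?subr_ge0// addr_ge0//; first by rewrite mulr_ge0// ltW.
  by rewrite mulr_ge0//; [rewrite mulr_ge0// ltW|exact: ltW].
have qE s : 0 <= s <= t -> - ((4 * kap s - 2 * E w1 s ^+ 2) / E w1 s ^+ 2) =
    2 - 4 / 3 * (1 + E w2 s / E w1 s + (E w2 s / E w1 s) ^+ 2).
  move=> hs; have n1 : E w1 s != 0 by rewrite gt_eqF// e1p.
  have -> : kap s = (E w1 s ^+ 2 + E w1 s * E w2 s + E w2 s ^+ 2) / 3.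
    by rewrite -kE// mulrAC mulfV ?mul1r.
  by field.
have dqo s : s \in `]0, t[ -> is_derive s 1 (fun s => (E w1 s)^-1)
    (- ((4 * kap s - 2 * E w1 s ^+ 2) / E w1 s ^+ 2)).
  by rewrite in_itv /= => /andP[/ltW s0 /ltW st]; apply: dq; rewrite s0.
have cq : {within `[0, t], continuous (fun s => (E w1 s)^-1)}.
  by apply: is_derive_continuous_within => s; rewrite in_itv /=; exact: dq.
(* The slope q'(c) at the intermediate time c is at least q'(t), because rho is positive and
   nondecreasing. *)
have [c] := MVT t0 dqo cq.
rewrite in_itv /= => /andP[c0 ct] Eq.
have hc : 0 <= c <= t by lra.
have ht : 0 <= t <= t by rewrite lexx ltW.
have r0 : 0 < E w2 c / E w1 c by rewrite divr_gt0 ?e1p ?e2p.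
have rr := rm c hc.
have q0 : 0 < (E w1 0)^-1 by rewrite invr_gt0 e1p// lexx ltW.
have qq : - ((4 * kap t - 2 * E w1 t ^+ 2) / E w1 t ^+ 2) <=
  - ((4 * kap c - 2 * E w1 c ^+ 2) / E w1 c ^+ 2).
  by rewrite !qE//; nra.
have key : - ((4 * kap t - 2 * E w1 t ^+ 2) / E w1 t ^+ 2) * t <= (E w1 t)^-1.
  rewrite subr0 in Eq; apply: le_trans (ler_wpM2r (ltW t0) qq) _.
  by rewrite -Eq; lra.
have e1t := e1p t ht.
have n1 : E w1 t != 0 by rewrite gt_eqF.
rewrite -subr_ge0.
have -> : (4 * kap t - 2 * E w1 t ^+ 2) / E w1 t - - t^-1 =
  ((E w1 t)^-1 - - ((4 * kap t - 2 * E w1 t ^+ 2) / E w1 t ^+ 2) * t) * (E w1 t / t).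
  by field; rewrite n1 gt_eqF.
by rewrite mulr_ge0 ?subr_ge0// divr_ge0// ltW.
Qed.

Definition harnack_rate (u D : R -> R) t :=
  (4 * kap t - 2 * E (u t) t ^+ 2 + D t / f (u t) t ^+ 2) / E (u t) t.

Lemma is_derive_ln_flow_curv (u D : R -> R) t : 0 <= t <= T -> w2 <= u t ->
  is_derive t 1 u (D t) -> is_derive t 1 (fun s => ln (E (u s) s)) (harnack_rate u D t).
Proof.
move=> tT ut du; have [a0 b0 D1 _ _] := H tT.
have E0 : 0 < E (u t) t by exact: flow_curv_gt0.
have dE := is_derive_flow_curv tT ut du.
apply: is_derive_eq (@is_derive1_comp R (@ln R) (fun s => E (u s) s) t _ _ (is_derive1_ln E0) dE) _.
by rewrite /harnack_rate mulrC.
Qed.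

(** Origin of 1/16: the part y of the rate due to the motion satisfies y^2 <= r z / 4, where z is
    the gradient term of [flow_harnack], and (r/16 + z)^2 - r z / 4 = (r/16 - z)^2, so that y >= -
    r/16 - z. *)
Lemma harnack_rate_ge (u D : R -> R) t r : 0 < t -> t <= T -> w2 <= u t -> u t <= w1 -> 0 <= r ->
  D t ^+ 2 <= r * f (u t) t * (c6 + 3 * k * u t - u t ^+ 3) / 3 ->
  - 2 / t - r / 16 <= harnack_rate u D t.
Proof.
move=> t0 tT u2 u1 r0 Dr; have tI : 0 <= t <= T by rewrite ltW.
have [a0 b0 D1 _ _] := H tI.
have E0 : 0 < E (u t) t by exact: flow_curv_gt0.
have f0 : 0 < f (u t) t by exact: (flow_factor_gt0 w2_gt0).
have h1 := flow_curv_max_harnack t0 tT.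
have h2 := flow_harnack w2_gt0 w21 a0 b0 D1 u2 u1.
rewrite -/k -/c6 -/(kap t) -/(E w1 t) -/(E (u t) t) -/(f (u t) t) in h2.
have ti : 0 < t^-1 by rewrite invr_gt0.
rewrite /harnack_rate mulrDl mulNr.
set g := c6 + _ - _ in Dr h2.
set y := D t / f (u t) t ^+ 2 / E (u t) t.
set z := 4 / 3 * (g / f (u t) t ^+ 3) / E (u t) t ^+ 2 in h2.
have En : E (u t) t != 0 by rewrite gt_eqF.
have fn : f (u t) t != 0 by rewrite gt_eqF.
have yz : y ^+ 2 <= r / 4 * z.
  have -> : y ^+ 2 = D t ^+ 2 * (f (u t) t ^+ 2 * E (u t) t) ^- 2 by rewrite /y; field; rewrite En fn.
  have -> : r / 4 * z = r * f (u t) t * g / 3 * (f (u t) t ^+ 2 * E (u t) t) ^- 2.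
    by rewrite /z; field; rewrite En fn.
  by rewrite ler_wpM2r// invr_ge0 exprn_ge0// mulr_ge0// ?exprn_ge0// ltW.
have z0 : 0 <= z.
  have w0 : w2 <= w1 := w21.
  rewrite /z flow_cubic//.
  have l1 := flow_curv_mono w2_gt0 a0 b0 D1 u2 u1.
  have l2 := flow_curv_mono w2_gt0 a0 b0 D1 (lexx _) u2.
  have p1 := flow_curv_gt0 w2_gt0 w21 a0 b0 D1 w0.
  have p2 := flow_curv_gt0 w2_gt0 w21 a0 b0 D1 (lexx w2).
  rewrite divr_ge0 ?sqr_ge0// mulr_ge0// -mulNr -mulNr mulr_ge0//.
    by rewrite mulr_ge0 ?subr_ge0// oppr_ge0 subr_le0.
  by rewrite !addr_ge0// ltW.
have yl : - (r / 16 + z) <= y.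
  rewrite lerNl; apply: le_trans (ler_norm _) _.
  have rz : 0 <= r / 16 + z by rewrite addr_ge0// divr_ge0.
  rewrite normrN -(@ler_pXn2r _ 2) ?nnegrE//.
  rewrite real_normK ?num_real//; apply: le_trans yz _.
  by rewrite -subr_ge0 (_ : _ - _ = (r / 16 - z) ^+ 2) ?sqr_ge0//; field.
(* [h1] provides - 1 / t, which is at least - 2 / t. *)
by move: h1 h2 yl; rewrite /y; lra.
Qed.

End Along.
End CurvatureFormula.

(** * The flow *)

Section MaximumPrinciple.
Context {R : realType}.

Lemma left_max_derive_ge0 (g : R -> R) (a t d : R) : a < t -> is_derive t 1 g d ->
  (forall s : R, a <= s <= t -> g s <= g t) -> 0 <= d.
Proof.
move=> at_ [gd gv] mx; rewrite leNgt; apply/negP => d0.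
have cv : (fun h : R => h^-1 *: ((g \o shift t) (h *: 1) - g t)) @ 0^' --> d by rewrite -gv.
move/cvgr_lt : (cv) => /(_ _ d0) /nbhs_ballP[e /= e0 He].
pose h := - (Num.min e (t - a) / 2).
have m0 : 0 < Num.min e (t - a) by rewrite lt_min e0 subr_gt0.
have m1 : Num.min e (t - a) <= e by rewrite ge_min lexx.
have m2 : Num.min e (t - a) <= t - a by rewrite ge_min lexx orbT.
have h0 : h < 0 by rewrite oppr_lt0 divr_gt0.
have := He h; rewrite /ball /= sub0r normrN ltr0_norm// opprK lt_eqF// => H.
have : h^-1 *: (g (h *: 1 + t) - g t) < 0 by apply: H => //; lra.
rewrite [_ *: _]/(_ * _) nmulr_rlt0 ?invr_lt0// subr_gt0 [h *: 1]mulr1 ltNge => /negP; apply.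
by apply: mx; rewrite /h; lra.
Qed.

(** With C above the maximum of m, a positive maximum of exp(- C t) v would have a negative time
    derivative. The differential inequality is demanded only at spatial maxima with v > 0, where
    [ext_ineq] applies. *)
Lemma parabolic_max_principle (X : topologicalType) (K : set X) (S : R) (v vt : X -> R -> R)
    (m : X * R -> R) : compact K ->
  {within K `*` `[0, S], continuous (fun z => v z.1 z.2)} ->
  {within K `*` `[0, S], continuous m} ->
  (forall q, K q -> v q 0 = 0) ->
  (forall q (t : R), K q -> 0 < t <= S -> is_derive t 1 (v q) (vt q t)) ->
  (forall q t, K q -> 0 < t <= S -> (forall q', K q' -> v q' t <= v q t) -> 0 < v q t ->
    vt q t <= m (q, t) * v q t) ->
  forall q t, K q -> 0 <= t <= S -> v q t <= 0.
Proof.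
move=> cK cv cm v0 dv H q0 t0 Kq0 /andP[t00 t0S]; rewrite leNgt; apply/negP => vp.
have cKS : compact (K `*` `[0, S]) by apply: compact_setX => //; exact: segment_compact.
have z0 : (K `*` `[0, S]) (q0, t0) by split=> //=; rewrite in_itv /= t00.
have [z1 _ Hm] := compact_EVT_max (ex_intro _ _ z0) cKS cm.
set C := m z1 + 1.
pose u (z : X * R) := expR (- C * z.2) * v z.1 z.2.
have cu : {within K `*` `[0, S], continuous u}.
  apply/subspace_continuousP => z zK; apply: cvgM; last first.
    by move/subspace_continuousP : cv => /(_ z zK).
  apply: (@cvg_comp _ _ _ (fun z : X * R => - C * z.2) (@expR R) _ (nbhs (- C * z.2))).
    by apply: cvgM; [exact: cvg_cst|apply: cvg_within_filter; exact: cvg_snd].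
  exact: continuous_expR.
have [[q t] zK Hu] := compact_EVT_max (ex_intro _ _ z0) cKS cu.
rewrite inE in zK; have [/= Kq] := zK; rewrite /= in_itv /= => /andP[tt0 tS].
have up : 0 < u (q, t).
  by apply: lt_le_trans (Hu (q0, t0) _); rewrite ?inE// /u /= mulr_gt0// expR_gt0.
have vq : 0 < v q t by move: up; rewrite /u /= pmulr_rgt0// expR_gt0.
have tp : 0 < t.
  by rewrite lt_neqAle tt0 andbT; apply/negP => /eqP t00'; rewrite -t00' v0 ?ltxx in vq.
have tI : 0 < t <= S by rewrite tp.
have vmx q' : K q' -> v q' t <= v q t.
  move=> Kq'; have := Hu (q', t); rewrite inE /u /= => /(_ _).
  by rewrite ler_pM2l ?expR_gt0//; apply; split=> //=; rewrite in_itv /= tt0.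
have h1 := H q t Kq tI vmx vq.
have d1 := dv q t Kq tI.
have de : is_derive t 1 (fun s : R => expR (- C * s)) (- C * expR (- C * t)).
  have dl : is_derive t 1 (fun s : R => - C * s) (- C).
    by apply: is_derive_eq; rewrite /GRing.scale /=; ring.
  apply: is_derive_eq (@is_derive1_comp R (@expR R) (fun s => - C * s) t _ _ (is_derive_expR _) dl) _.
  by rewrite mulrC.
have du := is_deriveM de d1.
have : 0 <= expR (- C * t) *: vt q t + v q t *: (- C * expR (- C * t)).
  apply: (left_max_derive_ge0 tp du) => s /andP[s0 st].
  by apply: (Hu (q, s)); rewrite inE; split=> //=; rewrite in_itv /= s0 (le_trans st).
rewrite /GRing.scale /= (_ : _ + _ = expR (- C * t) * (vt q t - C * v q t)); last by ring.
rewrite pmulr_rge0 ?expR_gt0// subr_ge0 leNgt => /negP; apply.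
apply: le_lt_trans h1 _; rewrite ltr_pM2r//.
apply: le_lt_trans (Hm (q, t) _) _; first by rewrite inE.
by rewrite ltrDl.
Qed.

End MaximumPrinciple.

(** * The conformal factor of two contact forms *)

Section Scalar.
Context {R : realType}.
Implicit Types a b u v : 'rV[R]_3.

(** For a = s b the Euclidean quotient returns s by one formula, continuous in both covectors,
    without the choice of a nonzero component. *)
Definition scal a b := pairing a b / pairing b b.

Lemma pairing_delta a i : pairing a (delta_mx 0 i) = a 0 i.
Proof.
rewrite /pairing (bigD1 i)//= mxE !eqxx mulr1 big1 ?addr0// => j ji.
by rewrite mxE eqxx (negPf ji) mulr0.
Qed.

Lemma pairing_gt0 b : b != 0 -> 0 < pairing b b.
Proof.
move=> b0; rewrite lt_neqAle; apply/andP; split; last first.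
  by apply: sumr_ge0 => i _; rewrite -expr2 sqr_ge0.
apply: contra b0 => /eqP/esym/eqP; rewrite psumr_eq0; last by move=> i _; rewrite -expr2 sqr_ge0.
move=> /allP H; apply/eqP/rowP => i; rewrite mxE; apply/eqP.
by have := H i (mem_index_enum _); rewrite /= mulf_eq0 orbb.
Qed.

Lemma scal_eq a b s : b != 0 -> a = s *: b -> scal a b = s.
Proof.
move=> b0 ->; rewrite /scal; have -> : pairing (s *: b) b = s * pairing b b.
  by rewrite /pairing mulr_sumr; apply: eq_bigr => i _; rewrite mxE mulrA.
by rewrite mulfK// gt_eqF// pairing_gt0.
Qed.

Lemma scalE a b : b != 0 -> (forall v, pairing b v = 0 -> pairing a v = 0) -> a = scal a b *: b.
Proof.
move=> b0 ker; have p0 := pairing_gt0 b0.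
have lin c u v (s : R) : pairing c (u - s *: v) = pairing c u - s * pairing c v.
  rewrite /pairing mulr_sumr -sumrB; apply: eq_bigr => i _; rewrite !mxE; ring.
apply/rowP => i; have := ker (delta_mx 0 i - (b 0 i / pairing b b) *: b).
rewrite !lin !pairing_delta divfK ?gt_eqF// subrr => /(_ erefl) /eqP.
by rewrite subr_eq0 mxE /scal => /eqP ->; ring.
Qed.

Lemma contact_neq0 P (a : 'rV[R]_3 -> 'rV[R]_3) x : contact_at P a x -> a x != 0.
Proof.
move=> [_ [u [v [w]]]]; apply: contraNneq => a0.
have z v' : pairing (a x) v' = 0 by rewrite a0 /pairing big1// => i _; rewrite mxE mul0r.
by rewrite /wedge12 !z !mul0r !addr0.
Qed.

Lemma contact_scal P (a b : 'rV[R]_3 -> 'rV[R]_3) x : contact_at P a x -> contact_at P b x ->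
  a x = scal (a x) (b x) *: b x.
Proof.
move=> ca cb; apply: scalE; first exact: contact_neq0 cb.
by move=> v /(cb.1 v) /(ca.1 v).
Qed.

End Scalar.

Section ConformalFactor.
Context {R : realType} (X : CR3 R).

Definition chart_at (p : X) : chart X := projT1 (cid (dom_chart p)).

Lemma chart_atP p : dom (chart_at p) p. Proof. exact: projT2 (cid (dom_chart p)). Qed.

(** The value is computed in a chosen chart; [conf_factor_chart] allows any other. *)
Definition conf_factor (a b : form1 X) (p : X) : R :=
  scal (a (chart_at p) (coord (chart_at p) p)) (b (chart_at p) (coord (chart_at p) p)).

Variables (a b : form1 X).
Hypotheses (ca : is_contact_form a) (cb : is_contact_form b).

Lemma conf_factorE c x : img c x -> a c x = conf_factor a b (param c x) *: b c x.
Proof.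
move=> [p dp <-]; rewrite coordK//; set d := chart_at p; have dd := chart_atP p : dom d p.
have xd : img d (coord d p) by exists p.
have e := contact_scal (ca.2 _ _ xd) (cb.2 _ _ xd).
apply/rowP => i; rewrite -!pairing_delta.
have lin s (u v : 'rV[R]_3) : pairing (s *: u) v = s * pairing u v.
  by rewrite /pairing mulr_sumr; apply: eq_bigr => j _; rewrite mxE mulrA.
by rewrite [RHS]lin (cb.1.2 _ _ _ dp dd) (ca.1.2 _ _ _ dp dd) [in LHS]e lin.
Qed.

Lemma conf_factor_chart c p : dom c p ->
  conf_factor a b p = scal (a c (coord c p)) (b c (coord c p)).
Proof.
move=> dp; have xc : img c (coord c p) by exists p.
apply/esym/scal_eq; first exact: contact_neq0 (cb.2 _ _ xc).
by rewrite conf_factorE// coordK.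
Qed.

End ConformalFactor.

Section OneParameter.
Context {R : realType}.

(** Smoothness on a set provides a local extension g. When t is a limit point of I, which the proper
    filter expresses, the limit along I is the ordinary derivative of g. *)
Lemma deriv_in_eq (V : normedModType R) (I : set R) (c g : R -> V) (t : R) :
  ProperFilter (within [set h | I (t + h)] (0 : R)^') -> I t ->
  (\forall s \near t, I s -> c s = g s) -> derivable g t 1 -> deriv_in I c t = 'D_1 g t.
Proof.
move=> PF It n gd; rewrite /deriv_in; have ct : c t = g t by exact: (nbhs_singleton n).
have n0 : \forall h \near (0 : R), I (t + h) -> c (t + h) = g (t + h).
  have lc : (t + h) @[h --> (0 : R)] --> t + 0 by apply: cvgD; [exact: cvg_cst|exact: cvg_id].
  by rewrite addr0 in lc; exact: (lc _ n).
apply: (@cvg_lim _ _ _ _ PF); first exact: norm_hausdorff.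
have gv : (fun h : R => h^-1 *: (g (h *: 1 + t) - g t)) @ 0^' --> 'D_1 g t by exact: gd.
have gw : (fun h : R => h^-1 *: (g (h *: 1 + t) - g t)) @ within [set h | I (t + h)] (0 : R)^' -->
    'D_1 g t by apply: cvg_within_filter; exact: gv.
apply: cvg_trans gw; apply: near_eq_cvg.
have n1 : \forall h \near (0 : R)^', I (t + h) -> c (t + h) = g (t + h).
  exact: (@cvg_within _ (nbhs (0 : R)) _ [set h | h != 0]).
by apply: filterS n1 => h /[apply] ->; rewrite ct [h *: 1]mulr1 (addrC t h).
Qed.

Lemma interior_proper (I : set R) (t : R) : (\forall s \near t, I s) ->
  ProperFilter (within [set h | I (t + h)] (0 : R)^').
Proof.
move=> n; have n0 : \forall h \near (0 : R), I (t + h).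
  have lc : (t + h) @[h --> (0 : R)] --> t + 0 by apply: cvgD; [exact: cvg_cst|exact: cvg_id].
  by rewrite addr0 in lc; exact: (lc _ n).
have nI : \forall h \near (0 : R)^', I (t + h).
  exact: (@cvg_within _ (nbhs (0 : R)) _ [set h | h != 0]).
apply: Build_ProperFilter_ex => P /= wP.
have : \forall h \near (0 : R)^', P h by apply: filterS2 nI wP => h ? ; apply.
by move=> /filter_ex.
Qed.

Lemma segment_proper (a b t : R) : a < b -> a <= t <= b ->
  ProperFilter (within [set h | `[a, b]%classic (t + h)] (0 : R)^').
Proof.
move=> ab tab; apply: Build_ProperFilter_ex => P /nbhs_ballP[e /= e0 He].
have [tb|tb] := ltP t b.
  have m0 : 0 < Num.min e (b - t) by rewrite lt_min e0 subr_gt0.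
  have m1 : Num.min e (b - t) <= e by rewrite ge_min lexx.
  have m2 : Num.min e (b - t) <= b - t by rewrite ge_min lexx orbT.
  exists (Num.min e (b - t) / 2); apply: He.
  - by rewrite /ball /= sub0r normrN gtr0_norm; lra.
  - by rewrite gt_eqF// divr_gt0.
  - by rewrite /= in_itv /=; lra.
have m0 : 0 < Num.min e (b - a) by rewrite lt_min e0 subr_gt0.
have m1 : Num.min e (b - a) <= e by rewrite ge_min lexx.
have m2 : Num.min e (b - a) <= b - a by rewrite ge_min lexx orbT.
exists (- (Num.min e (b - a) / 2)); apply: He.
- by rewrite /ball /= sub0r opprK gtr0_norm; lra.
- by rewrite lt_eqF// oppr_lt0 divr_gt0.
- by rewrite /= in_itv /=; lra.
Qed.

Lemma smooth_slice (V W : normedModType R) (O : set (V * R)) (g : V * R -> W) (x : V) (t : R) :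
  open O -> O (x, t) -> Ck 1 O g -> derivable (fun s => g (x, s)) t 1.
Proof.
move=> oO Ox g1.
have d : derivable g (x, t) (0, 1) by exact: Ck_derivable g1 Ox.
rewrite /derivable.
have -> : (fun h : R => h^-1 *: (((fun s => g (x, s)) \o shift t) (h *: 1) - g (x, t))) =
    (fun h : R => h^-1 *: ((g \o shift (x, t)) (h *: ((0, 1) : V * R)) - g (x, t))).
  apply/funext => h /=; congr (_ *: (g _ - _)); congr pair => /=.
  by rewrite scaler0 add0r.
exact: d.
Qed.

Lemma cvg_entry (T : Type) (F : set_system T) (FF : Filter F) (u : T -> 'rV[R]_3) (a : 'rV[R]_3) i :
  u @ F --> a -> (fun z => u z 0 i) @ F --> a 0 i.
Proof. by move=> ua; apply: (cvg_comp _ _ ua (@coordf_continuous R 1 3 0 i a)). Qed.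

Lemma cvg_scal (T : Type) (F : set_system T) (FF : Filter F) (u v : T -> 'rV[R]_3) (a b : 'rV[R]_3) :
  u @ F --> a -> v @ F --> b -> b != 0 -> (fun z => scal (u z) (v z)) @ F --> scal a b.
Proof.
move=> ua vb b0; have p (u' v' : T -> 'rV[R]_3) (a' b' : 'rV[R]_3) : u' @ F --> a' -> v' @ F --> b' ->
    (fun z => pairing (u' z) (v' z)) @ F --> pairing a' b'.
  by move=> h1 h2; apply: cvg_sumr => i; apply: cvgM; exact: cvg_entry.
apply: cvgM; first exact: p.
by apply: cvgV; [rewrite gt_eqF// pairing_gt0|exact: p].
Qed.

End OneParameter.

Section Flow.
Context {R : realType} (X : CR3 R) (hat : form1 X) (tmax : \bar R) (theta : R -> form1 X)
  (W : R -> X -> R).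
Hypotheses (hc : is_contact_form hat) (flow : yamabe_flow tmax theta W).
Local Notation I := (time_range tmax).
Let f t p := conf_factor hat (theta t) p.

Lemma time_range_near t : 0 < t -> (t%:E < tmax)%E -> \forall s \near t, I s.
Proof.
move=> t0 tm.
have n1 : \forall s \near t, 0 < s by exact: lt_nbhsr.
have n2 : \forall s \near t, (s%:E < tmax)%E.
  case: tmax tm => [r| |]//=.
    by rewrite lte_fin => tr; apply: filterS (lt_nbhsl tr) => s; rewrite lte_fin.
  by move=> _; apply: filterE => s; rewrite ltry.
by apply: filterS2 n1 n2 => s s0 sm; split=> //; exact: ltW.
Qed.

Lemma is_derive_theta c x t j : img c x -> 0 < t -> (t%:E < tmax)%E ->
  is_derive t 1 (fun s => theta s c x 0 j) (- 2 * W t (param c x) * theta t c x 0 j).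
Proof.
move=> xc t0 tm; have [sm _ _ de] := flow.
have It : I t by split=> //; exact: ltW.
have [U [g [oU Ox gs gE]]] := sm c (x, t) (conj xc It).
have d := smooth_slice oU Ox (gs 1).
have nO : \forall s \near t, U (x, s).
  have cp : (x, s) @[s --> t] --> (x, t) by exact: (cvg_pair (cvg_cst x) (@cvg_id _ (nbhs t))).
  by apply: cp; apply: open_nbhs_nbhs.
have nt : \forall s \near t, I s -> theta s c x = g (x, s).
  by apply: filterS nO => s Us Is; exact: (gE (x, s) (conj xc Is) Us).
have nI := time_range_near t0 tm.
have D : 'D_1 (fun s => g (x, s)) t = (- 2 * W t (param c x)) *: theta t c x.
  by rewrite -de//; apply/esym; exact: deriv_in_eq (interior_proper nI) It nt d.
have dE : is_derive t 1 (fun s => g (x, s) 0 j) ((- 2 * W t (param c x) *: theta t c x) 0 j).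
  rewrite -D; apply: DeriveDef (derive_coordE _ _ d).
  exact: (derivable_lin (L := coordf 0 j) (@coordf_continuous _ _ _ _ _) d).
rewrite mxE in dE; apply: near_eq_is_derive dE.
by apply: filterS2 nI nt => s Is /(_ Is) ->.
Qed.

(** The product f theta_t is the fixed form hat, so the relative rate of f is opposite to the rate -
    2 W of theta_t; it is computed on a component where theta_t is nonzero. *)
Lemma is_derive_conf_factor p t : 0 < t -> (t%:E < tmax)%E ->
  is_derive t 1 (fun s => f s p) (2 * W t p * f t p).
Proof.
move=> t0 tm; have [sm ctc _ _] := flow.
have It : I t by split=> //; exact: ltW.
have [c dp] := dom_chart p; set x := coord c p; have xc : img c x by exists p.
have bn := contact_neq0 ((ctc t It).2 _ _ xc).
have [j bj] : exists j, theta t c x 0 j != 0.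
  apply/not_existsP => h; move/eqP: bn; apply; apply/rowP => i; rewrite mxE.
  by apply/eqP/negP => n; apply: (h i); apply/negP.
have dj := is_derive_theta j xc t0 tm; rewrite coordK// in dj.
have nj : \forall s \near t, theta s c x 0 j != 0.
  have ct : {for t, continuous (fun s => theta s c x 0 j)}.
    by apply: differentiable_continuous; apply/derivable1_diffP; case: dj.
  exact: (cvgr_neq0 _ ct bj).
have nf : \forall s \near t, f s p = hat c x 0 j * (theta s c x 0 j)^-1.
  apply: filterS2 (time_range_near t0 tm) nj => s Is sj.
  by rewrite (conf_factorE hc (ctc s Is) xc) coordK// mxE mulfK.
have ft : f t p = hat c x 0 j * (theta t c x 0 j)^-1 by exact: nbhs_singleton nf.
have di := @is_deriveV R (fun s => theta s c x 0 j) t _ 1 bj dj.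
have dk : is_derive t 1 (fun s => hat c x 0 j * (theta s c x 0 j)^-1) (2 * W t p * f t p).
  have dc : is_derive t 1 (cst (hat c x 0 j)) (0 : R) by exact: is_derive_cst.
  apply: is_derive_eq (is_deriveM dc di) _.
  by rewrite ft /GRing.scale /=; field.
by apply: near_eq_is_derive dk; apply: filterS nf => s ->.
Qed.

(** Joint continuity in space and time, on which the compactness arguments over K and [0, S]
    rest. *)
Lemma conf_factor_continuous :
  {within [set z : X * R | I z.2], continuous (fun z => f z.2 z.1)}.
Proof.
have [sm ctc _ _] := flow.
apply/subspace_continuousP => -[p t] /= It.
have [c dp] := dom_chart p; set x := coord c p; have xc : img c x by exists p.
have [U [g [oU Ox gs gE]]] := sm c (x, t) (conj xc It).
set F := within _ _.
have c1 : coord c z.1 @[z --> F] --> x.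
  apply: cvg_within_filter.
  apply: (@cvg_comp _ _ _ fst (coord c) _ (nbhs p)); first exact: cvg_fst.
  exact: coord_continuous.
have c2 : z.2 @[z --> F] --> t.
  by apply: (@cvg_within_filter _ _ _ (nbhs (p, t))); exact: cvg_snd.
have cp : (coord c z.1, z.2) @[z --> F] --> (x, t) by exact: (cvg_pair c1 c2).
have nd : \forall z \near F, dom c z.1.
  apply: (@cvg_within _ (nbhs (p, t)) _ [set z : X * R | I z.2]).
  by apply: cvg_fst; apply: open_nbhs_nbhs; split=> //; exact: dom_open.
have nO : \forall z \near F, U (coord c z.1, z.2).
  by apply: cp; apply: open_nbhs_nbhs.
have nI : \forall z \near F, I z.2 by exact: withinT.
have ne : \forall z \near F, scal (hat c (coord c z.1)) (g (coord c z.1, z.2)) = f z.2 z.1.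
  near=> z; have dz : dom c z.1 by near: z.
  have Iz : I z.2 by near: z.
  rewrite /f (conf_factor_chart hc (ctc _ Iz) dz) -gE//; last by near: z.
  by split=> //; exists z.1.
apply: cvg_trans (near_eq_cvg ne) _.
have -> : from_subspace [set z : X * R | I z.2] (fun z => f z.2 z.1) (p, t) =
    scal (hat c x) (theta t c x) by exact: (conf_factor_chart hc (ctc _ It) dp).
have -> : theta t c x = g (x, t) by exact: (gE (x, t) (conj xc It) Ox).
apply: cvg_scal.
- have hcont := Ck_cont (hc.1.1 c 0%N) xc.
  exact: (cvg_comp _ _ c1 hcont).
- exact: (cvg_comp _ _ cp (Ck_cont (gs 0%N) Ox)).
- by rewrite -(gE (x, t) (conj xc It) Ox); exact: contact_neq0 ((ctc t It).2 _ _ xc).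
Unshelve. all: by end_near. Qed.

End Flow.

(** * The flow on the set K of points with given constants *)

Section Solution.
Context {R : realType} (X : CR3 R) (hat : form1 X) (tmax : \bar R) (theta : R -> form1 X)
  (W : R -> X -> R) (w : X -> R).
Hypotheses (Xc : compact [set: X]) (sph : spherical X) (hc : is_contact_form hat)
  (htf : vanishing_torsion hat) (htw : is_TW_curvature hat w) (w0 : forall p, 0 < w p).
Hypotheses (tmax_gt0 : (0 < tmax)%E) (flow : yamabe_flow tmax theta W)
  (theta_init : forall c x, img c x -> theta 0 c x = hat c x).
Local Notation I := (time_range tmax).
Let f t p := conf_factor hat (theta t) p.

Lemma w_continuous : continuous w.
Proof.
move=> p; have [c dp] := dom_chart p.
have [U [oU Ux Uc sU]] := w_smooth sph hc htf htw dp.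
have wc := Ck_cont (sU 0%N) Ux.
have e : \forall q \near p, (w \o param c) (coord c q) = w q.
  have nd : \forall q \near p, dom c q by apply: open_nbhs_nbhs; split=> //; exact: dom_open.
  by apply: filterS nd => q dq /=; rewrite coordK.
apply: cvg_trans (near_eq_cvg e) _.
have -> : w p = (w \o param c) (coord c p) by rewrite /= coordK.
exact: (cvg_comp _ _ (coord_continuous dp) wc).
Qed.

Variables (q0 : X) (k c6 : R).
Hypothesis lc0 : LC hat w q0 k c6.
Let K : set X := [set q | LC hat w q k c6].

Lemma K_open q : K q -> \forall q' \near q, K q'.
Proof. exact: LC_near. Qed.

(** The complement of K is a union of sets of the same kind, open by [LC_near]. *)
Lemma K_compact : compact K.
Proof.
apply: (subclosed_compact _ Xc); last by [].
rewrite -[K]setCK; apply: open_closedC; rewrite openE => q nK.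
have [k' [c' lc]] := LC_exists sph hc htf htw q.
apply: filterS (LC_near lc) => q' lc' Kq'; apply: nK.
have [e1 e2] := LC_uniq sph hc htf htw lc' Kq'.
by rewrite /K /= -e1 -e2.
Qed.

(** The cubic vanishes at both extrema; the difference of the two equations divided by w1 - w2 gives
    k. When w1 = w2, the inequalities of [crit_max] and [crit_min] give k = w1^2 instead. *)
Lemma extrema : exists w1 w2, [/\ 0 < w2, w2 <= w1, k = (w1 ^+ 2 + w1 * w2 + w2 ^+ 2) / 3,
  c6 = - (w1 * w2 * (w1 + w2)) & forall q, K q -> w2 <= w q <= w1].
Proof.
have cw : {within K, continuous w} by apply: continuous_subspaceT; exact: w_continuous.
have cw' : {within K, continuous (fun q => - w q)}.
  by apply: continuous_subspaceT => q; apply: cvgN; exact: w_continuous.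
have Kn : K !=set0 by exists q0.
have [p1 Kp1 H1] := compact_EVT_max Kn K_compact cw.
have [p2 Kp2 H2] := compact_EVT_max Kn K_compact cw'.
rewrite inE in Kp1; rewrite inE in Kp2.
have m1 q : K q -> w q <= w p1 by move=> Kq; apply: H1; rewrite inE.
have m2 q : K q -> w p2 <= w q by move=> Kq; rewrite -lerN2; apply: H2; rewrite inE.
have [e1 l1] : c6 + 3 * k * w p1 - w p1 ^+ 3 = 0 /\ k <= w p1 ^+ 2.
  apply: (crit_max sph hc htf htw Kp1); apply: filterS (K_open Kp1) => q; exact: m1.
have [e2 l2] : c6 + 3 * k * w p2 - w p2 ^+ 3 = 0 /\ w p2 ^+ 2 <= k.
  apply: (crit_min sph hc htf htw Kp2); apply: filterS (K_open Kp2) => q; exact: m2.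
have le21 := m1 _ Kp2.
have kE : k = (w p1 ^+ 2 + w p1 * w p2 + w p2 ^+ 2) / 3.
  have [e|n] := eqVneq (w p1) (w p2).
    have -> : k = w p2 ^+ 2 by apply/le_anti; rewrite l2 -e l1.
    by rewrite e; field.
  have n' : w p1 - w p2 != 0 by rewrite subr_eq0.
  apply: (mulfI n'); apply/eqP; rewrite -subr_eq0; apply/eqP.
  have -> : (w p1 - w p2) * k - (w p1 - w p2) * ((w p1 ^+ 2 + w p1 * w p2 + w p2 ^+ 2) / 3) =
    ((c6 + 3 * k * w p1 - w p1 ^+ 3) - (c6 + 3 * k * w p2 - w p2 ^+ 3)) / 3 by field.
  by rewrite e1 e2 subr0 mul0r.
exists (w p1), (w p2); split=> //; last by move=> q Kq; rewrite m1// m2.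
have -> : c6 = w p1 ^+ 3 - 3 * k * w p1 by lra.
by rewrite kE; field.
Qed.

Lemma ftheta c x t : I t -> img c x -> hat c x = f t (param c x) *: theta t c x.
Proof. by move=> It; have [_ ctc _ _] := flow; exact: conf_factorE hc (ctc t It) _ _. Qed.

Lemma f_init p : f 0 p = 1.
Proof.
have I0 : I 0 by split.
have [c dp] := dom_chart p; have xc : img c (coord c p) by exists p.
have [_ ctc _ _] := flow.
rewrite /f (conf_factor_chart hc (ctc 0 I0) dp) theta_init//.
by apply: scal_eq; rewrite ?scale1r//; exact: contact_neq0 (hc.2 _ _ xc).
Qed.

Section Comparison.
Variables (al be : R -> R) (S : R).
Hypotheses (S0 : 0 < S) (Sm : (S%:E < tmax)%E) (al0 : al 0 = 1) (be0 : be 0 = 0).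
Hypotheses (dal : forall t, 0 <= t <= S -> is_derive t 1 al (4 * k * al t * be t - 2 * c6 * be t ^+ 2))
  (dbe : forall t, 0 <= t <= S -> is_derive t 1 be (2 * al t ^+ 2 - 2 * k * be t ^+ 2)).

Lemma range_S t : 0 <= t <= S -> I t.
Proof. by move=> /andP[t0 tS]; split=> //; rewrite (le_lt_trans _ Sm)// lee_fin. Qed.

Let f_cont : {within K `*` `[0, S], continuous (fun z => f z.2 z.1)}.
Proof.
apply: continuous_subspaceW (conf_factor_continuous hc flow) => z [_ /=].
by rewrite in_itv /=; exact: range_S.
Qed.

Let cont_snd (g dg : R -> R) : (forall t, 0 <= t <= S -> is_derive t 1 g (dg t)) ->
  {within K `*` `[0, S], continuous (fun z : X * R => g z.2)}.
Proof.
move=> d; apply/subspace_continuousP => -[p t] [/= _]; rewrite in_itv /= => tS.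
apply: (@cvg_within_filter _ _ _ (nbhs (p, t))).
apply: (@cvg_comp _ _ _ snd g _ (nbhs t)); first exact: cvg_snd.
have gc : {for t, continuous g}.
  by apply: differentiable_continuous; apply/derivable1_diffP; have [] := d t tS.
exact: gc.
Qed.

Let cont_fst (g : X -> R) : continuous g ->
  {within K `*` `[0, S], continuous (fun z : X * R => g z.1)}.
Proof.
move=> cg; apply/subspace_continuousP => -[p t] _.
apply: (@cvg_within_filter _ _ _ (nbhs (p, t))).
by apply: (@cvg_comp _ _ _ fst g _ (nbhs p)); [exact: cvg_fst|exact: cg].
Qed.

(** At a spatial maximum of v, [ext_ineq] with b = be bounds s W f by s times a quadratic polynomial
    in f; by the ODE, al + be w satisfies the corresponding equation exactly. The two signs of s
    give both inequalities. *)
Lemma comparison (s : R) q t : (s = 1 \/ s = -1) -> K q -> 0 <= t <= S ->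
  s * (f t q - al t - be t * w q) <= 0.
Proof.
move=> s1; have s0 : s != 0 by case: s1 => ->; rewrite ?oppr_eq0 oner_neq0.
pose v q t := s * (f t q - al t - be t * w q).
pose vt q t := s * (2 * W t q * f t q - (4 * k * al t * be t - 2 * c6 * be t ^+ 2)
   - (2 * al t ^+ 2 - 2 * k * be t ^+ 2) * w q).
(* Twice the difference quotient of this quadratic polynomial between f and al + be w. *)
pose m (z : X * R) := 2 * (2 * be z.2 * (k - w z.1 ^+ 2) + w z.1 * (f z.2 z.1 + al z.2 + be z.2 * w z.1)).
have ca := cont_snd dal; have cb := cont_snd dbe; have cw := cont_fst w_continuous.
apply: (@parabolic_max_principle _ X K S v vt m K_compact).
- move=> z; apply: cvgM; first exact: cvg_cst.
  apply: cvgB; last by apply: cvgM; [exact: cb|exact: cw].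
  by apply: cvgB; [exact: f_cont|exact: ca].
- move=> z; apply: cvgM; first exact: cvg_cst.
  apply: cvgD.
    apply: cvgM; first by apply: cvgM; [exact: cvg_cst|exact: cb].
    by apply: cvgB; [exact: cvg_cst|apply: cvgM; exact: cw].
  apply: cvgM; first exact: cw.
  apply: cvgD; last by apply: cvgM; [exact: cb|exact: cw].
  by apply: cvgD; [exact: f_cont|exact: ca].
- by move=> p _; rewrite /v f_init al0 be0; ring.
- move=> p t' _ /andP[t0 tS]; have tI : 0 <= t' <= S by rewrite ltW.
  have df : is_derive t' 1 (fun s => f s p) _ :=
    is_derive_conf_factor hc flow p t0 (range_S tI).2.
  have da := dal tI; have db := dbe tI.
  apply: is_derive_eq; rewrite /vt /GRing.scale /= -?/(f t' p); ring.
- move=> p t' Kp /andP[t0 tS] mx vp; have tI : 0 <= t' <= S by rewrite ltW.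
  have It := range_S tI; have [_ ctc ctw _] := flow.
  have ext : \forall q' \near p, s * (f t' q' - be t' * w q') <= s * (f t' p - be t' * w p).
    apply: filterS (K_open Kp) => q' /mx; rewrite /v => h.
    have e x y : s * (x - al t' - y) = s * (x - y) - s * al t' by ring.
    by rewrite !e lerD2r in h.
  have := ext_ineq sph hc htf htw (ctc _ It) (ctw _ It) (fun c x => @ftheta c x t' It) Kp s0 ext.
  move: vp; rewrite /v /vt /m /=.
  move: (f t' p) (W t' p) (w p) (al t') (be t') => F V z a b vp E.
  rewrite -subr_ge0.
  set L := (X in 0 <= X).
  have -> : L = 2 * (s * (2 * F * b * (k - z ^+ 2) + z * F ^+ 2 - b ^+ 2 * (c6 + 3 * k * z - z ^+ 3))
     - s * (V * F)) by rewrite /L; ring.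
  by rewrite mulr_ge0// subr_ge0.
Qed.

Lemma conf_factor_affine q t : K q -> 0 <= t <= S -> f t q = al t + be t * w q.
Proof.
move=> Kq tS; have h1 := comparison (or_introl erefl) Kq tS.
by have h2 := comparison (or_intror erefl) Kq tS; lra.
Qed.

(** The equation f = al + be w is differentiated in time, where f' = 2 W f. *)
Lemma curvature_flow_curv q t : K q -> 0 < t < S -> al t + be t * w q != 0 ->
  W t q = flow_curv k c6 (al t) (be t) (w q).
Proof.
move=> Kq /andP[t0 tS] n0; have tI : 0 <= t <= S by rewrite !ltW.
have d1 := is_derive_conf_factor hc flow q t0 (range_S tI).2.
have da := dal tI; have db := dbe tI.
have d2 : is_derive t 1 (fun s => al s + be s * w q)
   ((4 * k * al t * be t - 2 * c6 * be t ^+ 2) + (2 * al t ^+ 2 - 2 * k * be t ^+ 2) * w q).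
  by apply: is_derive_eq; rewrite /GRing.scale /=; ring.
have n : \forall s \near t, f s q = al s + be s * w q.
  near=> s; apply: conf_factor_affine => //; apply/andP; split; apply: ltW; near: s.
    exact: lt_nbhsr.
  exact: lt_nbhsl.
have [_ e1] := near_eq_is_derive n d1; have [_ e2] := d2.
rewrite e1 in e2; rewrite -/(f t q) (conf_factor_affine Kq tI) in e2.
apply: (mulIf n0); rewrite /flow_curv /flow_factor divfK// /flow_num.
by apply: (@mulfI _ 2); rewrite ?pnatr_eq0// mulrA e2; ring.
Unshelve. all: by end_near. Qed.

Lemma conf_factor_bounded : exists B : R, forall q t, K q -> 0 <= t <= S -> f t q <= B.
Proof.
have cKS : compact (K `*` `[0, S]) by apply: compact_setX; [exact: K_compact|exact: segment_compact].
have z0 : (K `*` `[0, S]) (q0, 0) by split=> //=; rewrite in_itv /= lexx ltW.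
have [z1 _ Hm] := compact_EVT_max (ex_intro _ _ z0) cKS f_cont.
exists (f z1.2 z1.1) => q t Kq tS; apply: (Hm (q, t)).
by rewrite inE; split=> //=; rewrite in_itv.
Qed.

End Comparison.

Lemma flow_solution (t2 : R) : 0 < t2 -> (t2%:E < tmax)%E ->
  exists w1 w2 (al be : R -> R), [/\ 0 < w2, w2 <= w1,
    k = (w1 ^+ 2 + w1 * w2 + w2 ^+ 2) / 3 /\ c6 = - (w1 * w2 * (w1 + w2)),
    forall t, 0 <= t <= t2 -> [/\ 0 < al t, 0 <= be t,
      al t ^+ 3 - 3 * k * al t * be t ^+ 2 + c6 * be t ^+ 3 = 1,
      is_derive t 1 al (4 * k * al t * be t - 2 * c6 * be t ^+ 2) &
      is_derive t 1 be (2 * al t ^+ 2 - 2 * k * be t ^+ 2)] &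
    forall q t, LC hat w q k c6 -> 0 < t <= t2 -> [/\ w2 <= w q <= w1,
      f t q = al t + be t * w q & W t q = flow_curv k c6 (al t) (be t) (w q)]].
Proof.
move=> t20 t2m.
(* With S strictly between t2 and tmax, t2 is interior to [0, S], as [curvature_flow_curv] needs,
   and f is bounded on [0, S]. *)
have [S [St Sm]] : exists S, t2 < S /\ (S%:E < tmax)%E.
  case: tmax t2m => [r| |]//=; last by move=> _; exists (t2 + 1); rewrite ltrDl ltry.
  rewrite lte_fin => t2r; exists ((t2 + r) / 2); rewrite lte_fin; split; lra.
have S0 : 0 < S by exact: lt_trans St.
have [w1 [w2 [w20 w21 kE cE wb]]] := extrema.
have [B fB] := conf_factor_bounded S0 Sm.
have := cubic_ode w20 w21 B; rewrite -kE -cE => -[T [al [be [T0 al0 be0 BT H]]]].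
have w10 : 0 < w q0 by [].
(* If T <= S, then f at (q0, T) would be al T + be T w q0 > B, against the choice of B. *)
have TS : S < T.
  rewrite ltNge; apply/negP => TS.
  have Tm : (T%:E < tmax)%E by rewrite (le_lt_trans _ Sm)// lee_fin.
  have TT : 0 <= T <= T by rewrite lexx ltW.
  have := @conf_factor_affine al be T Tm al0 be0
    (fun t tT => let: And5 _ _ _ d _ := H t tT in d) (fun t tT => let: And5 _ _ _ _ d := H t tT in d)
    q0 T lc0 TT.
  have := fB q0 T lc0; rewrite (ltW T0) TS => /(_ erefl) h1 h2.
  have [_ b0 _ _ _] := H T TT.
  have : 0 <= be T * w q0 by rewrite mulr_ge0// ltW.
  lra.
have HS t : 0 <= t <= S -> 0 <= t <= T by lra.
exists w1, w2, al, be; split=> //.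
  by move=> t tt; apply: H; lra.
move=> q t Kq tt; have tS : 0 <= t <= S by lra.
have dal t' (h : 0 <= t' <= S) := let: And5 _ _ _ d _ := H t' (HS t' h) in d.
have dbe t' (h : 0 <= t' <= S) := let: And5 _ _ _ _ d := H t' (HS t' h) in d.
split; first exact: wb.
  exact: (conf_factor_affine Sm al0 be0 dal dbe Kq tS).
apply: (curvature_flow_curv Sm al0 be0 dal dbe Kq); first by lra.
have [a0 b0 _ _ _] := H t (HS t tS).
by rewrite gt_eqF// ltr_wpDr// mulr_ge0// ltW.
Qed.

End Solution.

(** * Legendrian paths *)

(* No measurability is needed: the integral of a nonnegative function is the supremum of the
   integrals of the simple functions below it. *)
Lemma ge0_le_integral_any d (T : measurableType d) (R : realType)
    (mu : {measure set T -> \bar R}) (D : set T) (g h : T -> \bar R) :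
  (forall x, D x -> 0 <= g x)%E -> (forall x, D x -> g x <= h x)%E ->
  (\int[mu]_(x in D) g x <= \int[mu]_(x in D) h x)%E.
Proof.
move=> g0 gh; have h0 x : D x -> (0 <= h x)%E by move=> Dx; exact: le_trans (g0 x Dx) (gh x Dx).
rewrite !ge0_integralE//; apply: le_ereal_sup => _ [s sg <-]; exists s => // x.
apply: le_trans (sg x) _; rewrite /patch; case: ifPn => //; rewrite inE; exact: gh.
Qed.

Lemma le_integral_any d (T : measurableType d) (R : realType)
    (mu : {measure set T -> \bar R}) (D : set T) (g h : T -> \bar R) :
  (forall x, D x -> 0 <= h x)%E -> (forall x, D x -> g x <= h x)%E ->
  (\int[mu]_(x in D) g x <= \int[mu]_(x in D) h x)%E.
Proof.
move=> h0 gh; rewrite integralE; apply: (@le_trans _ _ (\int[mu]_(x in D) (g ^\+ x))%E).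
  by apply: geeDl; rewrite oppe_le0; apply: integral_ge0.
apply: ge0_le_integral_any => x Dx; first exact: funepos_ge0.
by rewrite funeposE ge_max gh// h0.
Qed.

Section Path.
Context {R : realType} (X : CR3 R) (hat : form1 X) (tmax : \bar R) (theta : R -> form1 X)
  (W : R -> X -> R) (w : X -> R).
Hypotheses (Xc : compact [set: X]) (sph : spherical X) (hc : is_contact_form hat)
  (htf : vanishing_torsion hat) (htw : is_TW_curvature hat w) (w0 : forall p, 0 < w p).
Hypotheses (tmax_gt0 : (0 < tmax)%E) (flow : yamabe_flow tmax theta W)
  (theta_init : forall c x, img c x -> theta 0 c x = hat c x).

Lemma flow_curv_W_gt0 t p : 0 < t -> (t%:E < tmax)%E -> 0 < W t p.
Proof.
move=> t0 tm; have [k [c6 lc]] := LC_exists sph hc htf htw p.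
have [w1 [w2 [al [be [w20 w21 [kE cE] H F]]]]] :=
  flow_solution Xc sph hc htf htw w0 tmax_gt0 flow theta_init lc t0 tm.
have tt : 0 <= t <= t by rewrite lexx ltW.
have [a0 b0 D1 _ _] := H t tt.
have [/andP[u1 u2] _ ->] := F p t lc (introT andP (conj t0 (lexx t))).
by rewrite kE cE in D1 *; exact: flow_curv_gt0.
Qed.

Variables (t1 t2 : R) (g : R -> X).
Hypotheses (t10 : 0 < t1) (t12 : t1 < t2) (t2m : (t2%:E < tmax)%E) (leg : legendrian t1 t2 g).
Let I : set R := `[t1, t2]%classic.
Let u (s : R) := w (g s).
Let D (s : R) : R := deriv_in I u s.

Let IP (s : R) : I s -> t1 <= s <= t2. Proof. by rewrite /I /= in_itv. Qed.

Let IP0 (s : R) : I s -> 0 < s <= t2.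
Proof. by move=> /IP/andP[s1 s2]; rewrite (lt_le_trans t10 s1). Qed.

(** The points with given constants form an open and closed set, and the image of the path is
    connected. *)
Lemma path_LC k c6 : LC hat w (g t1) k c6 -> forall s, I s -> LC hat w (g s) k c6.
Proof.
move=> lc; have [gc _ _] := leg.
pose K := [set q | LC hat w q k c6].
have oK : open K by rewrite openE => q Kq; exact: LC_near.
have cK : closed K.
  rewrite -[K]setCK; apply: open_closedC; rewrite openE => q nK.
  have [k' [c' lcq]] := LC_exists sph hc htf htw q.
  apply: filterS (LC_near lcq) => q' lc' Kq'; apply: nK.
  have [e1 e2] := LC_uniq sph hc htf htw lc' Kq'.
  by rewrite /K /= -e1 -e2.
have cn := connected_continuous_connected (@segment_connected R t1 t2) gc.
have I1 : I t1 by rewrite /I /= in_itv /= lexx ltW.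
have E : g @` I `&` K = g @` I.
  apply: cn; [|by exists K|by exists K].
  by exists (g t1); split=> //; exists t1.
move=> s Is; have : (g @` I) (g s) by exists s.
by rewrite -E => -[].
Qed.

Lemma path_chart c t : I t -> dom c (g t) -> exists N (h : R -> 'rV[R]_3) U,
  [/\ open N, N t, smooth_open N h, open U & smooth_open U (w \o param c)] /\
  (forall s, N s -> U (h s)) /\ (forall s, I s -> N s -> dom c (g s) /\ coord c (g s) = h s).
Proof.
move=> It dt; have [gc gs _] := leg.
have [N [h [oN Nt hs hE]]] := gs c t (conj It dt).
have [U [oU Ux _ wU]] := w_smooth sph hc htf htw dt.
have ht : h t = coord c (g t) by rewrite -hE.
have nd : \forall s \near t, I s -> dom c (g s).
  have gt : g @ within I (nbhs t) --> g t by move/subspace_continuousP : gc => /(_ t It).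
  exact: (gt _ (open_nbhs_nbhs (conj (@dom_open _ _ _ c) dt))).
have nU : \forall s \near t, U (h s).
  have hc' := Ck_cont (hs 0%N) Nt.
  by apply: hc'; apply: open_nbhs_nbhs; rewrite ht.
have nN : \forall s \near t, N s by exact: open_nbhs_nbhs.
pose N' := [set s | N s /\ U (h s) /\ (I s -> dom c (g s))]^°.
have oN' : open N' by exact: open_interior.
have N'P s : N' s -> N s /\ U (h s) /\ (I s -> dom c (g s)) by exact: interior_subset.
exists N', h, U; split; [split=> //|split].
- by apply: filterI nN (filterI nU nd).
- by move=> n; apply: Ck_sub (hs n) => s /N'P[].
- by move=> s /N'P[_ []].
move=> s Is /N'P[Ns [_ /(_ Is) ds]]; split=> //.
by apply: hE => //; split.
Qed.

(** D is one-sided at t1 and t2. The local extension h, smooth across the end points, provides the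
    continuity of D on the closed segment, and the chain rule expresses D by the velocity. *)
Lemma path_derivative c t : I t -> dom c (g t) -> exists N (h : R -> R),
  [/\ open N, N t, Ck 1 N h & forall s, I s -> N s -> u s = h s /\ D s = 'D_1 h s] /\
  D t = 'D_(velocity I g c t) (w \o param c) (coord c (g t)).
Proof.
move=> It dt; have [N [h [U [[oN Nt hs oU wU] [NU hE]]]]] := path_chart It dt.
have hh1 : Ck 1 N ((w \o param c) \o h) by apply: Ck_comp oN oU NU hs (wU 1%N).
have uE s : I s -> N s -> u s = ((w \o param c) \o h) s.
  by move=> Is Ns; have [ds e] := hE s Is Ns; rewrite /= -e coordK.
have DE s : I s -> N s -> D s = 'D_1 ((w \o param c) \o h) s.
  move=> Is Ns; apply: deriv_in_eq (segment_proper t12 (IP Is)) Is _ (Ck_derivable hh1 Ns).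
  have nN : \forall z \near s, N z by exact: open_nbhs_nbhs.
  by apply: filterS nN => z Nz Iz; exact: uE.
exists N, ((w \o param c) \o h); split; first by split=> // s Is Ns; split; [exact: uE|exact: DE].
have hd : derivable h t 1 by exact: Ck_derivable (hs 1%N) Nt.
have vE : velocity I g c t = 'D_1 h t.
  apply: deriv_in_eq (segment_proper t12 (IP It)) It _ hd.
  have nN : \forall z \near t, N z by exact: open_nbhs_nbhs.
  by apply: filterS nN => z Nz Iz; have [] := hE z Iz Nz.
have [_ ch] := hE t It Nt.
have [_ e] := is_derive_chain oU (NU t Nt) (wU 1%N) hd.
by rewrite (DE t It Nt) e vE ch (derive_sum_delta _ oU (NU t Nt) (wU 1%N)).
Qed.

Lemma path_is_derive t : t1 < t < t2 -> is_derive t 1 u (D t).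
Proof.
move=> tt; have It : I t by rewrite /I /= in_itv /=; lra.
have [c dt] := dom_chart (g t); have [N [h [[oN Nt h1 E] _]]] := path_derivative It dt.
have [_ ->] := E t It Nt.
have dh : is_derive t 1 h ('D_1 h t) by apply: DeriveDef => //; exact: Ck_derivable h1 Nt.
apply: near_eq_is_derive dh.
have nN : \forall s \near t, N s by exact: open_nbhs_nbhs.
have nI : \forall s \near t, t1 < s < t2.
  near=> s; apply/andP; split; near: s; [apply: lt_nbhsr|apply: lt_nbhsl]; lra.
apply: filterS2 nN nI => s Ns ss; apply/esym; apply: (E s _ Ns).1.
by rewrite /I /= in_itv /=; lra.
Unshelve. all: by end_near. Qed.

Lemma path_continuous t : I t ->
  u s @[s --> within I (nbhs t)] --> u t /\ D s @[s --> within I (nbhs t)] --> D t.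
Proof.
move=> It; have [c dt] := dom_chart (g t).
have [N [h [[oN Nt h1 E] _]]] := path_derivative It dt.
have nN : \forall s \near within I (nbhs t), I s /\ N s.
  have nN : \forall z \near t, N z by exact: open_nbhs_nbhs.
  by apply: filterS nN => s Ns Is.
split.
  have ne : \forall s \near within I (nbhs t), h s = u s.
    by apply: filterS nN => s [Is Ns]; have [] := E s Is Ns.
  apply: cvg_trans (near_eq_cvg ne) _; have [-> _] := E t It Nt.
  apply: cvg_within_filter; exact: (Ck_cont h1 Nt).
have ne : \forall s \near within I (nbhs t), 'D_1 h s = D s.
  by apply: filterS nN => s [Is Ns]; have [] := E s Is Ns.
apply: cvg_trans (near_eq_cvg ne) _; have [_ ->] := E t It Nt.
have c0 : {for t, continuous (fun s => 'D_1 h s)}.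
  by have [_ /(_ 1)[_ [cD _]]] := h1; exact: cD.
exact: (@cvg_within_filter _ _ _ (nbhs t) _ _ _ c0).
Qed.

(** * Integration of the Harnack inequality along a path *)

Section Rate.
Variables (k c6 w1 w2 : R) (al be : R -> R).
Hypotheses (lc : LC hat w (g t1) k c6) (w20 : 0 < w2) (w21 : w2 <= w1)
  (kE : k = (w1 ^+ 2 + w1 * w2 + w2 ^+ 2) / 3) (cE : c6 = - (w1 * w2 * (w1 + w2))).
Hypothesis H : forall t : R, 0 <= t <= t2 -> [/\ 0 < al t, 0 <= be t,
  al t ^+ 3 - 3 * k * al t * be t ^+ 2 + c6 * be t ^+ 3 = 1,
  is_derive t 1 al (4 * k * al t * be t - 2 * c6 * be t ^+ 2) &
  is_derive t 1 be (2 * al t ^+ 2 - 2 * k * be t ^+ 2)].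
Hypothesis F : forall q (t : R), LC hat w q k c6 -> 0 < t <= t2 -> [/\ w2 <= w q <= w1,
  conf_factor hat (theta t) q = al t + be t * w q & W t q = flow_curv k c6 (al t) (be t) (w q)].

Let H' (t : R) : 0 <= t <= t2 -> [/\ 0 < al t, 0 <= be t,
  al t ^+ 3 - 3 * ((w1 ^+ 2 + w1 * w2 + w2 ^+ 2) / 3) * al t * be t ^+ 2 +
    - (w1 * w2 * (w1 + w2)) * be t ^+ 3 = 1,
  is_derive t 1 al (4 * ((w1 ^+ 2 + w1 * w2 + w2 ^+ 2) / 3) * al t * be t -
    2 * - (w1 * w2 * (w1 + w2)) * be t ^+ 2) &
  is_derive t 1 be (2 * al t ^+ 2 - 2 * ((w1 ^+ 2 + w1 * w2 + w2 ^+ 2) / 3) * be t ^+ 2)].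
Proof. by rewrite -kE -cE; exact: H. Qed.

Let rate := harnack_rate w1 w2 al be u D.

Lemma path_curv (t : R) : I t -> W t (g t) = flow_curv k c6 (al t) (be t) (u t).
Proof.
move=> It; have tp := IP0 It.
by have [_ _ ->] := F (path_LC lc It) tp.
Qed.

Lemma speed_ge (t : R) : I t -> 0 <= speed2 (theta t) t1 t2 g t /\
  - 16 * (rate t + 2 / t) <= speed2 (theta t) t1 t2 g t.
Proof.
move=> It; have tt := IP It; have tp := IP0 It.
have lct := path_LC lc It.
have [ub fE WE] := F lct tp.
have It' : time_range tmax t.
  by split; [lra|rewrite (le_lt_trans _ t2m)// lee_fin; lra].
have [_ ctc ctw _] := flow; have [_ _ lg] := leg.
(* The speed is picked among all r of this form, so the estimate is proved for each of them;
   [levi_exists] below excludes the default value 0 of [xget]. *)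
have key r : (exists c, dom c (g t) /\ is_levi (theta t) c (coord c (g t))
    (velocity I g c t) (velocity I g c t) r) -> 0 <= r /\ - 16 * (rate t + 2 / t) <= r.
  move=> [c [dt lev]]; have r0 := levi_ge0 lev; split=> //.
  have := levi_ineq sph hc htf htw (ctc t It') (ctw t It')
    (fun c x => @ftheta _ _ hat tmax theta W hc flow c x t It') dt lct lev.
  have [_ [_ [_ <-]]] := path_derivative It dt.
  rewrite fE kE cE => Dr.
  have [/andP[tp1 tp2] /andP[u1 u2]] := conj tp ub.
  have := harnack_rate_ge (u := u) (D := D) w20 w21 H' tp1 tp2 u1 u2 r0 Dr.
  rewrite -/(rate t); lra.
rewrite /speed2; case: xgetP => [r _ hr|none]; first exact: key.
have [c dt] := dom_chart (g t); have xc : img c (coord c (g t)) by exists (g t).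
have [r lev] := levi_exists (ctc t It') (ctw t It') xc (lg c t It dt).
by case: (none r); exists c.
Qed.

Local Notation E s := (flow_curv ((w1 ^+ 2 + w1 * w2 + w2 ^+ 2) / 3) (- (w1 * w2 * (w1 + w2)))
  (al s) (be s) (u s)).

Lemma path_cvg (t : R) : I t ->
  [/\ al s @[s --> within I (nbhs t)] --> al t, be s @[s --> within I (nbhs t)] --> be t,
    flow_factor (al s) (be s) (u s) @[s --> within I (nbhs t)] --> flow_factor (al t) (be t) (u t),
    E s @[s --> within I (nbhs t)] --> E t & flow_factor (al t) (be t) (u t) != 0 /\ 0 < E t].
Proof.
move=> It; have tp := IP0 It.
have tI : 0 <= t <= t2 by have /andP[/ltW-> ->] := IP0 It.
have [a0 b0 D1 da db] := H' tI.
have [cu cD] := path_continuous It.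
have fin (h : R -> R) d : is_derive t 1 h d -> h s @[s --> within I (nbhs t)] --> h t.
  move=> [hd _]; apply: (@cvg_within_filter _ _ _ (nbhs t)).
  by apply: differentiable_continuous; apply/derivable1_diffP.
have ca := fin _ _ da; have cb := fin _ _ db.
have [ub _ _] := F (path_LC lc It) tp.
have /andP[u1 u2] := ub.
have f0 : flow_factor (al t) (be t) (u t) != 0 by rewrite gt_eqF// (flow_factor_gt0 w20).
have E0 : 0 < E t by exact: flow_curv_gt0.
have cf : flow_factor (al s) (be s) (u s) @[s --> within I (nbhs t)] -->
    flow_factor (al t) (be t) (u t) by exact: (cvgD ca (cvgM cb cu)).
have ca2 : al s ^+ 2 @[s --> within I (nbhs t)] --> al t ^+ 2 by exact: (cvgM ca ca).
have cb2 : be s ^+ 2 @[s --> within I (nbhs t)] --> be t ^+ 2 by exact: (cvgM cb cb).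
have cN : flow_num ((w1 ^+ 2 + w1 * w2 + w2 ^+ 2) / 3) (- (w1 * w2 * (w1 + w2)))
    (al s) (be s) (u s) @[s --> within I (nbhs t)] -->
    flow_num ((w1 ^+ 2 + w1 * w2 + w2 ^+ 2) / 3) (- (w1 * w2 * (w1 + w2))) (al t) (be t) (u t).
  apply: cvgD; first apply: cvgB.
  - exact: (cvgM (cvgM (cvgM (cvg_cst _) ca) cb) (cvg_cst _)).
  - exact: (cvgM cb2 (cvg_cst _)).
  - exact: (cvgM cu (cvgB ca2 (cvgM cb2 (cvg_cst _)))).
split=> //; exact: (cvgM cN (cvgV f0 cf)).
Qed.

Lemma rate_continuous : {within I, continuous rate}.
Proof.
apply/subspace_continuousP => t It.
have [ca cb cf cE' [f0 /lt0r_neq0 E0]] := path_cvg It; have [_ cD] := path_continuous It.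
have ca2 : al s ^+ 2 @[s --> within I (nbhs t)] --> al t ^+ 2 by exact: (cvgM ca ca).
have cb2 : be s ^+ 2 @[s --> within I (nbhs t)] --> be t ^+ 2 by exact: (cvgM cb cb).
have ck4 : 4 * flow_kap ((w1 ^+ 2 + w1 * w2 + w2 ^+ 2) / 3) (- (w1 * w2 * (w1 + w2)))
    (al s) (be s) @[s --> within I (nbhs t)] -->
    4 * flow_kap ((w1 ^+ 2 + w1 * w2 + w2 ^+ 2) / 3) (- (w1 * w2 * (w1 + w2))) (al t) (be t).
  apply: cvgM; first exact: cvg_cst.
  apply: cvgD; first apply: cvgB.
  - exact: (cvgM (cvg_cst _) ca2).
  - exact: (cvgM (cvg_cst _) (cvgM ca cb)).
  - exact: (cvgM (cvg_cst _) cb2).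
have cEE : E s ^+ 2 @[s --> within I (nbhs t)] --> E t ^+ 2 by exact: (cvgM cE' cE').
have cff : flow_factor (al s) (be s) (u s) ^+ 2 @[s --> within I (nbhs t)] -->
    flow_factor (al t) (be t) (u t) ^+ 2 by exact: (cvgM cf cf).
have f2 : flow_factor (al t) (be t) (u t) ^+ 2 != 0 by rewrite expf_neq0.
have c2 : D s / flow_factor (al s) (be s) (u s) ^+ 2 @[s --> within I (nbhs t)] -->
    D t / flow_factor (al t) (be t) (u t) ^+ 2 by exact: (cvgM cD (cvgV f2 cff)).
have cE2 : 2 * E s ^+ 2 @[s --> within I (nbhs t)] --> 2 * E t ^+ 2.
  by exact: (cvgM (cvg_cst _) cEE).
have ci : (E s)^-1 @[s --> within I (nbhs t)] --> (E t)^-1 by exact: (cvgV E0 cE').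
have : (4 * flow_kap ((w1 ^+ 2 + w1 * w2 + w2 ^+ 2) / 3) (- (w1 * w2 * (w1 + w2))) (al s) (be s)
   - 2 * E s ^+ 2 + D s / flow_factor (al s) (be s) (u s) ^+ 2) / E s
   @[s --> within I (nbhs t)] --> rate t by exact: (cvgM (cvgD (cvgB ck4 cE2) c2) ci).
by [].
Qed.

(** A primitive of the lower bound - 16 (rate + 2 / t) of the squared speed; its increment involves
    the end points only. *)
Let Psi t := - 16 * (ln (flow_curv k c6 (al t) (be t) (u t)) + 2 * ln t).

Lemma Psi_is_derive (t : R) : t1 < t < t2 -> is_derive t 1 Psi (- 16 * (rate t + 2 / t)).
Proof.
move=> tt; have It : I t by rewrite /I /= in_itv /=; lra.
have /andP[t0 _] := IP0 It.
have tp := IP0 It.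
have [ub _ _] := F (path_LC lc It) tp.
have /andP[u1 u2] := ub.
have tI : 0 <= t <= t2 by have /andP[/ltW-> ->] := IP0 It.
have := is_derive_ln_flow_curv (u := u) (D := D) w20 w21 H' tI u1 (path_is_derive tt).
rewrite -/(rate t) -kE -cE => d1; have d2 := is_derive1_ln t0.
rewrite /Psi; apply: is_derive_eq; rewrite /GRing.scale /=; ring.
Qed.

Lemma Psi_continuous (t : R) : I t -> Psi s @[s --> within I (nbhs t)] --> Psi t.
Proof.
move=> It; have /andP[t0 _] := IP0 It.
have [_ _ _ cE' [_ E0]] := path_cvg It; rewrite /Psi kE cE.
apply: cvgM; first exact: cvg_cst.
apply: cvgD; first exact: (cvg_comp _ _ cE' (continuous_ln E0)).
apply: cvgM; first exact: cvg_cst.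
apply: (@cvg_within_filter _ _ _ (nbhs t)); exact: continuous_ln.
Qed.

(** By [speed_ge] the integrand dominates the derivative of Psi, whose formula is continuous up to
    the end points, so the fundamental theorem of calculus applies. *)
Lemma energy_ge : ((Psi t2 - Psi t1)%:E <=
  \int[@lebesgue_measure R]_(t in `[t1, t2]) (speed2 (theta t) t1 t2 g t)%:E)%E.
Proof.
have cphi : {within I, continuous (fun t => - 16 * (rate t + 2 / t))}.
  apply/subspace_continuousP => t It.
  have t0 : t != 0 by have /andP[h _] := IP0 It; rewrite gt_eqF.
  apply: cvgM; first exact: cvg_cst.
  apply: cvgD; first by move/subspace_continuousP : rate_continuous => /(_ t It).
  apply: cvgM; first exact: cvg_cst.
  by apply: cvgV t0 _; apply: (@cvg_within_filter _ _ _ (nbhs t)); exact: cvg_id.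
have cPsi : {within I, continuous Psi}.
  by apply/subspace_continuousP => t It; exact: Psi_continuous.
have [_ cl cr] : [/\ True, Psi @ t1^'+ --> Psi t1 & Psi @ t2^'- --> Psi t2].
  by move/(continuous_within_itvP _ t12) : cPsi => [].
have ftc := @continuous_FTC2 R (fun t => - 16 * (rate t + 2 / t)) Psi t1 t2 t12 cphi.
rewrite EFinB -ftc.
- apply: le_integral_any => t It; rewrite lee_fin.
    by have [] := speed_ge It.
  by have [] := speed_ge It.
- apply: (And3 _ cl cr) => t; rewrite in_itv /= => tt.
  by have [dt _] := Psi_is_derive tt; exact: dt.
- move=> t; rewrite in_itv /= => tt; rewrite derive1E.
  have [_ dt] := Psi_is_derive tt; exact: dt.
Qed.

End Rate.

Lemma energy_lower_bound :
  ((- 16 * (ln (W t2 (g t2) / W t1 (g t1)) + 2 * ln (t2 / t1)))%:E <=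
  \int[@lebesgue_measure R]_(t in `[t1, t2]) (speed2 (theta t) t1 t2 g t)%:E)%E.
Proof.
have [k [c6 lc]] := LC_exists sph hc htf htw (g t1).
have t20 : 0 < t2 by exact: lt_trans t12.
have t1m : (t1%:E < tmax)%E by rewrite (lt_trans _ t2m)// lte_fin.
have [w1 [w2 [al [be [w20 w21 [kE cE] H F]]]]] :=
  flow_solution Xc sph hc htf htw w0 tmax_gt0 flow theta_init lc t20 t2m.
apply: le_trans (energy_ge lc w20 w21 kE cE H F); rewrite lee_fin.
have I1 : I t1 by rewrite /I /= in_itv /= lexx ltW.
have I2 : I t2 by rewrite /I /= in_itv /= lexx ltW.
rewrite -(path_curv lc F I1) -(path_curv lc F I2).
have W1 := flow_curv_W_gt0 (g t1) t10 t1m; have W2 := flow_curv_W_gt0 (g t2) t20 t2m.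
rewrite !ln_div ?posrE//; lra.
Qed.

End Path.

Theorem theoremB (R : realType) (X : CR3 R) (thetahat : form1 X)
    (tmax : \bar R) (theta : R -> form1 X) (W : R -> X -> R)
    (X_closed : compact [set: X])
    (X_spherical : spherical X)
    (hat_contact : is_contact_form thetahat)
    (hat_positive : positive_psh thetahat)
    (hat_torsion : vanishing_torsion thetahat)
    (hat_curvature : exists2 What : X -> R,
       is_TW_curvature thetahat What & forall p, 0 < What p)
    (tmax_gt0 : (0 < tmax)%E)
    (flow : yamabe_flow tmax theta W)
    (theta_init : forall c x, img c x -> theta 0 c x = thetahat c x)
    (x1 x2 : X) (t1 t2 : R)
    (t1_gt0 : 0 < t1) (t1_lt_t2 : t1 < t2) (t2_lt_tmax : (t2%:E < tmax)%E) :
  (((t2 / t1) ^- 2)%:E *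
     expeR (- (16^-1)%:E * inf_energy theta t1 t2 x1 x2)
   <= (W t2 x2 / W t1 x1)%:E)%E.
Proof.
have [w wE w0] := hat_curvature.
have t2_gt0 : 0 < t2 by exact: lt_trans t1_lt_t2.
have t1m : (t1%:E < tmax)%E by rewrite (lt_trans _ t2_lt_tmax)// lte_fin.
have Wpos := flow_curv_W_gt0 X_closed X_spherical hat_contact hat_torsion wE w0 tmax_gt0 flow theta_init.
have W1 := Wpos _ x1 t1_gt0 t1m; have W2 := Wpos _ x2 t2_gt0 t2_lt_tmax.
(* The value of L at which the claim becomes an equality. It bounds the energy of every Legendrian
   path from below, hence the infimum, also when this is +oo for lack of paths. *)
pose c := - 16 * (ln (W t2 x2 / W t1 x1) + 2 * ln (t2 / t1)).
have lb : (c%:E <= inf_energy theta t1 t2 x1 x2)%E.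
  apply: le_ereal_inf_tmp => _ [g [leg g1 g2] <-]; rewrite /c -g1 -g2.
  exact: (energy_lower_bound X_closed X_spherical hat_contact hat_torsion wE w0 tmax_gt0 flow
    theta_init t1_gt0 t1_lt_t2 t2_lt_tmax leg).
have q0 : 0 < t2 / t1 by rewrite divr_gt0.
apply: (@le_trans _ _ (((t2 / t1) ^- 2)%:E * expeR (- (16^-1)%:E * c%:E))%E).
  apply: lee_wpmul2l; first by rewrite lee_fin invr_ge0 exprn_ge0// ltW.
  by rewrite lee_expeR !mulNe leeN2; apply: lee_wpmul2l.
rewrite -EFinN -EFinM /= lee_fin /c.
rewrite (_ : - 16^-1 * _ = ln (W t2 x2 / W t1 x1) + 2 * ln (t2 / t1)); last by field.
rewrite expRD expRM_natl !lnK ?posrE ?divr_gt0// mulrCA mulVf ?mulr1//.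
by rewrite expf_neq0// gt_eqF.
Qed.
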